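(* Let $R\colon\mathscr{A}\to\mathscr{A}$ be the unitary antipode, $R=S\circ\tau_{\mathrm{i}/2}\circ\vartheta$. The map $R$ is unital, linear, $*$-preserving and anti-multiplicative. It satisfies $$R(\alpha)=\alpha^*,\quad R(\alpha^* )=\alpha,\quad R(\gamma)=-\zeta^{\frac12}\tfrac{\overline{q}}{|q|}\gamma,\quad R(\gamma^* )=-\zeta^{\frac12}\tfrac{\overline{q}}{|q|}\gamma^*.$$ Moreover $R$ is invertible with $R^2=\mathrm{id}$. We have $\boldsymbol{h}\circ R=\boldsymbol{h}$ and $R$ is $\mathbb{T}$-equivariant. Furthermore $R$ extends to a bounded map on the $C^*$-algebra $A$ and to a bounded, normal map on the von Neumann algebra $M$, with analogous properties (the extensions are unital, linear, $*$-preserving, anti-multiplicative, square to the identity, preserve $\boldsymbol{h}$ and are $\mathbb{T}$-equivariant).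
   Context: Fix $q\in\mathbb{C}$ with $0<|q|<1$ and put $\zeta=q/\overline{q}\in\mathbb{T}$. Powers of $\zeta$ are defined by $\zeta^w=\mathrm{e}^{w\operatorname{Log}\zeta}$ with $\operatorname{Log}\zeta\in\mathrm{i}\,]-\pi,\pi]$. $A$ is the universal unital $C^*$-algebra generated by $\alpha,\gamma$ with $\alpha^*\alpha+\gamma^*\gamma=1$, $\alpha\alpha^*+|q|^2\gamma^*\gamma=1$, $\alpha\gamma=\overline{q}\gamma\alpha$, $\gamma\gamma^*=\gamma^*\gamma$ (these imply $\alpha\gamma^*=q\gamma^*\alpha$). $\mathscr{A}\subseteq A$ is the unital $*$-subalgebra generated algebraically by $\alpha,\gamma$. Let $\boldsymbol{z}\in C(\mathbb{T})$ be the identity function. $\mathbb{T}$ acts on $A$ via $\rho^A\colon A\to C(\mathbb{T})\otimes A$, $\rho^A(\alpha)=1\otimes\alpha$, $\rho^A(\gamma)=\boldsymbol{z}\otimes\gamma$; $x$ is homogeneous of degree $\deg(x)=n$ if $\rho^A(x)=\boldsymbol{z}^n\otimes x$. $\rho^A_\lambda=(\mathrm{ev}_{\lambda^{-1}}\otimes\mathrm{id})\circ\rho^A$ for $\lambda\in\mathbb{T}$. $S\colon\mathscr{A}\to\mathscr{A}$ (the antipode) is the unique unital, linear, degree-preserving map with $S(\alpha)=\alpha^*$, $S(\alpha^* )=\alpha$, $S(\gamma)=-\overline{q}\gamma$, $S(\gamma^* )=-\tfrac1q\gamma^*$ and $S(ab)=\zeta^{-\deg(a)\deg(b)}S(b)S(a)$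 for homogeneous $a,b$. The scaling group is the one-parameter automorphism group of $A$ with $\tau_t(\alpha)=\alpha$, $\tau_t(\gamma)=|q|^{2\mathrm{i}t}\gamma$; for $w\in\mathbb{C}$, $\tau_w\colon\mathscr{A}\to\mathscr{A}$ is its entire analytic extension, i.e. $\tau_w(a)=|q|^{2\mathrm{i}w\deg(a)}a$ for homogeneous $a\in\mathscr{A}$. The residual mapping $\vartheta\colon\mathscr{A}\to\mathscr{A}$ is the linear map with $\vartheta(a)=\zeta^{\frac12\deg(a)^2}a$ for homogeneous $a$. The state $\boldsymbol{h}$: let $B$ be the universal unital $C^*$-algebra generated by $\alpha,\gamma,z$ where $\alpha,\gamma$ satisfy the defining relations of $A$ and $z$ is unitary with $z\alpha z^*=\alpha$, $z\gamma z^*=\zeta^{-1}\gamma$; with $\Delta_B(\alpha)=\alpha\otimes\alpha-q\gamma^*z\otimes\gamma$, $\Delta_B(\gamma)=\gamma\otimes\alpha+\alpha^*z\otimes\gamma$, $\Delta_B(z)=z\otimes z$ it is a compact quantum group; $\boldsymbol{h}_B$ is its Haar state. With $\kappa\colon A\to B$ the unital $*$-homomorphism $\alpha\mapsto\alpha,\gamma\mapsto\gamma$, put $\boldsymbol{h}=\boldsymbol{h}_B\circ\kappa$, a faithful state on $A$. $M$ is the von Neumann algebra generated by the image of $A$ in the GNS representation of $\boldsymbol{h}$ (so $A\subseteq M$); $\boldsymbol{h}$ and each $\rho^A_\lambda$ extend to $M$, giving a normal faithful state and a point-weak$^*$ continuous action of $\mathbb{T}$ on $M$. *)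

(* Defs.v *)
From HB Require Import structures.
From mathcomp Require Import all_boot all_order all_algebra.
From mathcomp Require Import complex.
From mathcomp Require Import all_classical all_reals all_analysis.
Set Implicit Arguments.
Unset Strict Implicit.
Unset Printing Implicit Defensive.
Import Order.TTheory GRing.Theory Num.Theory numFieldNormedType.Exports.
Local Open Scope classical_set_scope.
Local Open Scope ring_scope.
Local Open Scope complex_scope.

(* R[i] carries no topology of its own in the library: take the one of its
   norm. *)
HB.instance Definition _ (R : realType) :=
  PseudoMetricNormedZmod.copy R[i] (R[i] : numFieldType)^o.

(* Principal branch: [carg z] lies in ]-pi, pi] for z != 0, since acos takes
   its values in [0, pi]. *)
Definition carg {R : realType} (z : R[i]) : R :=
  let t := acos (complex.Re z / complex.Re `|z|) in
  if complex.Im z < 0 then - t else t.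

Definition clog {R : realType} (z : R[i]) : R[i] :=
  ln (complex.Re `|z|) +i* carg z.

Definition cexp {R : realType} (z : R[i]) : R[i] :=
  (expR (complex.Re z))%:C * (cos (complex.Im z) +i* sin (complex.Im z)).

Definition cpow {R : realType} (z w : R[i]) : R[i] := cexp (w * clog z).

Definition circle {R : realType} : set R[i] := [set l | `|l| = 1].

Definition linear_on {R : realType} {U V : lmodType R[i]} (D : set U)
    (f : U -> V) : Prop :=
  forall (c : R[i]) x y, D x -> D y -> f (c *: x + y) = c *: f x + f y.

Definition is_submodule {R : realType} {U : lmodType R[i]} (D : set U) : Prop :=
  D 0 /\ forall (c : R[i]) x y, D x -> D y -> D (c *: x + y).

Definition lin_span {R : realType} {U : lmodType R[i]} (X : set U) : set U :=
  smallest is_submodule X.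

(* Unital C*-algebras. The ring structure is part of the mixin because the
   library has no join of its rings with its normed modules. *)
HB.mixin Record hasCStarAlgebra (R : realType) A
    of CompleteNormedModule (R[i] : numFieldType) A := {
  amul : A -> A -> A ;
  aone : A ;
  star : A -> A ;
  amulA : associative amul ;
  amul1l : left_id aone amul ;
  amul1r : right_id aone amul ;
  amulDl : forall (c : R[i]) x y z,
    amul (c *: x + y) z = c *: amul x z + amul y z ;
  amulDr : forall (c : R[i]) x y z,
    amul z (c *: x + y) = c *: amul z x + amul z y ;
  starD : forall (c : R[i]) x y,
    star (c *: x + y) = (c^*)%C *: star x + star y ;
  starM : forall x y, star (amul x y) = amul (star y) (star x) ;
  starK : involutive star ;
  normM_le : forall x y, `|amul x y| <= `|x| * `|y| ;
  cstar_norm : forall x, `|amul (star x) x| = `|x| ^+ 2 }.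

#[short(type="cstarAlgType")]
HB.structure Definition CStarAlgebra (R : realType) :=
  {A of hasCStarAlgebra R A & CompleteNormedModule (R[i] : numFieldType) A}.

Arguments aone {R s}.
Notation "x ** y" := (amul x y) (at level 40, left associativity) : ring_scope.

HB.mixin Record hasInner (R : realType) H
    of CompleteNormedModule (R[i] : numFieldType) H := {
  inner : H -> H -> R[i] ;
  innerDl : forall (c : R[i]) u v w,
    inner (c *: u + v) w = c * inner u w + inner v w ;
  inner_conj : forall u v, inner v u = ((inner u v)^*)%C ;
  inner_norm : forall u, inner u u = `|u| ^+ 2 }.

#[short(type="hilbertType")]
HB.structure Definition Hilbert (R : realType) :=
  {H of hasInner R H & CompleteNormedModule (R[i] : numFieldType) H}.

Section CStarAlgebras.
Context {R : realType}.
Implicit Types A B T : cstarAlgType R.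

(* Unital *-homomorphism; boundedness is automatic. *)
Definition star_hom A B (f : A -> B) : Prop :=
  [/\ linear f, f aone = aone, forall x y, f (x ** y) = f x ** f y
    & forall x, f (star x) = star (f x)].

Definition is_star_subalgebra A (D : set A) : Prop :=
  [/\ is_submodule D, D aone, forall x y, D x -> D y -> D (x ** y)
    & forall x, D x -> D (star x)].

Definition bounded_map A B (f : A -> B) : Prop :=
  exists K : R, forall x, `|f x| <= K%:C * `|x|.

Definition is_state A (h : A -> R[i]) : Prop :=
  [/\ scalar h, forall x, 0 <= h (star x ** x) & h aone = 1].

End CStarAlgebras.

Section Operators.
Context {R : realType}.
Implicit Types H : hilbertType R.

(* Elements of B(H) are functions H -> H satisfying [bounded_op]; the module
   structure on H -> H is the pointwise one. *)
Definition bounded_op H (x : H -> H) : Prop :=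
  linear x /\ exists K : R, forall v, `|x v| <= K%:C * `|v|.

Definition adjoint H (x y : H -> H) : Prop :=
  forall u v, inner (x u) v = inner u (y v).

Definition opnorm H (x : H -> H) : R :=
  sup [set complex.Re `|x v| | v in [set v : H | `|v| <= 1]].

Definition square_summable H (xi : nat -> H) : Prop :=
  cvgn (series (fun n => `|xi n| ^+ 2)).

Definition weakstar_functional H (xi eta : nat -> H) (x : H -> H) : R[i] :=
  limn (series (fun n => inner (x (xi n)) (eta n))).

(* Neighbourhoods in the weak-* (ultraweak) topology of B(H), i.e. the initial
   topology for the functionals x |-> \sum_n <x xi_n, eta_n> with square
   summable xi and eta. *)
Definition weakstar_nbhs H (x0 : H -> H) : set_system (H -> H) :=
  [set U | exists n (xi eta : 'I_n -> nat -> H) (e : R),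
     [/\ 0 < e, forall i, square_summable (xi i),
         forall i, square_summable (eta i)
       & forall x, bounded_op x ->
           (forall i, `|weakstar_functional (xi i) (eta i) (x - x0)| < e%:C) ->
           U x]].

Definition weakstar_closed H (N : set (H -> H)) : Prop :=
  forall x, bounded_op x ->
    (forall U, weakstar_nbhs x U -> U `&` N !=set0) -> N x.

Definition is_von_neumann H (N : set (H -> H)) : Prop :=
  [/\ N `<=` @bounded_op H, is_submodule N /\ N id,
      forall x y, N x -> N y -> N (x \o y),
      forall x, N x -> exists2 y, N y & adjoint x y
    & weakstar_closed N].

Definition von_neumann_gen H (X : set (H -> H)) : set (H -> H) :=
  smallest (@is_von_neumann H) X.

Definition normal_map H (N : set (H -> H)) (F : (H -> H) -> (H -> H)) : Prop :=
  forall x, N x ->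
    cvg_to (F @ within N (weakstar_nbhs x)) (weakstar_nbhs (F x)).

Definition normal_functional H (N : set (H -> H)) (f : (H -> H) -> R[i]) : Prop :=
  forall x, N x -> cvg_to (f @ within N (weakstar_nbhs x)) (nbhs (f x)).

Definition adjoint_preserving H (N : set (H -> H))
    (F : (H -> H) -> (H -> H)) : Prop :=
  forall x y, N x -> N y -> adjoint x y -> adjoint (F x) (F y).

Definition is_rep (A : cstarAlgType R) H (rep : A -> H -> H) : Prop :=
  [/\ forall a, bounded_op (rep a), linear rep, rep aone = id,
      forall a b, rep (a ** b) = rep a \o rep b
    & forall a, adjoint (rep a) (rep (star a))].

Definition is_gns (A : cstarAlgType R) (h : A -> R[i]) H (rep : A -> H -> H)
    (Omega : H) : Prop :=
  [/\ is_rep rep, dense [set rep a Omega | a in [set: A]]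
    & forall a, inner (rep a Omega) Omega = h a].

Definition is_hilbert_tensor (H1 H2 K : hilbertType R) (t : H1 -> H2 -> K) : Prop :=
  [/\ forall v, linear (t^~ v), forall u, linear (t u),
      forall u u' v v', inner (t u v) (t u' v') = inner u u' * inner v v'
    & dense (lin_span [set t u v | u in [set: H1] & v in [set: H2]])].

(* T is the spatial (minimal) tensor product of A1 and A2, with
   a (x) b = i1 a ** i2 b: it acts faithfully on the Hilbert tensor product of
   the spaces of faithful representations of A1 and A2. *)
Definition is_cstar_tensor (A1 A2 T : cstarAlgType R)
    (i1 : A1 -> T) (i2 : A2 -> T) : Prop :=
  [/\ star_hom i1, star_hom i2, forall a b, i1 a ** i2 b = i2 b ** i1 a,
      dense (lin_span [set i1 a ** i2 b | a in [set: A1] & b in [set: A2]])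
    & exists (H1 H2 K : hilbertType R) (t : H1 -> H2 -> K)
        (pi1 : A1 -> H1 -> H1) (pi2 : A2 -> H2 -> H2) (rep : T -> K -> K),
      [/\ is_hilbert_tensor t,
          is_rep pi1 /\ injective pi1, is_rep pi2 /\ injective pi2,
          is_rep rep /\ injective rep
        & forall a b u v, rep (i1 a ** i2 b) (t u v) = t (pi1 a u) (pi2 b v)]].

(* Slice maps h (x) id and id (x) h. *)
Definition is_lslice (A1 A2 T : cstarAlgType R) (i1 : A1 -> T) (i2 : A2 -> T)
    (h : A1 -> R[i]) (s : T -> A2) : Prop :=
  [/\ linear s, bounded_map s & forall a b, s (i1 a ** i2 b) = h a *: b].

Definition is_rslice (A1 A2 T : cstarAlgType R) (i1 : A1 -> T) (i2 : A2 -> T)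
    (h : A2 -> R[i]) (s : T -> A1) : Prop :=
  [/\ linear s, bounded_map s & forall a b, s (i1 a ** i2 b) = h b *: a].

Definition is_haar_state (B BB : cstarAlgType R) (i1 i2 : B -> BB)
    (Delta : B -> BB) (h : B -> R[i]) : Prop :=
  is_state h /\
  exists s1 s2 : BB -> B,
    [/\ is_lslice i1 i2 h s1, is_rslice i1 i2 h s2,
        forall x, s1 (Delta x) = h x *: aone
      & forall x, s2 (Delta x) = h x *: aone].

End Operators.

Section BraidedSUq2.
Context {R : realType} (q : R[i]).

Definition zeta : R[i] := q / (q^*)%C.

Definition suq2_relations (A : cstarAlgType R) (alpha gamma : A) : Prop :=
  [/\ star alpha ** alpha + star gamma ** gamma = aone,
      alpha ** star alpha + `|q| ^+ 2 *: (star gamma ** gamma) = aone,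
      alpha ** gamma = (q^*)%C *: (gamma ** alpha)
    & gamma ** star gamma = star gamma ** gamma].

Definition is_universal_suq2 (A : cstarAlgType R) (alpha gamma : A) : Prop :=
  suq2_relations alpha gamma /\
  forall (C : cstarAlgType R) (x y : C), suq2_relations x y ->
    exists! f : A -> C, [/\ star_hom f, f alpha = x & f gamma = y].

Definition boson_relations (B : cstarAlgType R) (alpha gamma z : B) : Prop :=
  [/\ suq2_relations alpha gamma,
      star z ** z = aone, z ** star z = aone,
      z ** alpha ** star z = alpha
    & z ** gamma ** star z = zeta^-1 *: gamma].

Definition is_universal_boson (B : cstarAlgType R) (alpha gamma z : B) : Prop :=
  boson_relations alpha gamma z /\
  forall (C : cstarAlgType R) (x y w : C), boson_relations x y w ->
    exists! f : B -> C, [/\ star_hom f, f alpha = x, f gamma = y & f z = w].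

Definition is_comultiplication (B BB : cstarAlgType R) (i1 i2 : B -> BB)
    (alpha gamma z : B) (Delta : B -> BB) : Prop :=
  [/\ star_hom Delta,
      Delta alpha = i1 alpha ** i2 alpha
                    - q *: (i1 (star gamma ** z) ** i2 gamma),
      Delta gamma = i1 gamma ** i2 alpha + i1 (star alpha ** z) ** i2 gamma
    & Delta z = i1 z ** i2 z].

Variables (A : cstarAlgType R) (alpha gamma : A).

Definition pol : set A := smallest (@is_star_subalgebra R A) [set alpha; gamma].

(* The coaction A -> C(T) (x) A, with C(T) (x) A identified with C(T, A):
   [rho x l] is the value of the image of x at the point l. *)
Definition is_circle_coaction (rho : A -> R[i] -> A) : Prop :=
  [/\ forall x, {within circle, continuous (rho x)},
      forall l, circle l -> star_hom (rho^~ l),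
      forall l, circle l -> rho alpha l = alpha
    & forall l, circle l -> rho gamma l = l *: gamma].

Variable rho : A -> R[i] -> A.

Definition homogeneous (n : int) (x : A) : Prop :=
  forall l, circle l -> rho x l = l ^ n *: x.

(* rho_l = (ev_{l^-1} (x) id) o rho *)
Definition rho_at (l : R[i]) (x : A) : A := rho x l^-1.

Record is_antipode (S : A -> A) : Prop := {
  antipode_pol : forall a, pol a -> pol (S a) ;
  antipode_linear : linear_on pol S ;
  antipode_one : S aone = aone ;
  antipode_deg : forall n a, pol a -> homogeneous n a -> homogeneous n (S a) ;
  antipode_alpha : S alpha = star alpha ;
  antipode_star_alpha : S (star alpha) = alpha ;
  antipode_gamma : S gamma = - ((q^*)%C *: gamma) ;
  antipode_star_gamma : S (star gamma) = - (q^-1 *: star gamma) ;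
  antipode_mul : forall m n a b, pol a -> pol b ->
    homogeneous m a -> homogeneous n b ->
    S (a ** b) = cpow zeta (- (m * n)%:~R) *: (S b ** S a) }.

(* The linear map on [pol] multiplying homogeneous elements of degree n by
   c n. *)
Definition is_degree_multiplier (c : int -> R[i]) (F : A -> A) : Prop :=
  [/\ forall a, pol a -> pol (F a), linear_on pol F
    & forall n a, pol a -> homogeneous n a -> F a = c n *: a].

Definition is_scaling (tau : R[i] -> A -> A) : Prop :=
  forall w, is_degree_multiplier
    (fun n => cpow `|q| (2 * 'i%C * w * n%:~R)) (tau w).

Definition is_residual (vartheta : A -> A) : Prop :=
  is_degree_multiplier (fun n => cpow zeta (2^-1 * n%:~R ^+ 2)) vartheta.

End BraidedSUq2.

Section Extensions.
Context {R : realType} (A : cstarAlgType R) (H : hilbertType R).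
Variables (rep : A -> H -> H) (M : set (H -> H)).

Definition is_normal_extension (h : A -> R[i]) (hM : (H -> H) -> R[i]) : Prop :=
  [/\ forall (c : R[i]) x y, M x -> M y -> hM (c *: x + y) = c * hM x + hM y,
      normal_functional M hM
    & forall a, hM (rep a) = h a].

Record is_action_extension (rho : R[i] -> A -> A)
    (rhoM : R[i] -> (H -> H) -> (H -> H)) : Prop := {
  action_maps : forall l x, circle l -> M x -> M (rhoM l x) ;
  action_linear : forall l, circle l -> linear_on M (rhoM l) ;
  action_id : forall l, circle l -> rhoM l id = id ;
  action_comp : forall l x y, circle l -> M x -> M y ->
    rhoM l (x \o y) = rhoM l x \o rhoM l y ;
  action_adjoint : forall l, circle l -> adjoint_preserving M (rhoM l) ;
  action_normal : forall l, circle l -> normal_map M (rhoM l) ;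
  action_1 : forall x, M x -> rhoM 1 x = x ;
  action_mul : forall l m x, circle l -> circle m -> M x ->
    rhoM (l * m) x = rhoM l (rhoM m x) ;
  action_continuous : forall x l, M x -> circle l ->
    cvg_to ((fun m => rhoM m x) @ within circle (nbhs l))
           (weakstar_nbhs (rhoM l x)) ;
  action_extends : forall l a, circle l -> rhoM l (rep a) = rep (rho l a) }.

End Extensions.

(* Main.v *)
Require Import Defs.
From HB Require Import structures.
From mathcomp Require Import all_boot all_order all_algebra.
From mathcomp Require Import complex.
From mathcomp Require Import all_classical all_reals all_analysis.
From mathcomp Require Import ring lra.
Set Implicit Arguments.
Unset Strict Implicit.
Unset Printing Implicit Defensive.
Import Order.TTheory GRing.Theory Num.Theory numFieldNormedType.Exports.
Local Open Scope classical_set_scope.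
Local Open Scope ring_scope.
Local Open Scope complex_scope.

(* The constant c of the theorem is 1 or -1, and on generators R acts as
   alpha |-> alpha*, gamma |-> -c gamma. The opposite algebra of A satisfies the
   defining relations for these elements (this uses alpha gamma* = q gamma* alpha,
   which follows from the relations), so universality provides an involutive
   *-antiautomorphism of A; *-homomorphisms are bounded. The factors
   zeta^(deg^2/2) turn the braided antimultiplicativity of S into honest
   antimultiplicativity of R, so the two maps agree on polynomials.

   Invariance of h: translating the Haar state by the characters of B that kill
   gamma shows that h is invariant under a two-torus, hence vanishes on a
   normally ordered monomial alpha^k gamma^m gamma*^n or
   alpha*^k gamma^m gamma*^n unless k = 0 and m = n, and R fixes those
   remaining monomials. Polynomials are dense by universality.

   On M: J (a Omega) = R(a)* Omega extends to an antiunitary involution of the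
   GNS space, and x |-> J x* J is normal because
   <J x* J xi, eta> = <x J eta, J xi>. It extends R, and since M is the
   weak-* closure of A, the identities between normal maps pass from A to M. *)

(** * Real-valued norms and limits of sequences *)

Section RealNorm.
Context {R : realType}.
Local Notation C := (R[i] : numFieldType).

(** [SA], [tau] and [vartheta] are constrained only on [pol alpha gamma], and no norm bound on them
    is given. So [Rant] is not extended by continuity: an antiautomorphism [f] is built on all of
    [A], and every assertion about [Rant] is read off from [f]. Realness of [c] makes the
    coefficients on [gamma] and [star gamma] compatible with [star]; [c * c = 1] makes [f] an
    involution. Norm estimates rest on one device, a square root of [aone - b] for small
    self-adjoint [b]. It bounds star homomorphisms and representations up to a factor 2, which is
    harmless since only boundedness is claimed. In the Haar argument, [h x = 0] for a monomial [x]
    is not enough: [h (f x)] must vanish too. As [f] conjugates the phase of a torus action on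
    [alpha] and keeps the phase on [gamma], it carries torus actions to torus actions. On operators,
    the map given by [J] is defined on all of B(H) and has its algebraic properties there. The
    algebra [M] matters only for its own stability, for invariance of the extended state and for
    equivariance. *)

Definition nr {V : normedZmodType C} (x : V) : R := complex.Re `|x|.

Lemma nrE {V : normedZmodType C} (x : V) : `|x| = (nr x)%:C.
Proof. by rewrite /nr RRe_real ?normr_real. Qed.

Lemma nr_ge0 {V : normedZmodType C} (x : V) : 0 <= nr x.
Proof. by rewrite -ler0c -nrE. Qed.

Lemma nr0 {V : normedZmodType C} : nr (0 : V) = 0.
Proof. by rewrite /nr normr0. Qed.

Lemma nrN {V : normedZmodType C} (x : V) : nr (- x) = nr x.
Proof. by rewrite /nr normrN. Qed.

(** Norms of the structures are valued in [R[i]]; real-valued norms and distances make inequalities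
    accessible to real arithmetic. *)
Definition dst {V : normedZmodType C} (x y : V) : R := nr (x - y).

Lemma dst_ge0 {V : normedZmodType C} (x y : V) : 0 <= dst x y.
Proof. exact: nr_ge0. Qed.

Lemma dstC {V : normedZmodType C} (x y : V) : dst x y = dst y x.
Proof. by rewrite /dst -nrN opprB. Qed.

Lemma nrD {V : normedZmodType C} (x y : V) : nr (x + y) <= nr x + nr y.
Proof. by rewrite -lecR rmorphD /= -!nrE ler_normD. Qed.

Lemma dst_tri {V : normedZmodType C} (z x y : V) : dst x y <= dst x z + dst z y.
Proof. by rewrite /dst -[x - y](subrKA z) nrD. Qed.

Lemma dstx0 {V : normedZmodType C} (x : V) : dst x 0 = nr x.
Proof. by rewrite /dst subr0. Qed.

Lemma dstxx {V : normedZmodType C} (x : V) : dst x x = 0.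
Proof. by rewrite /dst subrr nr0. Qed.

Lemma nr_eq0 {V : normedZmodType C} (x : V) : nr x = 0 -> x = 0.
Proof. by move=> h; apply/normr0_eq0; rewrite nrE h. Qed.

Lemma nrZ {V : normedModType C} (c : C) (x : V) : nr (c *: x) = nr c * nr x.
Proof. by apply: (@complexI R); rewrite rmorphM /= -!nrE normrZ. Qed.

Lemma nrM (c d : C) : nr (c * d) = nr c * nr d.
Proof. by apply: (@complexI R); rewrite rmorphM /= -!nrE normrM. Qed.

Lemma nr_conj (c : C) : nr ((c^*)%C) = nr c.
Proof. by rewrite /nr normcJ. Qed.

Lemma nr_real (r : R) : nr (r%:C : C) = `|r|.
Proof. by rewrite /nr normc_def /= expr0n addr0 sqrtr_sqr. Qed.

Lemma le_nr_Re (c : C) : `|complex.Re c| <= nr c.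
Proof. by rewrite -lecR -nrE; exact: normc_ge_Re. Qed.

Lemma le_nr_Im (c : C) : `|complex.Im c| <= nr c.
Proof.
have -> : complex.Im c = complex.Re (- ('i%C * c)).
  by rewrite mulrC raddfN /= ReiNIm opprK.
by apply: (le_trans (le_nr_Re _)); rewrite nrN nrM /nr normc_def /= expr0n expr1n add0r sqrtr1 mul1r.
Qed.

Lemma nr_le_ReIm (c : C) : nr c <= `|complex.Re c| + `|complex.Im c|.
Proof.
have -> : nr c = nr ((complex.Re c)%:C + 'i%C * (complex.Im c)%:C).
  by rewrite -complexE.
apply: (le_trans (nrD _ _)).
by rewrite nrM !nr_real [X in _ + X * _]/nr normc_def /= expr0n expr1n add0r sqrtr1 mul1r.
Qed.

Lemma le_eps (a b : R) : (forall e, 0 < e -> a <= b + e) -> a <= b.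
Proof. by move=> h; apply/ler_addgt0Pr. Qed.

Lemma nr_eps0 {V : normedZmodType C} (x : V) : (forall e, 0 < e -> nr x <= e) -> x = 0.
Proof.
move=> h; apply: nr_eq0; apply/eqP; rewrite eq_le nr_ge0 andbT.
by apply: le_eps => e /h; rewrite add0r.
Qed.

Lemma dst_eps {V : normedZmodType C} (x y : V) :
  (forall e, 0 < e -> dst x y <= e) -> x = y.
Proof. by move=> /nr_eps0 /eqP; rewrite subr_eq0 => /eqP. Qed.

Definition lims {V : normedZmodType C} (u : nat -> V) (l : V) :=
  forall e : R, 0 < e -> exists N, forall n, (N <= n)%N -> dst (u n) l < e.

Lemma ball_nrE {V : pseudoMetricNormedZmodType C} (x y : V) (e : R) :
  ball x (e%:C : C) y = (dst x y < e) :> Prop.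
Proof. by rewrite -ball_normE /ball_ /= nrE ltcR. Qed.

Lemma posC (e : C) : 0 < e -> exists2 r : R, 0 < r & e = r%:C.
Proof.
move=> e0; have re : e = (complex.Re e)%:C by rewrite RRe_real // gtr0_real.
by exists (complex.Re e) => //; rewrite -ltcR -re.
Qed.

Lemma lims_cvg {V : pseudoMetricNormedZmodType C} (u : nat -> V) (l : V) :
  lims u l <-> u @ \oo --> l.
Proof.
split=> [h|h e e0].
  apply/cvgrPdist_lt => _ /posC[e e0 ->]; have [N hN] := h e e0.
  by exists N => // n /= /hN; rewrite dstC nrE ltcR.
have /cvgrPdist_lt/(_ e%:C) := h; rewrite ltcR => /(_ e0)[N _ hN]; exists N => n /hN /=.
by rewrite dstC nrE ltcR.
Qed.

Lemma cauchy_lims {V : completeNormedModType C} (u : nat -> V) :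
  (forall e : R, 0 < e -> exists N, forall m n, (N <= m)%N -> (N <= n)%N ->
     dst (u m) (u n) < e) -> exists l, lims u l.
Proof.
move=> h; have : cvg (u @ \oo).
  apply/cauchy_cvgP/cauchy_exP => _ /posC[e e0 ->]; have [N hN] := h e e0.
  exists (u N); exists N => // n /= Nn; rewrite ball_nrE.
  exact: hN.
by move=> /cvg_ex[l ul]; exists l; apply/lims_cvg.
Qed.

Lemma expr_half_lt (e : R) : 0 < e -> exists N, forall n, (N <= n)%N -> (2^-1 : R) ^+ n < e.
Proof.
move=> e0; have : (fun n => (2^-1 : R) ^+ n) @ \oo --> (0 : R).
  by apply: cvg_expr; rewrite ger0_norm ?invr_ge0 // invf_lt1 // ltr1n.
move/cvgrPdist_lt => /(_ _ e0)[N _ hN]; exists N => n /hN /=.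
by rewrite sub0r normrN ger0_norm // exprn_ge0 // invr_ge0.
Qed.

Lemma geometric_lims {V : completeNormedModType C} (u : nat -> V) :
  (forall n, dst (u n.+1) (u n) <= (2^-1 : R) ^+ n) -> exists l, lims u l.
Proof.
move=> h.
(* The bound keeps the exact partial geometric sum; its first term alone would not survive the
   induction on [k]. *)
have hk n k : dst (u (n + k)%N) (u n) <= 2 * (2^-1 : R) ^+ n - 2 * (2^-1 : R) ^+ (n + k).
  elim: k => [|k ih]; first by rewrite addn0 !subrr dstxx.
  rewrite addnS; apply: (le_trans (dst_tri (u (n + k)%N) _ _)).
  apply: (le_trans (lerD (h _) ih)).
  rewrite [in X in _ <= X]exprS; lra.
have hk' n k : dst (u (n + k)%N) (u n) <= 2 * (2^-1 : R) ^+ n.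
  apply: (le_trans (hk n k)); rewrite gerBl mulr_ge0 // exprn_ge0 // invr_ge0 //.
apply: cauchy_lims => e e0.
have e4 : 0 < e / 4 by lra.
have [N hN] := expr_half_lt e4; exists N => m n Nm Nn.
have := hk' N (m - N)%N; have := hk' N (n - N)%N; rewrite !subnKC // => h1 h2.
have := hN N (leqnn N) => h3.
apply: (le_lt_trans (dst_tri (u N) _ _)); rewrite (dstC (u N)); lra.
Qed.

End RealNorm.

Section LinearMaps.
Context {R : realType}.
Local Notation C := (R[i] : numFieldType).

Section Maps.
Variables (U V : lmodType C) (f : U -> V).
Hypothesis lf : linear f.

Lemma linD x y : f (x + y) = f x + f y.
Proof. by have := lf 1 x y; rewrite !scale1r. Qed.
Lemma lin0 : f 0 = 0.
Proof. by have := linD 0 0; rewrite addr0 => /eqP; rewrite -subr_eq subrr eq_sym => /eqP. Qed.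
Lemma linZ c x : f (c *: x) = c *: f x.
Proof. by have := lf c x 0; rewrite lin0 !addr0. Qed.
Lemma linB x y : f (x - y) = f x - f y.
Proof. by rewrite linD -scaleN1r linZ scaleN1r. Qed.
End Maps.

Section Forms.
Variables (U : lmodType C) (h : U -> R[i]).
Hypothesis lh : scalar h.

Lemma formD x y : h (x + y) = h x + h y.
Proof. by have := lh 1 x y; rewrite scale1r mul1r. Qed.
Lemma form0 : h 0 = 0.
Proof. by have := formD 0 0; rewrite addr0 => /eqP; rewrite -subr_eq subrr eq_sym => /eqP. Qed.
Lemma formZ c x : h (c *: x) = c * h x.
Proof. by have := lh c x 0; rewrite form0 !addr0. Qed.
Lemma formB x y : h (x - y) = h x - h y.
Proof. by rewrite formD -scaleN1r formZ mulN1r. Qed.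
End Forms.

End LinearMaps.

(** * C*-algebras *)

Section Algebra.
Context {R : realType}.
Local Notation C := (R[i] : numFieldType).
Implicit Types A : cstarAlgType R.

Lemma amulD A (x y z : A) : (x + y) ** z = x ** z + y ** z.
Proof. by have := amulDl 1 x y z; rewrite !scale1r. Qed.
Lemma amulDR A (x y z : A) : z ** (x + y) = z ** x + z ** y.
Proof. by have := amulDr 1 x y z; rewrite !scale1r. Qed.
Lemma amul0 A (x : A) : 0 ** x = 0.
Proof. by have := amulD 0 0 x; rewrite addr0 => /eqP; rewrite -subr_eq subrr => /eqP. Qed.
Lemma amulR0 A (x : A) : x ** 0 = 0.
Proof. by have := amulDR 0 0 x; rewrite addr0 => /eqP; rewrite -subr_eq subrr => /eqP. Qed.
Lemma amulZ A c (x z : A) : (c *: x) ** z = c *: (x ** z).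
Proof. by have := amulDl c x 0 z; rewrite addr0 amul0 addr0. Qed.
Lemma amulZR A c (x z : A) : z ** (c *: x) = c *: (z ** x).
Proof. by have := amulDr c x 0 z; rewrite addr0 amulR0 addr0. Qed.
Lemma amulN A (x z : A) : (- x) ** z = - (x ** z).
Proof. by rewrite -scaleN1r amulZ scaleN1r. Qed.
Lemma amulNR A (x z : A) : z ** (- x) = - (z ** x).
Proof. by rewrite -scaleN1r amulZR scaleN1r. Qed.
Lemma amulB A (x y z : A) : (x - y) ** z = x ** z - y ** z.
Proof. by rewrite amulD amulN. Qed.
Lemma amulBR A (x y z : A) : z ** (x - y) = z ** x - z ** y.
Proof. by rewrite amulDR amulNR. Qed.

Lemma star_add A (x y : A) : star (x + y) = star x + star y.
Proof. by have := starD 1 x y; rewrite !scale1r conjc1 scale1r. Qed.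
Lemma star0 A : star (0 : A) = 0.
Proof. by have := star_add (0 : A) 0; rewrite addr0 => /eqP; rewrite -subr_eq subrr => /eqP. Qed.
Lemma starZ A c (x : A) : star (c *: x) = (c^*)%C *: star x.
Proof. by have := starD c x 0; rewrite addr0 star0 addr0. Qed.
Lemma starN A (x : A) : star (- x) = - star x.
Proof. by apply/eqP; rewrite -addr_eq0 -star_add addNr star0. Qed.
Lemma starB A (x y : A) : star (x - y) = star x - star y.
Proof. by rewrite star_add starN. Qed.
Lemma star1 A : star (aone : A) = aone.
Proof. by rewrite -[LHS]amul1r -{2}[aone]starK -starM amul1r starK. Qed.

Lemma nrD_alg A (x y : A) : nr (x + y) <= nr x + nr y.
Proof. exact: nrD. Qed.

Lemma dstE_alg A (x y : A) : dst x y = nr (x - y).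
Proof. by []. Qed.

Lemma nr_amul A (x y : A) : nr (x ** y) <= nr x * nr y.
Proof. by rewrite -lecR rmorphM /= -!nrE; exact: normM_le. Qed.

Lemma nr_cstar A (x : A) : nr (star x ** x) = nr x ^+ 2.
Proof. by apply: (@complexI R); rewrite rmorphXn /= -!nrE; exact: cstar_norm. Qed.

Lemma nr_star_le A (x : A) : nr x <= nr (star x).
Proof.
have [->|x0] := eqVneq (nr x) 0; first exact: nr_ge0.
have {}x0 : 0 < nr x by rewrite lt_def x0 nr_ge0.
by rewrite -(ler_pM2r x0) -expr2 -nr_cstar nr_amul.
Qed.

Lemma nr_star A (x : A) : nr (star x) = nr x.
Proof. by apply/eqP; rewrite eq_le nr_star_le -{2}[x]starK nr_star_le. Qed.

Lemma cstar_eq0 A (x : A) : star x ** x = 0 -> x = 0.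
Proof.
move=> h; apply: nr_eq0; apply/eqP; rewrite -sqrf_eq0 -nr_cstar h.
by rewrite nr0.
Qed.

Lemma nr_one_le A : nr (aone : A) <= 1.
Proof.
have := nr_cstar (aone : A); rewrite star1 amul1r => h.
have := nr_ge0 (aone : A) => h0; nra.
Qed.

Lemma half_double (V : lmodType C) (x : V) : (2^-1 : C) *: (x + x) = x.
Proof. by rewrite -{1 2}(scale1r x) -scalerDl scalerA mulVf ?scale1r // pnatr_eq0. Qed.

Lemma nr_half (V : normedModType C) (x : V) : nr ((2^-1 : C) *: x) = 2^-1 * nr x.
Proof.
rewrite nrZ -[X in nr X * _](_ : (2^-1)%:C = _); last by rewrite fmorphV /= rmorphMn.
by rewrite nr_real ger0_norm.
Qed.

(* The iteration [w' = (b + w^2) / 2] is a contraction on the ball of radius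
   1/2 and its fixed point satisfies [(1 - w)^2 = 1 - b]. *)
Definition sqrt_step A (b w : A) : A := (2^-1 : C) *: (b + w ** w).
Definition sqrt_iter A (b : A) n : A := iter n (sqrt_step b) 0.

Section SquareRoot.
Variables (A : cstarAlgType R) (b : A).
Hypotheses (sb : star b = b) (nb : nr b <= 2^-1).
Local Notation step := (sqrt_step b).
Local Notation w := (sqrt_iter b).

Let w_le n : nr (w n) <= 2^-1.
Proof.
elim: n => [|n ih]; first by rewrite nr0.
rewrite /= nr_half; have := nrD_alg b (w n ** w n); have := nr_amul (w n) (w n).
have := nr_ge0 (w n) => h0 h1 h2; rewrite -/(w n).
have : nr (w n) * nr (w n) <= 2^-1 * 2^-1 by apply: ler_pM.
have := nb; lra.
Qed.

Let stepB (x y : A) : nr x <= 2^-1 -> nr y <= 2^-1 ->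
  dst (step x) (step y) <= 2^-1 * dst x y.
Proof.
move=> hx hy; rewrite !dstE_alg -scalerBr nr_half opprD addrACA subrr add0r.
rewrite ler_pM2l ?invr_gt0 //.
have -> : x ** x - y ** y = x ** (x - y) + (x - y) ** y.
  by rewrite amulBR amulB addrA subrK.
apply: (le_trans (nrD_alg _ _)).
have := nr_amul x (x - y); have := nr_amul (x - y) y.
have := nr_ge0 (x - y) => h0 h1 h2.
have : nr x * nr (x - y) <= 2^-1 * nr (x - y) by apply: ler_wpM2r.
have : nr (x - y) * nr y <= nr (x - y) * 2^-1 by apply: ler_wpM2l.
lra.
Qed.

Let w_star n : star (w n) = w n.
Proof.
elim: n => [|n ih]; first exact: star0.
rewrite /= starZ star_add starM sb -/(w n) ih.
by rewrite conjc_inv conjc_nat.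
Qed.

Let w_comm (a : A) n : a ** b = b ** a -> a ** w n = w n ** a.
Proof.
move=> ab; elim: n => [|n ih]; first by rewrite amulR0 amul0.
by rewrite /= amulZR amulZ amulDR amulD ab amulA -/(w n) ih -!amulA ih.
Qed.

Lemma sqrt_one_sub : exists y : A,
  [/\ star y = y, y ** y = aone - b &
      forall a, a ** b = b ** a -> a ** y = y ** a].
Proof.
have [l wl] : exists l, lims w l.
  apply: geometric_lims => n; elim: n => [|n ih].
    rewrite expr0 dstx0 (le_trans (w_le 1)) //; lra.
  apply: (le_trans (stepB (w_le n.+1) (w_le n))); rewrite exprS.
  by rewrite ler_pM2l ?invr_gt0.
(* Symmetry of [l] and its commutation with [a] both follow from a defect bounded by a multiple of
   the distance to [w n]. *)
have lim_close (x y : A) (K : R) :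
    (forall n, dst x y <= K * dst (w n) l) -> 0 <= K -> x = y.
  move=> h K0; apply: dst_eps => e e0.
  have e' : 0 < e / (K + 1) by apply: divr_gt0 => //; lra.
  have [N /(_ _ (leqnn N)) hN] := wl _ e'.
  apply: (le_trans (h N)).
  apply: (@le_trans _ _ (K * (e / (K + 1)))); first by apply: ler_wpM2l => //; exact: ltW.
  by rewrite mulrCA ler_piMr ?(ltW e0) // ler_pdivrMr; lra.
have sl : star l = l.
  apply: (lim_close _ _ 2) => // n.
  apply: (le_trans (dst_tri (w n) _ _)).
  rewrite -{1}(w_star n) dstE_alg -starB nr_star -dstE_alg (dstC l); lra.
have nl : nr l <= 2^-1.
  apply: le_eps => e /wl[N /(_ _ (leqnn N)) hN].
  have := dst_tri (w N) l 0; rewrite !dstx0 (dstC l) => h.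
  have := w_le N; lra.
have fl : step l = l.
  apply: dst_eps => e e0.
  have e2 : 0 < e / 2 by lra.
  have [N hN] := wl _ e2.
  have h1 := hN N (leqnn N); have h2 := hN N.+1 (leqnSn N).
  have := stepB nl (w_le N); rewrite (dstC l) => h3.
  apply: (le_trans (dst_tri (w N.+1) _ _)).
  rewrite -[w N.+1]/(step (w N)) in h2 *; lra.
exists (aone - l); split.
- by rewrite starB star1 sl.
- have : b + l ** l = l + l.
    by rewrite -{3 4}fl /sqrt_step -scalerDr half_double.
  rewrite amulB !amulBR !amul1l amul1r => h.
  have -> : b = l + l - l ** l by rewrite -h addrK.
  by rewrite !opprD !opprK !addrA.
- move=> a ab; rewrite amulB amulBR amul1l amul1r; congr (_ - _).
  apply: (lim_close _ _ (2 * nr a)) => [n|]; last first.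
    by rewrite mulr_ge0 // nr_ge0.
  apply: (le_trans (dst_tri (w n ** a) _ _)).
  rewrite -{1}(w_comm n ab) !dstE_alg -amulBR -amulB.
  have := nr_amul a (l - w n); have := nr_amul (w n - l) a.
  rewrite -!dstE_alg (dstC l); lra.
Qed.
End SquareRoot.

(** Scales into the ball of radius 1/2, where [sqrt_one_sub] applies; this rescaling is the source
    of the factor 2 in the later bounds. *)
Lemma normalize (V : normedModType C) (x : V) : exists (t : R) (y : V),
  [/\ 0 <= t, t <= 2 * nr x, nr y <= 2^-1 & x = t%:C *: y].
Proof.
have [x0|x0] := eqVneq (nr x) 0.
  by exists 0, 0; rewrite (nr_eq0 x0) nr0 !mulr0 scaler0; split => //; rewrite invr_ge0.
have {}x0 : 0 < nr x by rewrite lt_def x0 nr_ge0.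
exists (2 * nr x), ((2 * nr x)^-1%:C *: x); split.
- by rewrite mulr_ge0 // nr_ge0.
- by [].
- rewrite nrZ nr_real ger0_norm ?invr_ge0 ?mulr_ge0 ?nr_ge0 //.
  by rewrite invfM mulfVK // gt_eqF.
- rewrite scalerA -rmorphM divff ?scale1r // gt_eqF //; lra.
Qed.

(* For self-adjoint [a] of norm at most 1/2, [f a + i f (sqrt (1 - a^2))] is
   unitary, whence the bound without any spectral theory. *)
Lemma star_hom_bound A (D : cstarAlgType R) (f : A -> D) : star_hom f ->
  forall x, nr (f x) <= 2 * nr x.
Proof.
case=> lf f1 fM fS.
have fD := linD lf; have fZ := linZ lf.
have sa (a : A) : star a = a -> nr a <= 2^-1 -> nr (f a) <= 1.
  move=> sa na.
  have saa : star (a ** a) = a ** a by rewrite starM sa.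
  have naa : nr (a ** a) <= 2^-1.
    apply: (le_trans (nr_amul _ _)).
    have : nr a * nr a <= 2^-1 * 2^-1 by apply: ler_pM; rewrite ?nr_ge0.
    lra.
  have [y [sy yy]] := sqrt_one_sub saa naa.
  move=> /(_ a); rewrite amulA => /(_ erefl) ay.
  pose u : D := f a + ('i%C : C) *: f y.
  have su : star u = f a - ('i%C : C) *: f y.
    rewrite star_add starZ -!fS sa sy; congr (_ + _).
    by rewrite -scaleNr; congr (_ *: _); apply/eqP; rewrite eq_complex /= oppr0 !eqxx.
  have nu : nr u <= 1.
    have : nr u ^+ 2 <= 1.
      rewrite -nr_cstar su /u amulB !amulDR !amulZ !amulZR -!fM -ay yy.
      rewrite opprD addrA addrK scalerA -expr2 sqr_i scaleN1r opprK -fD addrC subrK f1.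
      exact: nr_one_le.
    have := nr_ge0 u; nra.
  have -> : f a = (2^-1 : C) *: (u + star u).
    by rewrite su addrACA subrr addr0 half_double.
  rewrite nr_half; have := nrD_alg u (star u); rewrite nr_star; lra.
(* The self-adjoint case is applied to [star y ** y], and the C*-identity turns its bound into one
   for [f y]. *)
move=> x; have [t [y [t0 tx ny xE]]] := normalize x.
have nfy : nr (f y) <= 1.
  have : nr (f y) ^+ 2 <= 1.
    rewrite -nr_cstar -fS -fM; apply: sa; first by rewrite starM starK.
    rewrite nr_cstar; have := nr_ge0 y => h; nra.
  have := nr_ge0 (f y); nra.
rewrite {1}xE fZ nrZ nr_real ger0_norm //; apply: le_trans tx.
by rewrite ler_piMr.
Qed.

End Algebra.

(** A synonym of the carrier, to which a second C*-structure with reversed product can be attached.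
    A star homomorphism from [A] into [opp_alg A] is an antihomomorphism of [A]. *)
Definition opp_alg {R : realType} (A : cstarAlgType R) : Type := A.

Section OppositeAlgebra.
Context {R : realType} (A : cstarAlgType R).
Local Notation C := (R[i] : numFieldType).

HB.instance Definition _ :=
  CompleteNormedModule.copy (opp_alg A) (A : completeNormedModType C).

Let omul (x y : opp_alg A) : opp_alg A := (y : A) ** (x : A).
Let ostar (x : opp_alg A) : opp_alg A := star (x : A).

Let omulA : associative omul.
Proof. by move=> x y z; rewrite /omul amulA. Qed.
Let omul1 : left_id (aone : A) omul.
Proof. by move=> x; rewrite /omul amul1r. Qed.
Let omulr1 : right_id (aone : A) omul.
Proof. by move=> x; rewrite /omul amul1l. Qed.
Let omulDl (c : R[i]) (x y z : opp_alg A) : omul (c *: x + y) z = c *: omul x z + omul y z.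
Proof. exact: (@amulDr R A). Qed.
Let omulDr (c : R[i]) (x y z : opp_alg A) : omul z (c *: x + y) = c *: omul z x + omul z y.
Proof. exact: (@amulDl R A). Qed.
Let ostarD (c : R[i]) (x y : opp_alg A) : ostar (c *: x + y) = (c^*)%C *: ostar x + ostar y.
Proof. exact: (@starD R A). Qed.
Let ostarM x y : ostar (omul x y) = omul (ostar y) (ostar x).
Proof. exact: (@starM R A). Qed.
Let onormM x y : `|omul x y| <= `|x| * `|y|.
Proof. by rewrite mulrC; exact: (@normM_le R A). Qed.
Let ocstar x : `|omul (ostar x) x| = `|x| ^+ 2.
Proof.
rewrite nrE [in RHS]nrE -rmorphXn; congr (_%:C).
by have := nr_cstar (star (x : A)); rewrite starK nr_star.
Qed.

HB.instance Definition _ := hasCStarAlgebra.Build R (opp_alg A)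
  omulA omul1 omulr1 omulDl omulDr ostarD ostarM (@starK R A) onormM ocstar.
End OppositeAlgebra.

(** * Closed *-subalgebras as C*-algebras; density of the polynomials *)

Definition closed_star_subalgebra {R : realType} (A : cstarAlgType R) (D : set A) :=
  is_star_subalgebra D /\ forall u l, (forall n : nat, D (u n)) -> lims u l -> D l.

(* [hD] is a parameter of the type so that instance resolution can find it. *)
Definition subalg {R : realType} (A : cstarAlgType R) (D : set A)
  (hD : closed_star_subalgebra D) : Type := {x : A | `[< D x >]}.

Section Subalgebra.
Context {R : realType} (A : cstarAlgType R) (D : set A) (hD : closed_star_subalgebra D).
Local Notation C := (R[i] : numFieldType).
Local Notation T := (subalg hD).

HB.instance Definition _ := SubType.on T.
HB.instance Definition _ := Choice.on T.

Definition subalg_in (x : A) (hx : D x) : T := exist _ x (asboolT hx).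

Lemma subalgP (x : T) : D (val x).
Proof. exact/asboolP/(valP x). Qed.

Let D0 : D 0. Proof. by case: hD => -[[]]. Qed.
Let DD c x y : D x -> D y -> D (c *: x + y).
Proof. by case: hD => -[[_ h]] *; exact: h. Qed.
Let D1 : D aone. Proof. by case: hD => -[]. Qed.
Let DM x y : D x -> D y -> D (x ** y).
Proof. by case: hD => -[_ _ h _] _; exact: h. Qed.
Let DS x : D x -> D (star x).
Proof. by case: hD => -[_ _ _ h] _; exact: h. Qed.

(** Closure is given only for [c *: x + y], so membership of a sum is transported along [scale1r].
    The transport affects the proof component alone: [val] of a sum computes to the sum of the
    values. *)
Let add (x y : T) : T :=
  subalg_in (eq_ind _ D (DD 1 (subalgP x) (subalgP y)) _ (congr1 (+%R^~ (val y)) (scale1r (val x)))).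
Let scl (c : C) (x : T) : T :=
  subalg_in (eq_ind _ D (DD c (subalgP x) D0) _ (addr0 (c *: val x))).
Let opp (x : T) : T := scl (-1) x.
Let zer : T := subalg_in D0.

Let addA : associative add.
Proof. by move=> x y z; apply: val_inj; rewrite /= addrA. Qed.
Let addC : commutative add.
Proof. by move=> x y; apply: val_inj; rewrite /= addrC. Qed.
Let add0 : left_id zer add.
Proof. by move=> x; apply: val_inj; rewrite /= add0r. Qed.
Let addN : left_inverse zer opp add.
Proof. by move=> x; apply: val_inj; rewrite /= scaleN1r addNr. Qed.

HB.instance Definition _ := GRing.isZmodule.Build T addA addC add0 addN.

Let sclA a b (v : T) : scl a (scl b v) = scl (a * b) v.
Proof. by apply: val_inj; rewrite /= scalerA. Qed.
Let scl1 : left_id 1 scl.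
Proof. by move=> x; apply: val_inj; rewrite /= scale1r. Qed.
Let sclDr : right_distributive scl +%R.
Proof. by move=> a x y; apply: val_inj; rewrite /= scalerDr. Qed.
Let sclDl (v : T) : {morph scl^~ v : a b / a + b}.
Proof. by move=> a b; apply: val_inj; rewrite /= scalerDl. Qed.

HB.instance Definition _ := GRing.Zmodule_isLmodule.Build C T sclA scl1 sclDr sclDl.

Let nrm (x : T) : C := `|val x|.
Let nrmD x y : nrm (x + y) <= nrm x + nrm y.
Proof. exact: ler_normD. Qed.
Let nrmZ (l : C) (x : T) : nrm (l *: x) = `|l| * nrm x.
Proof. exact: normrZ. Qed.
Let nrm0 (x : T) : nrm x = 0 -> x = 0.
Proof. by move=> h; apply: val_inj; apply: normr0_eq0. Qed.

HB.instance Definition _ := Lmodule_isNormed.Build C T nrmD nrmZ nrm0.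

Lemma subalg_valB (x y : T) : val (x - y) = val x - val y.
Proof. by rewrite -[- val y]scaleN1r. Qed.

Lemma subalg_dst (x y : T) : dst x y = dst (val x) (val y).
Proof.
have nrv (v : T) : nr v = nr (val v) by [].
by rewrite /dst nrv subalg_valB.
Qed.

Let complete (F : set_system T) : ProperFilter F -> cauchy F -> cvg F.
Proof.
move=> FF /cauchyP Fc.
have eps_pos n : 0 < (2^-1 : R) ^+ n / 4 by rewrite divr_gt0 // exprn_gt0 // invr_gt0.
(* A sequence is extracted from the Cauchy filter. Two balls in [F] meet, so consecutive centres are
   closer than the sum of the radii, which is below the [2^-1 ^+ n] required by [geometric_lims]. *)
have /choice[u Fu] : forall n, exists x, F (ball x ((2^-1 : R) ^+ n / 4)%:C).
  by move=> n; apply: Fc; rewrite ltcR.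
have [l ul] : exists l, lims (fun n => val (u n)) l.
  apply: geometric_lims => n; rewrite -subalg_dst.
  have [z []] := filter_ex (filterI (Fu n) (Fu n.+1)); rewrite !ball_nrE => h h'.
  apply: (le_trans (dst_tri z _ _)); rewrite dstC in h'.
  rewrite exprS in h'; rewrite dstC [X in _ + X]dstC.
  have := exprn_gt0 n (_ : 0 < 2^-1 :> R); rewrite invr_gt0 ltr0n => /(_ isT); lra.
have Dl : D l by case: hD => _; apply; [move=> n; exact: (subalgP (u n)) | exact: ul].
apply/cvg_ex; exists (subalg_in Dl); apply/cvg_ballP => _ /posC[e e0 ->].
have e2 : 0 < e / 2 by lra.
have [N1 h1] := ul _ e2; have [N2 h2] := expr_half_lt e2.
have {}h1 := h1 (maxn N1 N2) (leq_maxl _ _); have {}h2 := h2 (maxn N1 N2) (leq_maxr _ _).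
apply: filterS (Fu (maxn N1 N2)) => z; rewrite !ball_nrE !subalg_dst /= => h3.
apply: (le_lt_trans (dst_tri (val (u (maxn N1 N2))) _ _)); rewrite dstC.
have := eps_pos (maxn N1 N2); lra.
Qed.

HB.instance Definition _ := Uniform_isComplete.Build T complete.

Let smul (x y : T) : T := subalg_in (DM (subalgP x) (subalgP y)).
Let sstar (x : T) : T := subalg_in (DS (subalgP x)).
Let sone : T := subalg_in D1.

Let smulA : associative smul.
Proof. by move=> x y z; apply: val_inj; rewrite /= amulA. Qed.
Let smul1 : left_id sone smul.
Proof. by move=> x; apply: val_inj; rewrite /= amul1l. Qed.
Let smulr1 : right_id sone smul.
Proof. by move=> x; apply: val_inj; rewrite /= amul1r. Qed.
Let smulDl (c : C) (x y z : T) : smul (c *: x + y) z = c *: smul x z + smul y z.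
Proof. by apply: val_inj; exact: amulDl. Qed.
Let smulDr (c : C) (x y z : T) : smul z (c *: x + y) = c *: smul z x + smul z y.
Proof. by apply: val_inj; exact: amulDr. Qed.
Let sstarD (c : C) (x y : T) : sstar (c *: x + y) = (c^*)%C *: sstar x + sstar y.
Proof. by apply: val_inj; exact: starD. Qed.
Let sstarM x y : sstar (smul x y) = smul (sstar y) (sstar x).
Proof. by apply: val_inj; exact: starM. Qed.
Let sstarK : involutive sstar.
Proof. by move=> x; apply: val_inj; exact: starK. Qed.
Let snormM x y : `|smul x y| <= `|x| * `|y|.
Proof. exact: (@normM_le R A). Qed.
Let scstar x : `|smul (sstar x) x| = `|x| ^+ 2.
Proof. exact: (@cstar_norm R A). Qed.

HB.instance Definition _ := hasCStarAlgebra.Build R T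
  smulA smul1 smulr1 smulDl smulDr sstarD sstarM sstarK snormM scstar.

Lemma subalg_val_hom : star_hom (val : T -> A).
Proof. by split. Qed.

End Subalgebra.

Section Closure.
Context {R : realType}.
Local Notation C := (R[i] : numFieldType).
Implicit Types A : cstarAlgType R.

Definition adherent (V : normedZmodType C) (D : set V) : set V :=
  [set x | forall e : R, 0 < e -> exists2 p, D p & dst x p < e].

Lemma sub_adherent (V : normedZmodType C) (D : set V) : D `<=` adherent D.
Proof. by move=> x Dx e e0; exists x => //; rewrite dstxx. Qed.

Lemma adherent_lims (V : normedZmodType C) (D : set V) u l :
  (forall n : nat, adherent D (u n)) -> lims u l -> adherent D l.
Proof.
move=> Du ul e e0; have e2 : 0 < e / 2 by lra.
have [N /(_ N (leqnn N)) h] := ul _ e2; have [p Dp h'] := Du N _ e2.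
by exists p => //; apply: (le_lt_trans (dst_tri (u N) _ _)); rewrite dstC; lra.
Qed.

Lemma dst_lin A (c : C) (x y x' y' : A) :
  dst (c *: x + y) (c *: x' + y') <= nr c * dst x x' + dst y y'.
Proof.
rewrite !dstE_alg opprD addrACA -scalerBr (le_trans (nrD_alg _ _)) // nrZ //.
Qed.

Lemma dst_amul A (x y x' y' : A) :
  dst (x ** y) (x' ** y') <= nr x * dst y y' + dst x x' * (nr y + dst y y').
Proof.
have -> : dst (x ** y) (x' ** y') = nr (x ** (y - y') + (x - x') ** y').
  by rewrite amulBR amulB addrA subrK.
apply: (le_trans (nrD_alg _ _)); apply: lerD; first exact: nr_amul.
apply: (le_trans (nr_amul _ _)); rewrite -dstE_alg; apply: ler_wpM2l; first exact: nr_ge0.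
rewrite -!dstx0; apply: (le_trans (dst_tri y _ _)); by rewrite addrC (dstC y').
Qed.

Lemma dst_star A (x y : A) : dst (star x) (star y) = dst x y.
Proof. by rewrite !dstE_alg -starB nr_star. Qed.

Lemma adherent_subalgebra A (D : set A) :
  is_star_subalgebra D -> closed_star_subalgebra (adherent D).
Proof.
move=> [[D0 DD] D1 DM DS]; split; last exact: adherent_lims.
split; [split| | |].
- exact: sub_adherent.
- move=> c x y Dx Dy e e0.
  have c0 : 0 < nr c + 1 by have := nr_ge0 c; lra.
  have e1 : 0 < e / 2 / (nr c + 1) by rewrite divr_gt0 //; lra.
  have e2 : 0 < e / 2 by lra.
  have [p Dp hp] := Dx _ e1; have [r Dr hr] := Dy _ e2.
  exists (c *: p + r); first exact: DD.
  apply: (le_lt_trans (dst_lin _ _ _ _ _)).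
  rewrite ltr_pdivlMr // in hp; have := dst_ge0 x p; have := nr_ge0 c; nra.
- exact: sub_adherent.
- move=> x y Dx Dy e e0.
  have k0 : 0 < nr x + nr y + 1 by have := nr_ge0 x; have := nr_ge0 y; lra.
  (* With both errors below [d <= 1], the product errs by at most [d * (nr x + nr y + 1)]. *)
  pose d := Num.min 1 (e / (nr x + nr y + 1) / 2).
  have d0 : 0 < d by rewrite lt_min ltr01 !divr_gt0.
  have d1 : d <= 1 by rewrite ge_min lexx.
  have d2 : d * (nr x + nr y + 1) < e.
    rewrite -ltr_pdivlMr //; apply: (@le_lt_trans _ _ (e / (nr x + nr y + 1) / 2)).
      by rewrite ge_min lexx orbT.
    have := divr_gt0 e0 k0; lra.
  have [p Dp hp] := Dx _ d0; have [r Dr hr] := Dy _ d0.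
  exists (p ** r); first exact: DM.
  apply: (le_lt_trans (dst_amul _ _ _ _)).
  have := dst_ge0 x p; have := dst_ge0 y r; have := nr_ge0 x; have := nr_ge0 y.
  move: (nr x) (nr y) (dst x p) (dst y r) d hp hr {d0} d1 d2 {k0 e0} => a b s t d *.
  have : a * t <= a * d by rewrite ler_wpM2l // ltW.
  have : s * (b + t) <= d * (b + 1) by apply: ler_pM => //; lra.
  lra.
- move=> x Dx e e0; have [p Dp hp] := Dx _ e0; exists (star p); first exact: DS.
  by rewrite dst_star.
Qed.

Lemma star_hom_id A : star_hom (@idfun A).
Proof. by split. Qed.

Lemma star_hom_comp A (B D : cstarAlgType R) (f : A -> B) (g : B -> D) :
  star_hom f -> star_hom g -> star_hom (g \o f).
Proof.
move=> [lf f1 fM fS] [lg g1 gM gS]; split => //=.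
- by move=> c x y /=; rewrite lf lg.
- by rewrite f1.
- by move=> x y; rewrite fM.
- by move=> x; rewrite fS.
Qed.

End Closure.

Section Universal.
Context {R : realType} (q : R[i]) (A : cstarAlgType R) (alpha gamma : A).
Hypothesis hA : is_universal_suq2 q alpha gamma.
Local Notation C := (R[i] : numFieldType).
Local Notation P := (pol alpha gamma).

Lemma pol_subalgebra : is_star_subalgebra P.
Proof.
split; [split| | |].
- by move=> D [[[]]].
- by move=> c x y Px Py D hD; case: (hD) => -[[_ h] _ _ _] _; apply: h; [exact: Px|exact: Py].
- by move=> D [[]].
- by move=> x y Px Py D hD; case: (hD) => -[_ _ h _] _; apply: h; [exact: Px|exact: Py].
- by move=> x Px D hD; case: (hD) => -[_ _ _ h] _; apply: h; exact: Px.
Qed.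

Lemma pol_alpha : P alpha. Proof. by move=> D [_]; apply; left. Qed.
Lemma pol_gamma : P gamma. Proof. by move=> D [_]; apply; right. Qed.

Lemma pol_ind (D : set A) : is_star_subalgebra D -> D alpha -> D gamma -> P `<=` D.
Proof. by move=> hD Da Dg x; apply; split => // _ [->|->]. Qed.

Lemma universal_hom (D : cstarAlgType R) (x y : D) : suq2_relations q x y ->
  exists f : A -> D, [/\ star_hom f, f alpha = x & f gamma = y].
Proof. by case: hA => _ h /h[f [hf _]]; exists f. Qed.

Lemma hom_relations (D : cstarAlgType R) (f : A -> D) : star_hom f ->
  suq2_relations q (f alpha) (f gamma).
Proof.
case: hA => -[r1 r2 r3 r4] _ [lf f1 fM fS].
have fD := linD lf; have fZ := linZ lf.
by split; rewrite -?fS -!fM -?fZ -?fD ?r1 ?r2 ?r3 ?r4.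
Qed.

Lemma universal_uniq (D : cstarAlgType R) (f g : A -> D) : star_hom f -> star_hom g ->
  f alpha = g alpha -> f gamma = g gamma -> f = g.
Proof.
move=> hf hg fga fgg; case: hA => _ /(_ D _ _ (hom_relations hf))[k [_ ku]].
by rewrite -(ku f) // -(ku g).
Qed.

(* Universality applied to the closure of the polynomial algebra. *)
Lemma pol_dense (x : A) : adherent P x.
Proof.
pose hD := adherent_subalgebra pol_subalgebra.
pose a : subalg hD := subalg_in hD (sub_adherent pol_alpha).
pose g : subalg hD := subalg_in hD (sub_adherent pol_gamma).
have hr : suq2_relations q a g.
  by case: hA => -[r1 r2 r3 r4] _; split; apply: val_inj.
have [f [hf fa fg]] := universal_hom hr.
have -> : x = val (f x).
  have hvf := star_hom_comp hf (subalg_val_hom hD).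
  have E : idfun = (val : subalg hD -> A) \o f.
    apply: (@universal_uniq A idfun (val \o f)) => //=; first by rewrite fa.
    by rewrite fg.
  exact: (congr1 (fun k : A -> A => k x) E).
exact: subalgP.
Qed.

End Universal.

(** * The antiautomorphism of A *)

Section Flip.
Context {R : realType} (q : R[i]) (A : cstarAlgType R) (alpha gamma : A).
Hypotheses (q0 : q != 0) (rel : suq2_relations q alpha gamma).
Local Notation C := (R[i] : numFieldType).

Lemma norm_sqr : `|q| ^+ 2 = (q^*)%C * q.
Proof. by rewrite sqr_normc mulrC. Qed.

Lemma conj_neq0 : (q^*)%C != 0.
Proof. by rewrite conjc_eq0. Qed.

(** For normal [g] the elements [g ** X] and [star g ** X] have the same norm, as
    [star X ** g ** star g ** X] equals [star X ** star g ** g ** X]. *)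
Lemma normal_kernel (g X : A) : g ** star g = star g ** g ->
  g ** X = 0 -> star g ** X = 0.
Proof.
move=> ng gX; apply: cstar_eq0; rewrite starM starK -amulA [g ** _]amulA ng.
by rewrite -amulA gX !amulR0.
Qed.

(** The product [alpha ** star alpha ** alpha] is computed in two ways, from the first and from the
    second relation. *)
Lemma alpha_N : alpha ** (star gamma ** gamma)
  = `|q| ^+ 2 *: ((star gamma ** gamma) ** alpha).
Proof.
case: rel => r1 r2 _ _.
have e1 : star alpha ** alpha = aone - star gamma ** gamma by rewrite -r1 addrK.
have e2 : alpha ** star alpha = aone - `|q| ^+ 2 *: (star gamma ** gamma).
  by rewrite -r2 addrK.
have : alpha ** (star alpha ** alpha) = (alpha ** star alpha) ** alpha by rewrite amulA.
rewrite e1 e2 amulBR amulB amul1l amul1r amulZ => /eqP.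
by rewrite (inj_eq (addrI _)) eqr_opp => /eqP.
Qed.

(* [X = alpha gamma* - q gamma* alpha] satisfies [gamma X = 0]; as [gamma] is
   normal, this forces [X* X = 0], so that Fuglede's theorem is not needed. *)
Lemma alpha_star_gamma : alpha ** star gamma = q *: (star gamma ** alpha).
Proof.
case: (rel) => _ _ r3 r4.
pose X := alpha ** star gamma - q *: (star gamma ** alpha).
have gX : gamma ** X = 0.
  have e1 : (q^*)%C *: (gamma ** (alpha ** star gamma)) = `|q| ^+ 2 *: (star gamma ** gamma ** alpha).
    by rewrite amulA -amulZ -r3 -amulA r4 alpha_N.
  have e2 : (q^*)%C *: (gamma ** (q *: (star gamma ** alpha))) = `|q| ^+ 2 *: (star gamma ** gamma ** alpha).
    by rewrite amulZR scalerA -norm_sqr amulA r4.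
  have : (q^*)%C *: (gamma ** X) = 0 by rewrite amulBR scalerBr e1 e2 subrr.
  by move/eqP; rewrite scaler_eq0 (negPf conj_neq0) => /eqP.
(* [star X ** X] combines [star alpha ** gamma ** X] and [gamma ** star alpha ** X]. The second
   vanishes because [star gamma ** star alpha] is a multiple of [star alpha ** star gamma], which
   kills [X], and [star gamma] is normal too. *)
have sgX : star gamma ** X = 0 by exact: normal_kernel.
have sr3 : star gamma ** star alpha = q *: (star alpha ** star gamma).
  by rewrite -!starM r3 starZ conjcK.
have gaX : gamma ** (star alpha ** X) = 0.
  rewrite -[gamma]starK; apply: normal_kernel; first by rewrite starK.
  by rewrite amulA sr3 amulZ -amulA sgX amulR0 scaler0.
have /eqP : X = 0.
  apply: cstar_eq0; rewrite {1}/X starB starZ !starM starK amulB amulZ -!amulA gX.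
  by rewrite gaX amulR0 scaler0 subr0.
by rewrite subr_eq0 => /eqP.
Qed.

Lemma gamma_star_alpha : gamma ** star alpha = (q^*)%C *: (star alpha ** gamma).
Proof.
have := congr1 star alpha_star_gamma; rewrite starZ !starM starK.
by move->.
Qed.

(** Passing from [alpha] to [star alpha] undoes the reversal of products in the first two relations;
    the third becomes [gamma_star_alpha]. Any phase [c] is allowed at this stage. *)
Lemma flip_relations (c : C) : (c^*)%C * c = 1 ->
  @suq2_relations R q (opp_alg A) (star alpha) (c *: gamma).
Proof.
move=> c1; case: (rel) => r1 r2 r3 r4.
have E1 (x y : opp_alg A) : x ** y = (y : A) ** (x : A) by [].
have E2 (x : opp_alg A) : star x = star (x : A) by [].
have E3 : (c *: gamma) ** star (c *: gamma) = star gamma ** gamma.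
  by rewrite starZ amulZ amulZR scalerA mulrC c1 scale1r r4.
have E4 : star (c *: gamma) ** (c *: gamma) = star gamma ** gamma.
  by rewrite starZ amulZ amulZR scalerA c1 scale1r.
split; rewrite !E1 ?E2.
- by rewrite E3 starK.
- by rewrite E3 starK.
- have -> : (c *: gamma) ** star alpha = (q^*)%C *: (star alpha ** (c *: gamma)); last by [].
  by rewrite amulZ amulZR gamma_star_alpha !scalerA mulrC.
- by rewrite E3 E4.
Qed.

End Flip.

Section FlipHom.
Context {R : realType} (q : R[i]) (A : cstarAlgType R) (alpha gamma : A).
Hypotheses (q0 : q != 0) (hA : is_universal_suq2 q alpha gamma).
Local Notation C := (R[i] : numFieldType).

(** The square of [f] is multiplicative and fixes the generators, [gamma] because [c * c = 1];
    uniqueness makes it the identity. *)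
Lemma flip_exists (c : C) : (c^*)%C = c -> c * c = 1 ->
  exists f : A -> A,
    [/\ linear f, f aone = aone, forall x y, f (x ** y) = f y ** f x,
        forall x, f (star x) = star (f x)
     &  [/\ f alpha = star alpha, f gamma = c *: gamma, forall x, f (f x) = x
         & forall x, nr (f x) <= 2 * nr x]].
Proof.
move=> cr c1; have c2 : (c^*)%C * c = 1 by rewrite cr.
have [f [hf fa fg]] := universal_hom hA (flip_relations q0 (proj1 hA) c2).
have hb := star_hom_bound hf; case: hf => lf f1 fM fS.
have fZ (x : A) : (f (c *: x) : A) = c *: (f x : A) by exact: linZ lf c x.
have hff : star_hom ((f : A -> A) \o (f : A -> A)).
  split=> /=.
  - by move=> a x y /=; rewrite lf; exact: lf.
  - by rewrite f1; exact: f1.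
  - by move=> x y; rewrite fM; exact: (fM (f y : A) (f x : A)).
  - by move=> x; rewrite fS; exact: fS.
have ffE : (f : A -> A) \o (f : A -> A) = idfun.
  apply: (universal_uniq hA hff (star_hom_id A)) => /=.
  - by rewrite fa fS fa; exact: starK.
  - by rewrite fg; have -> := fZ gamma; rewrite fg scalerA c1 scale1r.
exists f; split => //; split => // x.
exact: (congr1 (fun k : A -> A => k x) ffE).
Qed.
End FlipHom.

(** * Comparison with the antipode *)

Lemma half_sqrD (K : numFieldType) (x y : K) :
  2^-1 * (x + y) ^+ 2 + - (x * y) = 2^-1 * x ^+ 2 + 2^-1 * y ^+ 2.
Proof. by field. Qed.

Lemma two_half_mul (K : numFieldType) (x y : K) : 2 * x * (x / 2) * y = x ^+ 2 * y.
Proof. by field. Qed.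

Lemma half_add_half (K : numFieldType) : 2^-1 + 2^-1 = 1 :> K.
Proof. by field. Qed.

Lemma phase_sqr (K : fieldType) (x y n : K) : y != 0 -> n != 0 ->
  x / y * (y / n * (y / n)) = y * x / n ^+ 2.
Proof. by move=> y0 n0; field; rewrite n0. Qed.

Section ComplexPowers.
Context {R : realType}.
Local Notation C := (R[i] : numFieldType).

Lemma cexpD (z w : R[i]) : cexp (z + w) = cexp z * cexp w.
Proof.
case: z => a b; case: w => x y; rewrite /cexp /= expRD cosD sinD rmorphM /=.
apply/eqP; rewrite eq_complex /=; apply/andP; split; apply/eqP; ring.
Qed.

Lemma cexp_real (x : R) : cexp x%:C = (expR x)%:C.
Proof.
by rewrite /cexp /= cos0 sin0 [X in _ * X](_ : _ = 1) ?mulr1.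
Qed.

Lemma cpowD (z w w' : R[i]) : cpow z (w + w') = cpow z w * cpow z w'.
Proof. by rewrite /cpow mulrDl cexpD. Qed.

Lemma cpow0 (z : R[i]) : cpow z 0 = 1.
Proof. by rewrite /cpow mul0r (cexp_real 0) expR0. Qed.

Lemma clog_pos (r : R) : 0 < r -> clog (r%:C) = (ln r)%:C.
Proof.
move=> r0; have rr : complex.Re `|r%:C| = r by rewrite -/(nr _) nr_real gtr0_norm.
by rewrite /clog /carg rr /= ltxx divff ?gt_eqF // acos1.
Qed.

Lemma cpow_pos_real (r x : R) : 0 < r -> cpow r%:C x%:C = (expR (x * ln r))%:C.
Proof. by move=> r0; rewrite /cpow clog_pos // -rmorphM /= cexp_real. Qed.

(** On the circle, [sin (acos a)] recovers only the absolute value of the imaginary part; the case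
    distinction in [carg] restores its sign. *)
Lemma cexp_clog (z : R[i]) : `|z| = 1 -> cexp (clog z) = z.
Proof.
case: z => a b z1.
have ab1 : a ^+ 2 + b ^+ 2 = 1.
  by have := add_Re2_Im2 (a +i* b); rewrite z1 expr1n /= => -[].
have a1 : -1 <= a <= 1.
  by have := sqr_ge0 b; have := sqr_ge0 a; move=> *; apply/andP; split; nra.
rewrite /clog z1 /= ln1 /carg z1 /= divr1.
rewrite /cexp /= expR0 mul1r.
have sE : sin (acos a) = `|b|.
  by rewrite sin_acos // -sqrtr_sqr; congr Num.sqrt; lra.
case: ltP => b0.
  by rewrite cosN sinN acosK ?in_itv //= sE ltr0_norm // opprK.
by rewrite acosK ?in_itv //= sE ger0_norm.
Qed.

End ComplexPowers.

Section Submodules.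
Context {R : realType}.
Local Notation C := (R[i] : numFieldType).

Lemma lin_span_submodule (U : lmodType C) (X : set U) : is_submodule (lin_span X).
Proof.
split; first by move=> D [[]].
move=> c x y Xx Xy D hD; case: (hD) => -[_ h] _; apply: h; [exact: Xx|exact: Xy].
Qed.

Lemma sub_lin_span (U : lmodType C) (X : set U) : X `<=` lin_span X.
Proof. by move=> x Xx D [_]; exact. Qed.

Lemma lin_span_ind (U : lmodType C) (X D : set U) : is_submodule D -> X `<=` D -> lin_span X `<=` D.
Proof. by move=> hD XD x; apply. Qed.

Lemma linear_on0 (U V : lmodType C) (D : set U) (f : U -> V) :
  is_submodule D -> linear_on D f -> f 0 = 0.
Proof.
move=> [D0 _] lf; have := lf 1 0 0 D0 D0; rewrite !scale1r addr0 => /eqP.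
by rewrite -subr_eq subrr eq_sym => /eqP.
Qed.

Lemma linear_onZ (U V : lmodType C) (D : set U) (f : U -> V) c x :
  is_submodule D -> linear_on D f -> D x -> f (c *: x) = c *: f x.
Proof.
move=> hD lf Dx; have := lf c x 0 Dx (proj1 hD).
by rewrite (linear_on0 hD lf) !addr0.
Qed.
End Submodules.

(** * Homogeneous polynomials and the phases in the unitary antipode *)

Section Degrees.
Context {R : realType} (q : R[i]) (A : cstarAlgType R) (alpha gamma : A).
Hypothesis hq0 : 0 < `|q|.
Local Notation C := (R[i] : numFieldType).
Local Notation P := (pol alpha gamma).
Variables (rho : A -> R[i] -> A) (hrho : is_circle_coaction alpha gamma rho).

Let rho_hom l : circle l -> star_hom (rho^~ l).
Proof. by case: hrho => _ h _ _; exact: h. Qed.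

Lemma circle_neq0 (l : R[i]) : circle l -> l != 0.
Proof. by move=> h; rewrite -normr_eq0 h oner_eq0. Qed.

Lemma circle_conj (l : R[i]) : circle l -> (l^*)%C = l^-1.
Proof. by move=> h; rewrite invc_norm h expr1n invr1 mul1r. Qed.

Lemma homogeneous_one : homogeneous rho 0 (aone : A).
Proof. by move=> l /rho_hom[_ -> _ _]; rewrite expr0z scale1r. Qed.

Lemma homogeneous_alpha : homogeneous rho 0 alpha.
Proof. by case: hrho => _ _ h _ l /h ->; rewrite expr0z scale1r. Qed.

Lemma homogeneous_gamma : homogeneous rho 1 gamma.
Proof. by case: hrho => _ _ _ h l /h ->; rewrite expr1z. Qed.

Lemma homogeneous_star n a : homogeneous rho n a -> homogeneous rho (- n) (star a).
Proof.
move=> h l hl; have [_ _ _ ->] := rho_hom hl; rewrite h // starZ.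
have -> : ((l ^ n)^*)%C = (l^*)%C ^ n 
  by apply: (rmorphXz (conjc : {rmorphism R[i] -> R[i]})); rewrite unitfE circle_neq0.
by rewrite circle_conj // exprz_inv.
Qed.

Lemma homogeneousM m n a b : homogeneous rho m a -> homogeneous rho n b ->
  homogeneous rho (m + n) (a ** b).
Proof.
move=> ha hb l hl; have [_ _ -> _] := rho_hom hl.
by rewrite ha // hb // amulZ amulZR scalerA expfzDr // circle_neq0.
Qed.

Definition homogeneous_pol : set A := [set a | P a /\ exists n, homogeneous rho n a].

(** The antipode, the scaling group and the residual map are prescribed on homogeneous elements;
    this spanning property lets identities reach all polynomials. *)
Lemma pol_homogeneous : P `<=` lin_span homogeneous_pol.
Proof.
have [Psub P1 PM PS] := @pol_subalgebra R A alpha gamma.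
have [S0 SD] := lin_span_submodule homogeneous_pol.
apply: pol_ind; last 2 first.
- apply: sub_lin_span; split; first exact: pol_alpha.
  by exists 0; exact: homogeneous_alpha.
- apply: sub_lin_span; split; first exact: pol_gamma.
  by exists 1; exact: homogeneous_gamma.
split=> //.
- apply: sub_lin_span; split => //; exists 0; exact: homogeneous_one.
- move=> x y Sx Sy; move: x Sx; apply: lin_span_ind.
    split; first by rewrite /= amul0.
    by move=> c x x' /= hx hx'; rewrite amulDl; exact: SD.
  move=> x [Px [m hx]] /=; move: y Sy; apply: lin_span_ind.
    split; first by rewrite /= amulR0.
    by move=> c y y' /= hy hy'; rewrite amulDr; exact: SD.
  move=> y [Py [n hy]] /=; apply: sub_lin_span; split; first exact: PM.
  by exists (m + n); exact: homogeneousM.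
- apply: lin_span_ind.
    split; first by rewrite /= star0.
    by move=> c y y' /= hy hy'; rewrite starD; exact: SD.
  move=> x [Px [m hx]]; apply: sub_lin_span; split; first exact: PS.
  by exists (- m); exact: homogeneous_star.
Qed.

Variables (SA : A -> A) (hSA : is_antipode q alpha gamma rho SA).
Variables (tau : R[i] -> A -> A) (htau : is_scaling q alpha gamma rho tau).
Variables (vartheta : A -> A) (hvartheta : is_residual q alpha gamma rho vartheta).
Let Rant := SA \o tau ('i%C / 2) \o vartheta.

(** The joint eigenvalue of [vartheta] and of the scaling group at i/2 in degree [n]: zeta^(n^2/2)
    |q|^(-n), since 2 i (i/2) = -1. *)
Definition antipode_coef (n : int) : R[i] :=
  cpow (zeta q) (2^-1 * n%:~R ^+ 2) * cpow `|q| (2 * 'i%C * ('i%C / 2) * n%:~R).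

(** The braiding exponent is absorbed by (m+n)^2/2 - mn = m^2/2 + n^2/2, while |q|^(-n) is already
    multiplicative in the degree. *)
Lemma antipode_coefD m n :
  antipode_coef (m + n) * cpow (zeta q) (- (m * n)%:~R) = antipode_coef m * antipode_coef n.
Proof.
rewrite /antipode_coef mulrAC -cpowD rmorphD rmorphM /= half_sqrD cpowD mulrDr.
by rewrite [X in _ * X = _]cpowD mulrACA.
Qed.

Lemma Rant_homogeneous n a : P a -> homogeneous rho n a ->
  Rant a = antipode_coef n *: SA a.
Proof.
move=> Pa ha; have [Psub _ _ _] := @pol_subalgebra R A alpha gamma.
have [_ _ hv] := hvartheta; have [_ lt ht] := htau ('i%C / 2).
rewrite /Rant /= (hv n) // (linear_onZ _ Psub lt) // (ht n) // scalerA.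
by rewrite (linear_onZ _ Psub (antipode_linear hSA)).
Qed.

Lemma Rant_linear : linear_on P Rant.
Proof.
move=> c x y Px Py; have [_ lt _] := htau ('i%C / 2); have [Pv lv _] := hvartheta.
have [Pt _ _] := htau ('i%C / 2).
rewrite /Rant /= lv // lt; [|exact: Pv..].
by rewrite (antipode_linear hSA) //; apply: Pt; exact: Pv.
Qed.

Lemma RantM a b : P a -> P b -> Rant (a ** b) = Rant b ** Rant a.
Proof.
have [[P0 PD] P1 PM PS] := @pol_subalgebra R A alpha gamma.
have lR := Rant_linear.
have R0 : Rant 0 = 0 by exact: (linear_on0 (conj P0 PD) lR).
(* Membership in [P] is carried along because [Rant] is linear only there. A second span induction,
   over [F], treats the other factor. *)
pose E := [set a | P a /\ forall b, P b -> Rant (a ** b) = Rant b ** Rant a].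
move=> Pa Pb; suff : E a by case=> _; exact.
move/pol_homogeneous: Pa; apply: lin_span_ind.
  split; first by split => // d Pd; rewrite amul0 R0 amulR0.
  move=> c x y [Px hx] [Py hy]; split; first exact: PD.
  by move=> d Pd; rewrite amulDl !lR ?hx ?hy ?amulDr //; exact: PM.
move=> {}a [Pa [m ha]]; split=> // {}b {}Pb.
pose F := [set b | P b /\ Rant (a ** b) = Rant b ** Rant a].
suff : F b by case.
move/pol_homogeneous: Pb; apply: lin_span_ind.
  split; first by split => //; rewrite amulR0 R0 amul0.
  move=> c x y [Px hx] [Py hy]; split; first exact: PD.
  by rewrite amulDr !lR ?hx ?hy ?amulDl //; exact: PM.
move=> {}b [Pb [n hb]]; split => //.
rewrite (Rant_homogeneous (PM _ _ Pa Pb) (homogeneousM ha hb)).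
rewrite (Rant_homogeneous Pa ha) (Rant_homogeneous Pb hb).
rewrite (antipode_mul hSA Pa Pb ha hb) scalerA antipode_coefD.
by rewrite amulZ amulZR scalerA mulrC.
Qed.

Let c := cpow (zeta q) 2^-1 * ((q^*)%C / `|q|).

Lemma q_neq0 : q != 0.
Proof. by rewrite -normr_gt0. Qed.

Lemma zeta_circle : `|zeta q| = 1.
Proof. by rewrite /zeta normrM normfV normcJ divff // gt_eqF. Qed.

(** The square is zeta conj(q)^2 / |q|^2 = q conj(q) / |q|^2. Only the square of zeta^(1/2) enters;
    the branch of the root decides the sign of [c]. *)
Lemma antipode_const_sqr : c * c = 1.
Proof.
have zz : cpow (zeta q) 2^-1 * cpow (zeta q) 2^-1 = zeta q.
  rewrite -cpowD half_add_half.
  by rewrite /cpow mul1r cexp_clog // zeta_circle.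
rewrite /c mulrACA zz /zeta.
have nq : `|q| != 0 by rewrite gt_eqF.
have nn := norm_sqr q; have cq := conj_neq0 q_neq0.
have -> : q / q^*%C * (q^*%C / `|q| * (q^*%C / `|q|)) = (q^*%C * q) / `|q| ^+ 2.
  exact: phase_sqr.
by rewrite -nn divff // expf_neq0.
Qed.

Lemma antipode_const_real : (c^*)%C = c.
Proof.
have /eqP := antipode_const_sqr; rewrite -expr2 sqrf_eq1 => /orP[] /eqP ->.
  exact: conjc1.
by rewrite rmorphN rmorph1.
Qed.

Lemma antipode_coef0 : antipode_coef 0 = 1.
Proof. by rewrite /antipode_coef !mulr0z expr0n !mulr0 !cpow0 mulr1. Qed.

Let absE : `|q| = (nr q)%:C. Proof. exact: nrE. Qed.
Let abs_gt0 : 0 < nr q. Proof. by rewrite -ltcR -absE. Qed.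

Lemma i_coef (n : int) : 2 * 'i%C * ('i%C / 2) * n%:~R = (- n%:~R : R)%:C :> R[i].
Proof.
by rewrite two_half_mul sqr_i mulN1r rmorphN /= rmorph_int.
Qed.

Lemma Rant_gens :
  [/\ Rant aone = aone, Rant alpha = star alpha, Rant (star alpha) = alpha,
      Rant gamma = - (c *: gamma) & Rant (star gamma) = - (c *: star gamma)].
Proof.
have [[P0 PD] P1 PM PS] := @pol_subalgebra R A alpha gamma.
have Pa := @pol_alpha R A alpha gamma; have Pg := @pol_gamma R A alpha gamma.
split.
- by rewrite (Rant_homogeneous P1 homogeneous_one) antipode_coef0 scale1r (antipode_one hSA).
- by rewrite (Rant_homogeneous Pa homogeneous_alpha) antipode_coef0 scale1r (antipode_alpha hSA).
- have := homogeneous_star homogeneous_alpha; rewrite oppr0 => h.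
  by rewrite (Rant_homogeneous (PS _ Pa) h) antipode_coef0 scale1r (antipode_star_alpha hSA).
(* In degree 1 the factor is zeta^(1/2) / |q|, and the antipode contributes -conj(q). *)
- rewrite (Rant_homogeneous Pg homogeneous_gamma) (antipode_gamma hSA) scalerN scalerA.
  congr (- (_ *: _)); rewrite /antipode_coef i_coef expr1n mulr1 absE cpow_pos_real //.
  rewrite mulN1r -lnV ?posrE // lnK ?posrE ?invr_gt0 // /c absE fmorphV -mulrA.
  by congr (_ * _); rewrite mulrC.
(* In degree -1 the factor is zeta^(1/2) |q|, and the antipode contributes -1/q. Since |q| / q =
   conj(q) / |q|, the coefficient is again [- c]. *)
- rewrite (Rant_homogeneous (PS _ Pg) (homogeneous_star homogeneous_gamma)).
  rewrite (antipode_star_gamma hSA) scalerN scalerA.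
  congr (- (_ *: _)); rewrite /antipode_coef i_coef rmorphN sqrrN expr1n mulr1 absE.
  rewrite cpow_pos_real // opprK mul1r lnK ?posrE // /c -mulrA; congr (_ * _).
  rewrite -absE; have nq : `|q| != 0 by rewrite gt_eqF.
  have nn := norm_sqr q; have q0 := q_neq0.
  by apply: (mulIf nq); rewrite mulrAC -expr2 nn divfK // mulfK.
Qed.

Lemma Rant_flip (f : A -> A) :
  linear f -> f aone = aone -> (forall x y, f (x ** y) = f y ** f x) ->
  (forall x, f (star x) = star (f x)) -> f alpha = star alpha ->
  f gamma = - c *: gamma -> forall a, P a -> f a = Rant a.
Proof.
move=> lf f1 fM fS fa fg.
have [[P0 PD] P1 PM PS] := @pol_subalgebra R A alpha gamma.
have lR := Rant_linear; have R0 : Rant 0 = 0 by exact: (linear_on0 (conj P0 PD) lR).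
have f0 := lin0 lf.
have [r1 ra rsa rg rsg] := Rant_gens.
(* [Rant] is not yet known to commute with [star], so agreement at [star a] is made part of the set;
   this is what closes it under [star]. *)
pose E := [set a | [/\ P a, f a = Rant a & f (star a) = Rant (star a)]].
suff PE : P `<=` E by move=> a /PE[].
apply: pol_ind.
- split; [split| | |].
  + by split => //; rewrite ?star0 f0 R0.
  + move=> k x y [Px hx hsx] [Py hy hsy]; split; first exact: PD.
      by rewrite lf lR ?hx ?hy.
    by rewrite starD lf lR ?hsx ?hsy //; exact: PS.
  + by split => //; rewrite ?star1 f1 r1.
  + move=> x y [Px hx hsx] [Py hy hsy]; split; first exact: PM.
      by rewrite fM RantM // hx hy.
    by rewrite starM fM RantM ?hsx ?hsy //; exact: PS.
  + by move=> x [Px hx hsx]; split => //; [exact: PS|rewrite starK].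
- split; [exact: pol_alpha|by rewrite fa ra|by rewrite fS fa starK rsa].
- split; [exact: pol_gamma|by rewrite fg rg scaleNr|].
  by rewrite fS fg rsg starZ rmorphN /= antipode_const_real scaleNr.
Qed.

End Degrees.

(** * Invariance of the Haar state *)

Section StarHom.
Context {R : realType}.
Local Notation C := (R[i] : numFieldType).

Definition apow (A : cstarAlgType R) (x : A) n : A := iter n (amul x) aone.

Lemma apowS (A : cstarAlgType R) (x : A) n : apow x n.+1 = x ** apow x n.
Proof. by []. Qed.

Lemma apow_comm (A : cstarAlgType R) (c : C) (g x : A) n : g ** x = c *: (x ** g) ->
  g ** apow x n = c ^+ n *: (apow x n ** g).
Proof.
move=> gx; elim: n => [|n ih]; first by rewrite amul1r amul1l scale1r.
by rewrite apowS amulA gx amulZ -amulA ih amulZR scalerA amulA exprS.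
Qed.

Lemma apowSr (A : cstarAlgType R) (x : A) n : apow x n.+1 = apow x n ** x.
Proof. by rewrite apowS (@apow_comm _ 1) ?scale1r // expr1n scale1r. Qed.

Lemma apow_comm1 (A : cstarAlgType R) (x y : A) n m : x ** y = y ** x ->
  apow x n ** apow y m = apow y m ** apow x n.
Proof.
move=> xy; have h : apow x n ** y = y ** apow x n.
  by have := @apow_comm A 1 y x n; rewrite xy expr1n !scale1r => /(_ erefl).
by have := @apow_comm A 1 (apow x n) y m; rewrite h expr1n !scale1r => /(_ erefl).
Qed.

Lemma apowZ (A : cstarAlgType R) (c : C) (x : A) n : apow (c *: x) n = c ^+ n *: apow x n.
Proof.
elim: n => [|n ih]; first by rewrite scale1r.
by rewrite !apowS ih amulZ amulZR scalerA exprS.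
Qed.

Lemma hom_apow (A D : cstarAlgType R) (f : A -> D) x n : star_hom f ->
  f (apow x n) = apow (f x) n.
Proof. by case=> _ f1 fM _; elim: n => [//|n ih]; rewrite !apowS fM ih. Qed.

Lemma antihom_apow (A : cstarAlgType R) (f : A -> A) x n : f aone = aone ->
  (forall x y, f (x ** y) = f y ** f x) -> f (apow x n) = apow (f x) n.
Proof. by move=> f1 fM; elim: n => [//|n ih]; rewrite apowS fM ih apowSr. Qed.

(* Right and left invariance of the Haar state are treated at once: [j] is the
   leg on which the character [f] is evaluated, [i] the other one. *)
Section Slices.
Variables (B BB : cstarAlgType R) (i j Delta : B -> BB) (s : BB -> B) (h : B -> R[i]).
Variables (f sigma : B -> B).
Hypotheses (hi : star_hom i) (hj : star_hom j) (hDelta : star_hom Delta).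
Hypotheses (hf : star_hom f) (hsigma : star_hom sigma).
Hypothesis ij : forall a b, i a ** j b = j b ** i a.
Hypotheses (ls : linear s) (hs : forall a b, s (i a ** j b) = h a *: b).
Hypotheses (lh : scalar h) (inv : forall x, s (Delta x) = h x *: aone).

(** A relational form of the slice id (x) [f] on the algebraic tensor product, the second component
    being the image of the first. A relation raises no question of well-definedness or
    continuity. *)
Let graph : set (BB * B)%type :=
  lin_span [set t | exists a b c, f b = c *: aone /\ t = (i a ** j b, c *: a)].
Definition slice_graph : set (BB * B)%type := graph.

Lemma slice_graph_tensor a b c : f b = c *: aone -> slice_graph (i a ** j b, c *: a).
Proof. by move=> fb; apply: sub_lin_span; exists a, b, c. Qed.

Lemma slice_graph_lin c t t' y y' : slice_graph (t, y) -> slice_graph (t', y') ->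
  slice_graph (c *: t + t', c *: y + y').
Proof. exact: (lin_span_submodule _).2. Qed.

Lemma slice_graph0 : slice_graph (0, 0).
Proof. exact: (lin_span_submodule _).1. Qed.

(** Slicing one leg with [h] and the other with [f] can be done in either order. *)
Lemma slice_graph_eval t y : slice_graph (t, y) -> f (s t) = h y *: aone.
Proof.
have [lf f1 fM fS] := hf.
suff : slice_graph `<=` [set t | f (s t.1) = h t.2 *: aone] by move=> H /H.
apply: lin_span_ind.
  split; first by rewrite /= (lin0 ls) (lin0 lf) (form0 lh) scale0r.
  move=> c x x' /= hx hx'; rewrite ls lf lh hx hx' scalerDl scalerA //.
move=> _ [a [b [c [fb ->]]]] /=.
by rewrite (formZ lh) hs (linZ lf) fb scalerA mulrC.
Qed.

Lemma slice_graphM t t' y y' : slice_graph (t, y) -> slice_graph (t', y') ->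
  slice_graph (t ** t', y ** y').
Proof.
have [lf f1 fM fS] := hf; have [_ _ iM _] := hi; have [_ _ jM _] := hj.
pose D := [set u : (BB * B)%type | forall u', slice_graph u' -> slice_graph (u.1 ** u'.1, u.2 ** u'.2)].
move=> hy hy'; suff : slice_graph `<=` D by move=> /(_ _ hy (t', y') hy').
apply: lin_span_ind.
  split; first by move=> u' _; rewrite /= !amul0; exact: slice_graph0.
  move=> c u v hu hv u' hu' /=; rewrite !amulDl.
  by apply: slice_graph_lin; [exact: hu|exact: hv].
move=> _ [a [b [c [fb ->]]]] /=.
suff : slice_graph `<=` [set u' | slice_graph (i a ** j b ** u'.1, c *: a ** u'.2)] by [].
apply: lin_span_ind.
  split; first by rewrite /= !amulR0; exact: slice_graph0.
  move=> d u v hu hv /=; rewrite !amulDr; exact: slice_graph_lin.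
move=> _ [a' [b' [c' [fb' ->]]]] /=.
(* The two legs commute, so a product of elementary tensors is elementary. *)
have -> : i a ** j b ** (i a' ** j b') = i (a ** a') ** j (b ** b').
  by rewrite iM jM -!amulA; congr (_ ** _); rewrite !amulA ij.
have -> : c *: a ** (c' *: a') = (c * c') *: (a ** a').
  by rewrite amulZ amulZR scalerA.
by apply: slice_graph_tensor; rewrite fM fb fb' amulZ amulZR amul1l scalerA.
Qed.

Lemma slice_graph_star t y : slice_graph (t, y) -> slice_graph (star t, star y).
Proof.
have [lf f1 fM fS] := hf; have [_ _ _ iS] := hi; have [_ _ _ jS] := hj.
suff : slice_graph `<=` [set u | slice_graph (star u.1, star u.2)] by move=> H /H.
apply: lin_span_ind.
  split; first by rewrite /= !star0; exact: slice_graph0.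
  by move=> c u v hu hv /=; rewrite !starD; exact: slice_graph_lin.
move=> _ [a [b [c [fb ->]]]] /=.
rewrite starM -iS -jS -ij starZ; apply: slice_graph_tensor.
by rewrite fS fb starZ star1.
Qed.

(** [sigma] plays the part of the translation, that is, [Delta] followed by the slice with [f]. The
    graph is stable under the star-algebra operations, so this is checked on generators. Applying
    [s] first gives [h (kappa x)] by invariance; [slice_graph_eval] gives [h (sigma (kappa x))]. *)
Lemma slice_invariant (A : cstarAlgType R) (kappa : A -> B) (alpha gamma : A) :
  star_hom kappa ->
  slice_graph (Delta (kappa alpha), sigma (kappa alpha)) ->
  slice_graph (Delta (kappa gamma), sigma (kappa gamma)) ->
  aone != 0 :> B ->
  forall x, pol alpha gamma x -> h (sigma (kappa x)) = h (kappa x).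
Proof.
move=> [lk k1 kM kS] ga gg n0 x Px.
have [lf f1 _ _] := hf; have [ld d1 dM dS] := hDelta; have [lg g1 gM gS] := hsigma.
have [_ i1 _ _] := hi; have [_ j1 _ _] := hj.
have : slice_graph (Delta (kappa x), sigma (kappa x)).
  move: x Px; apply: pol_ind => //; split; [split| | |].
  - by rewrite /= (lin0 lk) (lin0 ld) (lin0 lg); exact: slice_graph0.
  - by move=> c x y /= hx hy; rewrite lk ld lg; exact: slice_graph_lin.
  - have := @slice_graph_tensor aone aone 1; rewrite f1 !scale1r i1 j1 amul1l.
    by rewrite /= k1 d1 g1; exact.
  - by move=> x y hx hy /=; rewrite kM dM gM; exact: slice_graphM.
  - by move=> x hx /=; rewrite kS dS gS; exact: slice_graph_star.
move/slice_graph_eval; rewrite inv (linZ lf) f1 => /eqP.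
by rewrite -subr_eq0 -scalerBl scaler_eq0 (negPf n0) orbF subr_eq0 => /eqP.
Qed.

End Slices.
End StarHom.

(** * Translations of the Haar state by characters of B *)

Section Haar.
Context {R : realType} (q : R[i]).
Local Notation C := (R[i] : numFieldType).

Lemma circle_conjM (mu : R[i]) : circle mu -> (mu^*)%C * mu = 1.
Proof. by move=> h; rewrite mulrC -sqr_normc h expr1n. Qed.

Lemma torus_relations (D : cstarAlgType R) (a g : D) (mu nu : R[i]) :
  circle mu -> circle nu -> suq2_relations q a g ->
  suq2_relations q (mu *: a) (nu *: g).
Proof.
move=> /circle_conjM hmu /circle_conjM hnu [r1 r2 r3 r4].
split; rewrite !(starZ, amulZ, amulZR) !scalerA.
- by rewrite ![_ * (_^*)%C]mulrC hmu hnu !scale1r.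
- by rewrite -[in X in _ + X]mulrA ![_ * (_^*)%C]mulrC hmu hnu mulr1 !scale1r.
- by rewrite r3 scalerA; congr (_ *: _); rewrite mulrC [mu * nu]mulrC.
- by rewrite r4 mulrC.
Qed.

Variables (A B BB : cstarAlgType R) (alpha gamma : A) (alphaB gammaB z : B).
Hypotheses (hA : is_universal_suq2 q alpha gamma).
Hypotheses (hB : is_universal_boson q alphaB gammaB z).
Variables (i1 i2 : B -> BB) (Delta : B -> BB) (haarB : B -> R[i]).
Hypotheses (hBB : is_cstar_tensor i1 i2).
Hypothesis hDelta : is_comultiplication q i1 i2 alphaB gammaB z Delta.
Hypothesis hhaarB : is_haar_state i1 i2 Delta haarB.
Variable kappa : A -> B.
Hypotheses (hkappa : star_hom kappa).
Hypotheses (kalpha : kappa alpha = alphaB) (kgamma : kappa gamma = gammaB).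
Local Notation h := (haarB \o kappa).

Lemma torus_exists (mu nu : R[i]) : circle mu -> circle nu ->
  exists theta : A -> A,
    [/\ star_hom theta, theta alpha = mu *: alpha & theta gamma = nu *: gamma].
Proof.
by move=> hmu hnu; apply: (universal_hom hA); apply: torus_relations => //; case: hA.
Qed.

Lemma boson_hom (D : cstarAlgType R) (x y w : D) : boson_relations q x y w ->
  exists f : B -> D, [/\ star_hom f, f alphaB = x, f gammaB = y & f z = w].
Proof. by case: hB => _ H /H[f [hf _]]; exists f. Qed.

Lemma boson_torus (mu nu : R[i]) : circle mu -> circle nu ->
  exists sigma : B -> B,
    [/\ star_hom sigma, sigma alphaB = mu *: alphaB & sigma gammaB = nu *: gammaB].
Proof.
move=> hmu hnu; case: (hB) => -[r1 r2 r3 r4 r5] _.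
have [|f [hf fa fg _]] := @boson_hom B (mu *: alphaB) (nu *: gammaB) z; last by exists f.
split => //; first exact: torus_relations.
- by rewrite amulZR amulZ r4.
- by rewrite amulZR amulZ r5 !scalerA mulrC.
Qed.

(** Characters are realised as endomorphisms of [B] sending the generators to multiples of [aone],
    so that universality applies directly. Killing [gammaB] leaves only the conditions that [mu] and
    [nu] be phases. *)
Lemma boson_character (mu nu : R[i]) : circle mu -> circle nu ->
  exists f : B -> B,
    [/\ star_hom f, f alphaB = mu *: aone, f gammaB = 0 & f z = nu *: aone].
Proof.
move=> /circle_conjM hmu /circle_conjM hnu.
have hmu' : mu * (mu^*)%C = 1 by rewrite mulrC.
have hnu' : nu * (nu^*)%C = 1 by rewrite mulrC.
apply: boson_hom; split.
- by split; rewrite !(starZ, star0, star1, amulZ, amulZR, amul0, amulR0, amul1l, scaler0, addr0) //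
    scalerA ?hmu ?hmu' scale1r.
- by rewrite starZ star1 amulZ amulZR amul1l scalerA ?hnu ?hnu' scale1r.
- by rewrite starZ star1 amulZ amulZR amul1l scalerA ?hnu ?hnu' scale1r.
- by rewrite starZ star1 !(amulZ, amulZR, amul1l, amul1r) !scalerA hnu mul1r.
- by rewrite amulR0 amul0 scaler0.
Qed.

Lemma boson_nontrivial : aone != 0 :> B.
Proof.
case: hhaarB => -[lh _ h1] _; apply/eqP => e; move: h1; rewrite e (form0 lh).
by move/eqP; rewrite eq_sym oner_eq0.
Qed.

Lemma haar_torus_comp (mu nu : R[i]) theta sigma : star_hom theta -> star_hom sigma ->
  theta alpha = mu *: alpha -> theta gamma = nu *: gamma ->
  sigma alphaB = mu *: alphaB -> sigma gammaB = nu *: gammaB ->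
  forall x, kappa (theta x) = sigma (kappa x).
Proof.
move=> ht hs ta tg sa sg x; have [lk _ _ _] := hkappa.
have : kappa \o theta = sigma \o kappa; last by move/(congr1 (@^~ x)).
apply: (universal_uniq hA); [exact: star_hom_comp..| |] => /=.
  by rewrite ta (linZ lk) kalpha sa.
by rewrite tg (linZ lk) kgamma sg.
Qed.

(* Right translation by the character [alpha |-> mu, gamma |-> 0, z |-> 1]. *)
Lemma haar_right (mu : R[i]) theta : circle mu -> star_hom theta ->
  theta alpha = mu *: alpha -> theta gamma = mu *: gamma ->
  forall x, pol alpha gamma x -> h (theta x) = h x.
Proof.
move=> hmu ht ta tg x Px.
have c1 : circle (1 : R[i]) by rewrite /circle /= normr1.
have [f [hf fa fg fz]] := boson_character hmu c1.
have [sigma [hs sa sg]] := boson_torus hmu hmu.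
rewrite /= (haar_torus_comp ht hs ta tg sa sg).
case: (hBB) => hi1 hi2 i12 _ _; case: (hDelta) => hD Da Dg _.
case: (hhaarB) => -[lh _ _] [s1 [_ [[ls1 _ hs1] _ inv1 _]]].
have gt := @slice_graph_tensor R B BB i1 i2 f.
have gl := @slice_graph_lin R B BB i1 i2 f.
apply: (slice_invariant hi1 hi2 hD hf hs i12 ls1 hs1 lh inv1 hkappa _ _ boson_nontrivial Px).
- rewrite kalpha Da sa -scaleNr addrC.
  have := gt (star gammaB ** z) gammaB 0.
  rewrite fg !scale0r => /(_ erefl) H; have := gl (- q) _ _ _ _ H (gt alphaB alphaB mu fa).
  by rewrite scaler0 add0r.
- rewrite kgamma Dg sg -[i1 gammaB ** _]scale1r.
  have := gt (star alphaB ** z) gammaB 0; rewrite fg !scale0r => /(_ erefl) H.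
  by have := gl 1 _ _ _ _ (gt gammaB alphaB mu fa) H; rewrite !scale1r addr0.
Qed.

(* Left translation by the character [alpha |-> 1, gamma |-> 0, z |-> nu]. *)
Lemma haar_left (nu : R[i]) theta : circle nu -> star_hom theta ->
  theta alpha = alpha -> theta gamma = nu *: gamma ->
  forall x, pol alpha gamma x -> h (theta x) = h x.
Proof.
move=> hnu ht ta tg x Px.
have c1 : circle (1 : R[i]) by rewrite /circle /= normr1.
have [f [hf fa fg fz]] := boson_character c1 hnu.
have [sigma [hs sa sg]] := boson_torus c1 hnu.
have ta' : theta alpha = 1 *: alpha by rewrite scale1r.
rewrite /= (haar_torus_comp ht hs ta' tg sa sg).
case: (hBB) => hi1 hi2 i12 _ _; case: (hDelta) => hD Da Dg _.
case: (hhaarB) => -[lh _ _] [_ [s2 [_ [ls2 _ hs2] _ inv2]]].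
have gt := @slice_graph_tensor R B BB i2 i1 f.
have gl := @slice_graph_lin R B BB i2 i1 f.
have i21 a b : i2 a ** i1 b = i1 b ** i2 a by rewrite i12.
have hs2' a b : s2 (i2 a ** i1 b) = haarB a *: b by rewrite i21 hs2.
have [_ _ fM fS] := hf.
apply: (slice_invariant hi2 hi1 hD hf hs i21 ls2 hs2' lh inv2 hkappa _ _ boson_nontrivial Px).
- rewrite kalpha Da sa -scaleNr addrC -!i21.
  have := gt gammaB (star gammaB ** z) 0.
  rewrite fM fS fg star0 amul0 !scale0r => /(_ erefl) H.
  have := gl (- q) _ _ _ _ H (gt alphaB alphaB 1 fa).
  by rewrite scaler0 add0r.
- rewrite kgamma Dg sg -!i21 addrC -[i2 gammaB ** _]scale1r.
  have := gt gammaB (star alphaB ** z) nu.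
  rewrite fM fS fa fz starZ star1 conjc1 scale1r amul1l => /(_ erefl) H.
  have := gt alphaB gammaB 0; rewrite fg !scale0r => /(_ erefl) H'.
  by have := gl 1 _ _ _ _ H H'; rewrite !scale1r addr0.
Qed.
End Haar.

Section Roots.
Context {R : realType}.

Lemma cexp_circle (t : R) : circle (cexp (0 +i* t)).
Proof.
rewrite /circle /= /cexp /= expR0 mul1r normc_def /=.
by rewrite cos2Dsin2 sqrtr1.
Qed.

Lemma cexpMn (z : R[i]) n : cexp z ^+ n = cexp (z *+ n).
Proof.
elim: n => [|n ih]; last by rewrite exprS ih -cexpD mulrS.
by rewrite expr0 mulr0n (cexp_real 0) expR0.
Qed.

(** Separates weights: every positive weight [k] takes the value -1, hence a value other than 1, at
    some phase. *)
Lemma circle_root_opp1 k : (0 < k)%N -> exists2 l : R[i], circle l & l ^+ k = -1.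
Proof.
move=> k0; exists (cexp (0 +i* (pi / k%:R))); first exact: cexp_circle.
rewrite cexpMn (_ : _ *+ k = 0 +i* pi).
  by rewrite /cexp /= expR0 mul1r cospi sinpi; apply/eqP; rewrite eq_complex /= oppr0 !eqxx.
have imn (t : R) n : (0 +i* t) *+ n = 0 +i* (t *+ n).
  elim: n => [|n ih]; first by rewrite !mulr0n.
  by rewrite !mulrS ih; apply/eqP; rewrite eq_complex /= addr0 !eqxx.
by rewrite imn -(mulr_natr (pi / k%:R)) divfK // pnatr_eq0 -lt0n.
Qed.

End Roots.

(** * Normally ordered monomials span the polynomials *)

Section NormalOrder.
Context {R : realType} (q : R[i]) (A : cstarAlgType R) (alpha gamma : A).
Hypotheses (q0 : q != 0) (rel : suq2_relations q alpha gamma).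
Local Notation C := (R[i] : numFieldType).
Local Notation P := (pol alpha gamma).

Definition gmono m n : A := apow gamma m ** apow (star gamma) n.

Definition monomials : set A :=
  [set x | exists k m n, x = apow alpha k ** gmono m n \/ x = apow (star alpha) k ** gmono m n].

Let S := lin_span monomials.
Let S0 : S 0 := (lin_span_submodule monomials).1.
Let SD : forall (c : C) x y, S x -> S y -> S (c *: x + y) := (lin_span_submodule monomials).2.

Let SZ (c : C) x : S x -> S (c *: x).
Proof. by move=> Sx; have := SD c Sx S0; rewrite addr0. Qed.

Let mono_in k m n : S (apow alpha k ** gmono m n) /\ S (apow (star alpha) k ** gmono m n).
Proof. by split; apply: sub_lin_span; exists k, m, n; [left|right]. Qed.

Let left_mult (a : A) : monomials `<=` [set x | S (a ** x)] -> forall x, S x -> S (a ** x).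
Proof.
move=> h; apply: lin_span_ind => //; split; first by rewrite /= amulR0.
by move=> c x y /= hx hy; rewrite amulDr; exact: SD.
Qed.

Let star_gamma_gmono m n : star gamma ** gmono m n = gmono m n.+1.
Proof.
have [_ _ _ r4] := rel.
have h : star gamma ** apow gamma m = apow gamma m ** star gamma.
  by rewrite (@apow_comm _ _ 1) ?expr1n ?scale1r // r4.
by rewrite /gmono amulA h -amulA.
Qed.

Let gamma_gmono m n : gamma ** gmono m n = gmono m.+1 n.
Proof. by rewrite /gmono amulA. Qed.

Let quasi_comm (g : A) (c d : C) : g ** alpha = c *: (alpha ** g) ->
  g ** star alpha = d *: (star alpha ** g) ->
  (forall m n, exists m' n', g ** gmono m n = gmono m' n') ->
  forall x, S x -> S (g ** x).
Proof.
move=> hc hd hg; apply: left_mult => x [k [m [n hx]]].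
have [m' [n' e]] := hg m n; have [M1 M2] := mono_in k m' n'.
case: hx => ->; rewrite /= amulA.
  by rewrite (apow_comm _ hc) amulZ -amulA e; exact: SZ.
by rewrite (apow_comm _ hd) amulZ -amulA e; exact: SZ.
Qed.

Lemma star_gamma_star_alpha : star gamma ** star alpha = q *: (star alpha ** star gamma).
Proof. by have [_ _ r3 _] := rel; rewrite -!starM r3 starZ conjcK. Qed.

Let Sgamma x : S x -> S (gamma ** x).
Proof.
apply: (quasi_comm (c := ((q^*)%C)^-1) _ (gamma_star_alpha q0 rel)).
  have [_ _ -> _] := rel; rewrite scalerA mulVf ?scale1r //; exact: conj_neq0.
by move=> m n; exists m.+1, n.
Qed.

Let Sstar_gamma x : S x -> S (star gamma ** x).
Proof.
apply: (quasi_comm (c := q^-1) _ star_gamma_star_alpha).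
  by rewrite (alpha_star_gamma q0 rel) scalerA mulVf ?scale1r.
by move=> m n; exists m, n.+1.
Qed.

Let Salpha x : S x -> S (alpha ** x).
Proof.
have [_ r2 _ _] := rel.
apply: left_mult => _ [k [m [n [->|->]]]] /=.
  by rewrite amulA -apowS; case: (mono_in k.+1 m n).
(* For [k = 0] the monomial is also of the first kind and [alpha] is simply prepended. Otherwise
   [alpha ** star alpha] is contracted by the second relation, and the resulting [gamma] factors are
   absorbed from the left. *)
case: k => [|k].
  by rewrite amul1l; have [] := mono_in 1 m n; rewrite /= amul1r.
have E G : alpha ** (star alpha ** G)
    = - `|q| ^+ 2 *: (star gamma ** (gamma ** G)) + G.
  by rewrite !amulA -[X in _ = _ + X]amul1l -r2 amulD amulZ scaleNr addrC addrK.
rewrite apowS -amulA E.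
by apply: SD; [apply: Sstar_gamma; apply: Sgamma|]; case: (mono_in k m n).
Qed.

Let Sstar_alpha x : S x -> S (star alpha ** x).
Proof.
have [r1 _ _ _] := rel.
apply: left_mult => _ [k [m [n [->|->]]]] /=; last first.
  by rewrite amulA -apowS; case: (mono_in k.+1 m n).
case: k => [|k].
  by rewrite amul1l; have [_] := mono_in 1 m n; rewrite /= amul1r.
have E G : star alpha ** (alpha ** G) = -1 *: (star gamma ** (gamma ** G)) + G.
  by rewrite !amulA -[X in _ = _ + X]amul1l -r1 amulD scaleN1r addrC addrK.
rewrite apowS -amulA E.
by apply: SD; [apply: Sstar_gamma; apply: Sgamma|]; case: (mono_in k m n).
Qed.

(** The elements [x] such that [x] and [star x] both multiply [S] into itself form a star subalgebra
    containing the generators; [x] is then recovered as [x ** aone]. *)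
Lemma pol_monomials : P `<=` lin_span monomials.
Proof.
pose D := [set x : A | (forall y, S y -> S (x ** y)) /\ (forall y, S y -> S (star x ** y))].
have S1 : S aone.
  by have [] := mono_in 0 0 0; rewrite /gmono /= !amul1l.
suff PD : P `<=` D by move=> x /PD[/(_ _ S1)]; rewrite amul1r.
apply: pol_ind; [|by split..].
split; [split| | |].
- by split => y _; rewrite ?star0 amul0.
- move=> c x y [hx hx'] [hy hy']; split => u Su.
    by rewrite amulDl; apply: SD; [exact: hx|exact: hy].
  by rewrite starD amulDl; apply: SD; [exact: hx'|exact: hy'].
- by split => y; rewrite ?star1 amul1l.
- move=> x y [hx hx'] [hy hy']; split => u Su.
    by rewrite -amulA; apply: hx; exact: hy.
  by rewrite starM -amulA; apply: hy'; exact: hx'.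
- by move=> x [hx hx']; split; rewrite ?starK.
Qed.

End NormalOrder.

(** * Torus weights and invariance of the state under the flip *)

Section FlipInvariance.
Context {R : realType} (q : R[i]) (A : cstarAlgType R) (alpha gamma : A).
Hypotheses (q0 : q != 0) (hA : is_universal_suq2 q alpha gamma).
Local Notation C := (R[i] : numFieldType).
Local Notation P := (pol alpha gamma).
Variable f : A -> A.
Hypotheses (lf : linear f) (f1 : f aone = aone)
  (fM : forall x y, f (x ** y) = f y ** f x) (fS : forall x, f (star x) = star (f x))
  (fK : forall x, f (f x) = x) (fa : f alpha = star alpha).
Variable c : C.
Hypotheses (cr : (c^*)%C = c) (cc : c * c = 1) (fg : f gamma = c *: gamma).

Lemma flip_pol x : P x -> P (f x).
Proof.
have [[P0 PD] P1 PM PS] := @pol_subalgebra R A alpha gamma.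
move: x; apply: pol_ind.
- split; [split| | |].
  + by rewrite /= (lin0 lf).
  + by move=> k x y /= hx hy; rewrite lf; exact: PD.
  + by rewrite /= f1.
  + by move=> x y /= hx hy; rewrite fM; exact: PM.
  + by move=> x /= hx; rewrite fS; exact: PS.
- by rewrite /= fa; apply: PS; exact: pol_alpha.
- by rewrite /= fg; have := PD c _ _ (@pol_gamma R A alpha gamma) P0; rewrite addr0.
Qed.

(** Conjugation by [f] exchanges [alpha] with [star alpha], which carries the conjugate phase, while
    [gamma] is only rescaled. Two star homomorphisms are thus compared on generators. *)
Lemma flip_torus (mu nu : R[i]) theta theta' : star_hom theta -> star_hom theta' ->
  theta alpha = mu *: alpha -> theta gamma = nu *: gamma ->
  theta' alpha = (mu^*)%C *: alpha -> theta' gamma = nu *: gamma ->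
  forall x, f (theta x) = theta' (f x).
Proof.
move=> [lt t1 tM tS] ht' ta tg ta' tg' x.
have E : f \o theta \o f = theta'.
  apply: (universal_uniq hA _ ht') => /=.
  - split=> /=.
    + by move=> k u v /=; rewrite lf lt lf.
    + by rewrite f1 t1 f1.
    + by move=> u v; rewrite fM tM fM.
    + by move=> u; rewrite fS tS fS.
  - by rewrite fa tS ta starZ (linZ lf) fS fa starK ta'.
  - by rewrite fg (linZ lt) tg !(linZ lf) fg !scalerA mulrAC cc mul1r tg'.
by rewrite -E /= fK.
Qed.

Variable h : A -> R[i].
Hypothesis lh : scalar h.
Hypothesis h_right : forall mu theta, circle mu -> star_hom theta ->
  theta alpha = mu *: alpha -> theta gamma = mu *: gamma ->
  forall x, P x -> h (theta x) = h x.
Hypothesis h_left : forall nu theta, circle nu -> star_hom theta ->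
  theta alpha = alpha -> theta gamma = nu *: gamma ->
  forall x, P x -> h (theta x) = h x.

Let hZ := formZ lh.

Let kill (k y : C) : k != 1 -> k * y = y -> y = 0.
Proof.
move=> k1 /eqP; rewrite -subr_eq0 -{2}[y]mul1r -mulrBl mulf_eq0 subr_eq0 (negPf k1).
by move/eqP.
Qed.

Lemma circle_conj_circle (mu : R[i]) : circle mu -> circle ((mu^*)%C).
Proof. by rewrite /circle /= normcJ. Qed.

(** A nontrivial weight forces [h x = 0]. Rotations of [gamma] alone commute with [f], so [f x] has
    the same weight and is killed as well. *)
Let h_weight_gamma x (d : C -> C) : P x -> 
  (forall nu theta, circle nu -> star_hom theta -> theta alpha = 1 *: alpha ->
     theta gamma = nu *: gamma -> theta x = d nu *: x) ->
  (exists2 nu, circle nu & d nu != 1) -> h (f x) = h x.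
Proof.
move=> Px hd [nu hnu dnu].
have c1 : circle (1 : R[i]) by rewrite /circle /= normr1.
have [t [ht ta tg]] := torus_exists hA c1 hnu.
have tx := hd _ _ hnu ht ta tg.
have ta' : t alpha = alpha by rewrite ta scale1r.
have -> : h x = 0 by apply: (kill dnu); rewrite -hZ -tx (h_left hnu ht).
apply: (kill dnu); rewrite -hZ -(linZ lf) -tx.
rewrite (flip_torus ht ht ta tg _ tg) ?conjc1 //.
by rewrite (h_left hnu ht) //; exact: flip_pol.
Qed.

Let h_weight_alpha x (d : C -> C) : P x ->
  (forall mu nu theta, circle mu -> star_hom theta -> theta alpha = mu *: alpha ->
     circle nu -> theta gamma = nu *: gamma -> theta x = d mu *: x) ->
  (exists2 mu, circle mu & d mu != 1) -> h (f x) = h x.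
Proof.
move=> Px hd [mu hmu dmu]; have hmu' := circle_conj_circle hmu.
have [t [ht ta tg]] := torus_exists hA hmu hmu.
(* Invariance of [h] is used for equal phases on both generators. As [f] conjugates the phase of
   [alpha] only, the element to start from is (mu, conj mu), which [f] carries to the diagonal (conj
   mu, conj mu). *)
have [t1 [ht1 t1a t1g]] := torus_exists hA hmu hmu'.
have [t2 [ht2 t2a t2g]] := torus_exists hA hmu' hmu'.
have -> : h x = 0.
  by apply: (kill dmu); rewrite -hZ -(hd _ _ _ hmu ht ta hmu tg) (h_right hmu ht).
apply: (kill dmu); rewrite -hZ -(linZ lf) -(hd _ _ _ hmu ht1 t1a hmu' t1g).
rewrite (flip_torus ht1 ht2 t1a t1g t2a t2g).
by rewrite (h_right hmu' ht2) //; exact: flip_pol.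
Qed.

Lemma pol_apow x n : P x -> P (apow x n).
Proof.
have [_ P1 PM _] := @pol_subalgebra R A alpha gamma.
by move=> Px; elim: n => [//|n ih]; apply: PM.
Qed.

Lemma pol_gmono m n : P (gmono gamma m n).
Proof.
have [_ P1 PM PS] := @pol_subalgebra R A alpha gamma.
by apply: PM; apply: pol_apow; [|apply: PS]; exact: pol_gamma.
Qed.

Let torus_gmono nu theta m n : star_hom theta -> theta gamma = nu *: gamma ->
  theta (gmono gamma m n) = (nu ^+ m * (nu^*)%C ^+ n) *: gmono gamma m n.
Proof.
move=> ht tg; have [_ _ tM tS] := ht.
by rewrite /gmono tM !(hom_apow _ _ ht) tS tg starZ !apowZ amulZ amulZR scalerA.
Qed.

Let opp1 : -1 != 1 :> C.
Proof. by rewrite eq_sym -subr_eq0 opprK -(natrD _ 1 1) pnatr_eq0. Qed.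

Let weight_gamma_root m n : m != n ->
  exists2 nu : C, circle nu & nu ^+ m * (nu^*)%C ^+ n != 1.
Proof.
rewrite neq_ltn => /orP[mn|nm].
  have [l hl lk] := @circle_root_opp1 R (n - m) (etrans (subn_gt0 _ _) mn).
  exists l => //; have -> : n = (m + (n - m))%N by rewrite subnKC // ltnW.
  rewrite exprD mulrA -exprMn [l * _]mulrC circle_conjM // expr1n mul1r.
  have -> : ((l^*)%C) ^+ (n - m) = ((l ^+ (n - m))^*)%C by rewrite rmorphXn.
  by rewrite lk rmorphN rmorph1 opp1.
have [l hl lk] := @circle_root_opp1 R (m - n) (etrans (subn_gt0 _ _) nm).
exists l => //; have -> : m = ((m - n) + n)%N by rewrite subnK // ltnW.
by rewrite exprD -mulrA -exprMn [l * _]mulrC circle_conjM // expr1n mulr1 lk opp1.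
Qed.

Let weight_gamma X m n : P X -> m != n ->
  (forall theta, star_hom theta -> theta alpha = 1 *: alpha -> theta X = X) ->
  h (f (X ** gmono gamma m n)) = h (X ** gmono gamma m n).
Proof.
move=> PX mn tX; have [_ _ PM _] := @pol_subalgebra R A alpha gamma.
apply: (@h_weight_gamma _ (fun nu => nu ^+ m * (nu^*)%C ^+ n)).
- by apply: PM => //; exact: pol_gmono.
- move=> nu t hnu ht ta tg; have [_ _ tM _] := ht.
  by rewrite tM (torus_gmono _ _ ht tg) tX // amulZR.
- exact: weight_gamma_root.
Qed.

Let gmono_diag_torus nu theta m : circle nu -> star_hom theta -> theta gamma = nu *: gamma ->
  theta (gmono gamma m m) = gmono gamma m m.
Proof.
move=> hnu ht tg; rewrite (torus_gmono _ _ ht tg) -exprMn [nu * _]mulrC circle_conjM //.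
by rewrite expr1n scale1r.
Qed.

Lemma flip_haar_pol x : P x -> h (f x) = h x.
Proof.
have [_ P1 PM PS] := @pol_subalgebra R A alpha gamma.
have Pa := @pol_alpha R A alpha gamma.
move/(pol_monomials q0 (proj1 hA)); move: x; apply: lin_span_ind.
  split; first by rewrite /= (lin0 lf).
  by move=> k x y /= hx hy; rewrite lf !lh hx hy.
move=> x [k [m [n hx]]] /=.
have [mn|mn] := eqVneq m n; last first.
  case: hx => ->; apply: weight_gamma => //; try by apply: pol_apow => //; exact: PS.
    by move=> t ht ta; rewrite (hom_apow _ _ ht) ta scale1r.
  by move=> t ht ta; have [_ _ _ tS] := ht; rewrite (hom_apow _ _ ht) tS ta scale1r.
rewrite -{}mn in hx.
case: k hx => [|k] hx.
  have {hx} -> : x = gmono gamma m m by case: hx => ->; rewrite amul1l.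
  have [_ _ _ r4] := proj1 hA.
  rewrite /gmono fM !(antihom_apow _ _ f1 fM) fS fg starZ cr !apowZ amulZ amulZR scalerA -exprMn cc.
  by rewrite expr1n scale1r (apow_comm1 _ _ (esym r4)).
have [l hl lk] := @circle_root_opp1 R k.+1 isT.
case: hx => ->.
  apply: (@h_weight_alpha _ (fun mu => mu ^+ k.+1)).
  - by apply: PM; [exact: pol_apow|exact: pol_gmono].
  - move=> mu nu t hmu ht ta hnu tg; have [_ _ tM _] := ht.
    by rewrite tM (hom_apow _ _ ht) ta apowZ amulZ (gmono_diag_torus _ hnu ht tg).
  - by exists l => //; rewrite lk opp1.
apply: (@h_weight_alpha _ (fun mu => (mu^*)%C ^+ k.+1)).
- by apply: PM; [apply: pol_apow; exact: PS|exact: pol_gmono].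
- move=> mu nu t hmu ht ta hnu tg; have [_ _ tM tS] := ht.
  by rewrite tM (hom_apow _ _ ht) tS ta starZ apowZ amulZ (gmono_diag_torus _ hnu ht tg).
- exists l => //.
  have -> : ((l^*)%C) ^+ k.+1 = ((l ^+ k.+1)^*)%C by rewrite rmorphXn.
  by rewrite lk rmorphN rmorph1 opp1.
Qed.

End FlipInvariance.

(** * Hilbert spaces *)

Section Hilbert.
Context {R : realType}.
Local Notation C := (R[i] : numFieldType).
Implicit Types H : hilbertType R.

Lemma innerD H (u v w : H) : inner (u + v) w = inner u w + inner v w.
Proof. by have := innerDl 1 u v w; rewrite scale1r mul1r. Qed.
Lemma inner0 H (w : H) : inner 0 w = 0.
Proof. by have := innerD 0 0 w; rewrite addr0 => /eqP; rewrite -subr_eq subrr eq_sym => /eqP. Qed.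
Lemma innerZ H c (u w : H) : inner (c *: u) w = c * inner u w.
Proof. by have := innerDl c u 0 w; rewrite addr0 inner0 addr0. Qed.
Lemma innerN H (u w : H) : inner (- u) w = - inner u w.
Proof. by rewrite -scaleN1r innerZ mulN1r. Qed.
Lemma innerB H (u v w : H) : inner (u - v) w = inner u w - inner v w.
Proof. by rewrite innerD innerN. Qed.
Lemma innerDR H (u v w : H) : inner w (u + v) = inner w u + inner w v.
Proof. by rewrite inner_conj innerD rmorphD /= -!inner_conj. Qed.
Lemma innerZR H c (u w : H) : inner w (c *: u) = (c^*)%C * inner w u.
Proof. by rewrite inner_conj innerZ rmorphM /= -inner_conj. Qed.
Lemma innerR0 H (w : H) : inner w 0 = 0.
Proof. by rewrite inner_conj inner0 conjc0. Qed.
Lemma innerNR H (u w : H) : inner w (- u) = - inner w u.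
Proof. by rewrite inner_conj innerN rmorphN /= -inner_conj. Qed.
Lemma innerBR H (u v w : H) : inner w (u - v) = inner w u - inner w v.
Proof. by rewrite innerDR innerNR. Qed.

Lemma inner_nr H (u : H) : inner u u = (nr u ^+ 2)%:C.
Proof. by rewrite inner_norm nrE rmorphXn. Qed.

Lemma dstE_hilb H (x y : H) : dst x y = nr (x - y).
Proof. by []. Qed.

Lemma nr_sqrC (c : C) : ((nr c) ^+ 2)%:C = c * (c^*)%C.
Proof. by rewrite rmorphXn /= -nrE sqr_normc. Qed.

Lemma nr_expand H (u v : H) (t : C) :
  nr (u + t *: v) ^+ 2 = nr u ^+ 2 + 2 * complex.Re ((t^*)%C * inner u v) + nr t ^+ 2 * nr v ^+ 2.
Proof.
apply: complexI; rewrite -inner_nr innerD !innerDR !innerZ !innerZR inner_nr.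
rewrite [inner v u]inner_conj inner_nr.
move: (inner u v) (nr u) (nr v) => c a b.
have -> : t * ((t^*)%C * (b ^+ 2)%:C) = (nr t ^+ 2 * b ^+ 2)%:C.
  by rewrite mulrA -nr_sqrC -rmorphM.
rewrite [in RHS]rmorphD [in RHS]rmorphD /=.
have -> : (2 * complex.Re ((t^*)%C * c))%:C = t^*%C * c + t * c^*%C.
  by rewrite rmorphM rmorphMn -addcJ rmorphM /= conjcK.
by rewrite !addrA.
Qed.

Lemma nr_expandB H (u v : H) :
  nr (u - v) ^+ 2 = nr u ^+ 2 - 2 * complex.Re (inner u v) + nr v ^+ 2.
Proof.
rewrite -scaleN1r nr_expand nrN.
have -> : nr (1 : C) = 1 by rewrite /nr normr1.
by rewrite rmorphN rmorph1 mulN1r raddfN /= mulrN expr1n mul1r.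
Qed.

Lemma nr_expandD H (u v : H) :
  nr (u + v) ^+ 2 = nr u ^+ 2 + 2 * complex.Re (inner u v) + nr v ^+ 2.
Proof.
by rewrite -{1}[v]opprK nr_expandB nrN innerNR raddfN /= mulrN opprK.
Qed.

Lemma cauchy_schwarz H (u v : H) : nr (inner u v) <= nr u * nr v.
Proof.
have [v0|v0] := eqVneq (nr v) 0.
  by rewrite (nr_eq0 v0) innerR0 !nr0 mulr0.
have v0' : 0 < nr v by rewrite lt_def v0 nr_ge0.
rewrite -(@ler_pXn2r _ 2) ?nnegrE ?mulr_ge0 ?nr_ge0 // exprMn.
(* The scalar [- (s%:C * c)] minimises the norm of [u + t *: v] over all [t]. *)
pose s := (nr v ^+ 2)^-1; pose c := inner u v.
have := nr_expand u v (- (s%:C * c)).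
have s0 : 0 <= s by rewrite invr_ge0 sqr_ge0.
have -> : complex.Re ((- (s%:C * c))^*%C * inner u v) = - (s * nr c ^+ 2).
  have -> : ((- (s%:C * c))^*)%C = - (s%:C * (c^*)%C) by rewrite rmorphN rmorphM -[in RHS](conjc_real s).
  rewrite mulNr -mulrA [_ * inner u v]mulrC -nr_sqrC -rmorphM.
  by rewrite -rmorphN.
rewrite nrN nrM nr_real ger0_norm // => h.
have h1 := sqr_ge0 (nr (u + - (s%:C * c) *: v)); rewrite h in h1.
have h2 : s * nr v ^+ 2 = 1 by rewrite mulVf // expf_neq0.
clearbody s.
rewrite -/c; have := sqr_ge0 (nr v); move: (nr v ^+ 2) (nr u ^+ 2) h1 h2 => V U.
rewrite exprMn; move: (nr c ^+ 2) => K h1 h2 V0.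
have h3 : (s ^+ 2 * K) * V = s * K.
  transitivity (s * K * (s * V)); last by rewrite h2 mulr1.
  ring.
have h4 : 0 <= U - s * K by move: h1; rewrite h3; lra.
have := mulr_ge0 h4 V0; rewrite mulrBl mulrAC h2 mul1r; lra.
Qed.

Lemma Re_le_CS H (u v : H) : complex.Re (inner u v) <= nr u * nr v.
Proof.
apply: le_trans (cauchy_schwarz u v); apply: le_trans (le_nr_Re _); exact: ler_norm.
Qed.

Lemma parallelogram H (u v : H) :
  nr (u + v) ^+ 2 + nr (u - v) ^+ 2 = 2 * nr u ^+ 2 + 2 * nr v ^+ 2.
Proof. by rewrite nr_expandD nr_expandB; ring. Qed.

Lemma inner_ext H (u v : H) : (forall w, inner w u = inner w v) -> u = v.
Proof.
move=> h; apply/eqP; rewrite -subr_eq0; apply/eqP; apply: nr_eq0; apply/eqP.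
rewrite -sqrf_eq0; apply/eqP/complexI; rewrite -inner_nr innerBR h subrr //.
Qed.

End Hilbert.

(** * Riesz representation of bounded functionals *)

Section Riesz.
Context {R : realType} (H : hilbertType R).
Local Notation C := (R[i] : numFieldType).
Variables (f : H -> R[i]) (K : R).
Hypothesis lf : scalar f.
Hypothesis bf : forall u, nr (f u) <= K * nr u.

(** If [f] is the inner product with [w], this is |u - w|^2 - |w|^2, so its minimiser is the
    representing vector. *)
Definition riesz_energy (u : H) : R := nr u ^+ 2 - 2 * complex.Re (f u).
Local Notation Phi := riesz_energy.

Let f_add := formD lf.
Let fZ := formZ lf.

Let Re_f u : complex.Re (f u) <= K * nr u.
Proof. by apply: le_trans (bf u); apply: le_trans (le_nr_Re _); exact: ler_norm. Qed.

Let ReM (t : R) (c : R[i]) : complex.Re (t%:C * c) = t * complex.Re c.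
Proof. by case: c => a b; rewrite /= mul0r subr0. Qed.

Let Phi_ge u : - K ^+ 2 <= Phi u.
Proof.
rewrite /riesz_energy; have := Re_f u; have := sqr_ge0 (nr u - K); rewrite sqrrB mulr2n.
move: (nr u) (complex.Re _) => a b; nra.
Qed.

Let I := inf (range Phi).

Let has_infPhi : has_inf (range Phi).
Proof.
split; first by exists (Phi 0), 0.
by exists (- K ^+ 2) => _ [u _ <-].
Qed.

Let I_le u : I <= Phi u.
Proof. by apply: ge_inf; [case: has_infPhi|exists u]. Qed.

Let near_inf (e : R) : 0 < e -> exists u, Phi u < I + e.
Proof. by move=> e0; have [_ [u _ <-] h] := inf_adherent e0 has_infPhi; exists u. Qed.

Let Phi_parallelogram u v :
  dst u v ^+ 2 = 2 * Phi u + 2 * Phi v - 4 * Phi ((2^-1 : C) *: (u + v)).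
Proof.
have h := parallelogram u v; rewrite dstE_hilb /riesz_energy nr_half fZ f_add.
rewrite -[X in complex.Re (X * _)](_ : (2^-1)%:C = _); last by rewrite fmorphV /= rmorphMn.
rewrite ReM raddfD /= exprMn; lra.
Qed.

Let Phi_line u v (t : R) :
  Phi (u + t%:C *: v) = Phi u + 2 * t * (complex.Re (inner u v) - complex.Re (f v)) + t ^+ 2 * nr v ^+ 2.
Proof.
rewrite /riesz_energy nr_expand conjc_real f_add fZ raddfD /= !ReM nr_real real_normK ?num_real //; ring.
Qed.

(* A minimizing sequence of the energy is Cauchy by the parallelogram law; the
   first-order condition at its limit is the representation of [f]. *)
Lemma riesz : exists w, forall u, f u = inner u w.
Proof.
have half_gt0 n : 0 < (2^-1 : R) ^+ n by rewrite exprn_gt0 // invr_gt0.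
have /choice[u uI] : forall n, exists u, Phi u < I + (2^-1 : R) ^+ n.
  by move=> n; apply: near_inf.
have [w uw] : exists w, lims u w.
  apply: cauchy_lims => e e0.
  have e2 : 0 < e ^+ 2 / 4 by rewrite divr_gt0 // exprn_gt0.
  have [N hN] := expr_half_lt e2; exists N => m n Nm Nn.
  rewrite -(@ltr_pXn2r _ 2) ?nnegrE ?dst_ge0 ?ltW // Phi_parallelogram.
  have := I_le ((2^-1 : C) *: (u m + u n)); have := uI m; have := uI n.
  have := hN _ Nm; have := hN _ Nn; lra.
have Re_eq v : complex.Re (f v) = complex.Re (inner v w).
  pose d := complex.Re (inner w v) - complex.Re (f v).
  have hd t : 0 <= 2 * t * d + t ^+ 2 * nr v ^+ 2.
    rewrite -oppr_le0; apply: le_eps => e e0; rewrite add0r.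
    have k0 : 0 < 2 * `|t| * nr v + 1.
      by rewrite ltr_wpDl // !mulr_ge0 // nr_ge0.
    have e1 : 0 < e / 2 / (2 * `|t| * nr v + 1) by rewrite divr_gt0 //; lra.
    have e2 : 0 < e / 2 by lra.
    have [N hN] := uw _ e1; have [N' hN'] := expr_half_lt e2.
    have {}hN := hN (maxn N N') (leq_maxl _ _).
    have {}hN' := hN' (maxn N N') (leq_maxr _ _).
    have := I_le (u (maxn N N') + t%:C *: v); rewrite Phi_line.
    have := uI (maxn N N'); move: (maxn N N') hN hN' => n hN hN'.
    have hc : `|complex.Re (inner (u n) v) - complex.Re (inner w v)| <= dst (u n) w * nr v.
      rewrite -raddfB /= -innerB; apply: (le_trans (le_nr_Re _)).
      exact: cauchy_schwarz.
    have : `|2 * t * (complex.Re (inner (u n) v) - complex.Re (inner w v))| <= e / 2.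
      rewrite normrM normrM ger0_norm //.
      apply: (@le_trans _ _ (2 * `|t| * (dst (u n) w * nr v))).
        by rewrite ler_wpM2l // mulr_ge0.
      rewrite ltr_pdivlMr // in hN.
      have := dst_ge0 (u n) w; have := nr_ge0 v; have := normr_ge0 t.
      move: (dst (u n) w) (nr v) `|t| hN => a b c *; lra.
    rewrite ler_norml => /andP[h1 h2]; rewrite /d.
    move: (complex.Re _) (complex.Re (f v)) h1 h2 => *; lra.
  have d0 : d = 0.
    have V0 := sqr_ge0 (nr v); have V1 : 0 < nr v ^+ 2 + 1 by lra.
    (* The optimal [t] would be [- d / nr v ^+ 2]; the added 1 avoids dividing by zero and still
       makes the expression negative unless [d = 0]. *)
    have := hd (- d / (nr v ^+ 2 + 1)).
    have -> : 2 * (- d / (nr v ^+ 2 + 1)) * d + (- d / (nr v ^+ 2 + 1)) ^+ 2 * nr v ^+ 2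
        = - (d ^+ 2 * (nr v ^+ 2 + 2)) / (nr v ^+ 2 + 1) ^+ 2.
      by field; rewrite gt_eqF.
    rewrite mulNr oppr_ge0 pmulr_lle0 ?invr_gt0 ?exprn_gt0 // pmulr_lle0; last lra.
    by move=> h; apply/eqP; rewrite -sqrf_eq0 eq_le h sqr_ge0.
  have : complex.Re (inner w v) = complex.Re (f v) by apply/eqP; rewrite -subr_eq0 -/d d0.
  by rewrite inner_conj; case: (inner v w).
(* The real parts at i v supply the imaginary parts at [v]. *)
exists w => v; have := Re_eq v; have := Re_eq (('i%C : C) *: v).
rewrite fZ innerZ (mulrC _ (f v)) (mulrC _ (inner v w)) !ReiNIm => /oppr_inj hI hR.
by apply/eqP; rewrite eq_complex hI hR !eqxx.
Qed.

End Riesz.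

(** * Adjoints and generated von Neumann algebras *)

Section Adjoints.
Context {R : realType} (H : hilbertType R).
Local Notation C := (R[i] : numFieldType).
Implicit Types x y : H -> H.

Lemma bounded_opP x : bounded_op x <->
  linear x /\ exists2 K : R, 0 <= K & forall v, nr (x v) <= K * nr v.
Proof.
split=> -[lx]; last first.
  by case=> K _ h; split => //; exists K => v; rewrite !nrE -rmorphM /= lecR.
case=> K h; split => //; exists `|K| => // v.
have := h v; rewrite !nrE -rmorphM /= lecR => /le_trans; apply.
by rewrite ler_wpM2r ?nr_ge0 ?ler_norm.
Qed.

Lemma adjoint_exists x : bounded_op x -> exists2 y, bounded_op y & adjoint x y.
Proof.
move=> /bounded_opP[lx [K K0 bx]].
have /choice[y hy] : forall v, exists w, forall u, inner (x u) v = inner u w.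
  move=> v; apply: (riesz (K := K * nr v)).
    by move=> c u u'; rewrite lx innerD innerZ.
  move=> u; apply: (le_trans (cauchy_schwarz _ _)).
  by rewrite mulrAC ler_wpM2r ?nr_ge0.
exists y; last by move=> u v; exact: hy.
apply/bounded_opP; split.
  move=> c u v; apply: inner_ext => w.
  by rewrite innerDR innerZR -!hy innerDR innerZR.
exists K => // v; have [->|y0] := eqVneq (nr (y v)) 0; first by rewrite mulr_ge0 // nr_ge0.
have {}y0 : 0 < nr (y v) by rewrite lt_def y0 nr_ge0.
rewrite -(ler_pM2r y0) -expr2.
have -> : nr (y v) ^+ 2 = complex.Re (inner (y v) (y v)) by rewrite inner_nr.
rewrite -hy; apply: (le_trans (Re_le_CS _ _)).
by rewrite mulrAC ler_wpM2r ?nr_ge0.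
Qed.

Lemma adjoint_sym x y : adjoint x y -> adjoint y x.
Proof. by move=> h u v; rewrite inner_conj -h -inner_conj. Qed.

Lemma adjoint_unique x y y' : adjoint x y -> adjoint x y' -> y = y'.
Proof.
by move=> h h'; apply/funext => v; apply: inner_ext => w; rewrite -h h'.
Qed.

(** Total on functions; the default [x] is never taken when [x] is bounded. *)
Definition adj x : H -> H := xget x [set y | bounded_op y /\ adjoint x y].

Lemma adjP x : bounded_op x -> bounded_op (adj x) /\ adjoint x (adj x).
Proof.
by move=> /adjoint_exists[y by_ xy]; rewrite /adj; case: xgetP => [y' _ //|/(_ y)[]].
Qed.

Lemma adjE x y : adjoint x y -> bounded_op x -> adj x = y.
Proof. by move=> xy /adjP[_ h]; exact: adjoint_unique h xy. Qed.

Lemma bounded_op_lin (c : C) x y : bounded_op x -> bounded_op y -> bounded_op (c *: x + y).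
Proof.
move=> /bounded_opP[lx [K K0 bx]] /bounded_opP[ly [K' K'0 b_y]]; apply/bounded_opP; split.
  move=> k u v; rewrite /= !fctE lx ly !scalerDr !scalerA [c * k]mulrC.
  by rewrite addrACA.
exists (nr c * K + K'); first by rewrite addr_ge0 // mulr_ge0 // nr_ge0.
move=> v; rewrite !fctE; apply: (le_trans (nrD _ _)); rewrite nrZ mulrDl; apply: lerD; last exact: b_y.
by rewrite -mulrA; apply: ler_wpM2l; [exact: nr_ge0|exact: bx].
Qed.

Lemma bounded_op0 : bounded_op (0 : H -> H).
Proof.
apply/bounded_opP; have E v : (0 : H -> H) v = 0 by [].
split; first by move=> c u v; rewrite !E scaler0 addr0.
by exists 0 => // v; rewrite E nr0 mul0r.
Qed.

Lemma bounded_op_id : bounded_op (@id H).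
Proof. by apply/bounded_opP; split => //; exists 1 => // v; rewrite mul1r. Qed.

Lemma bounded_op_comp x y : bounded_op x -> bounded_op y -> bounded_op (x \o y).
Proof.
move=> /bounded_opP[lx [K K0 bx]] /bounded_opP[ly [K' K'0 b_y]]; apply/bounded_opP; split.
  by move=> k u v /=; rewrite ly lx.
exists (K * K'); first by rewrite mulr_ge0.
by move=> v /=; apply: (le_trans (bx _)); rewrite -mulrA ler_wpM2l.
Qed.

Lemma von_neumann_bounded : is_von_neumann (@bounded_op R H).
Proof.
split=> //.
- split; last exact: bounded_op_id.
  by split; [exact: bounded_op0|exact: bounded_op_lin].
- exact: bounded_op_comp.
- exact: adjoint_exists.
Qed.

Section Generated.
Variable X : set (H -> H).
Hypothesis Xb : X `<=` @bounded_op R H.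
Local Notation M := (von_neumann_gen X).

Lemma gen_sub : X `<=` M.
Proof. by move=> x Xx N [_]; apply. Qed.

Lemma gen_min N : is_von_neumann N -> X `<=` N -> M `<=` N.
Proof. by move=> hN XN x; apply. Qed.

Lemma von_neumann_genP : is_von_neumann M.
Proof.
have MB : M `<=` @bounded_op R H by apply: gen_min => //; exact: von_neumann_bounded.
split=> //.
- split; last by move=> N [[_ [_ ?]]].
  split; first by move=> N [[_ [[? _] _]]].
  move=> c x y Mx My N hN; case: (hN) => -[_ [[_ h] _] _ _ _] _.
  by apply: h; [exact: Mx|exact: My].
- move=> x y Mx My N hN; case: (hN) => -[_ _ h _ _] _.
  by apply: h; [exact: Mx|exact: My].
(* Each algebra of the family provides an adjoint of its own; uniqueness identifies them all with
   [adj x]. *)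
- move=> x Mx; have [ab xa] := adjP (MB _ Mx); exists (adj x) => // N hN.
  case: (hN) => -[_ _ _ h _] _; have [y Ny xy] := h _ (Mx _ hN).
  by rewrite (adjoint_unique xa xy).
- move=> x bx hx N hN; case: (hN) => -[_ _ _ _ h] _; apply: h => // U xU.
  by have [y [Uy My]] := hx _ xU; exists y; split => //; exact: My.
Qed.
End Generated.

End Adjoints.

(** * The weak-* topology *)

Section ComplexSeries.
Context {R : realType}.
Local Notation C := (R[i] : numFieldType).

Lemma real_cauchy (u : nat -> R) :
  (forall e : R, 0 < e -> exists N, forall m n, (N <= m)%N -> (N <= n)%N ->
     `|u m - u n| < e) ->
  exists l, forall e : R, 0 < e -> exists N, forall n, (N <= n)%N -> `|u n - l| < e.
Proof.
move=> h; have : cvg (u @ \oo).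
  apply/cauchy_cvgP/cauchy_exP => e e0; have [N hN] := h e e0.
  exists (u N); exists N => // n /= Nn; rewrite -ball_normE /ball_ /=.
  exact: hN.
move=> /cvg_ex[l /cvgrPdist_lt ul]; exists l => e /ul[N _ hN].
by exists N => n /hN /=; rewrite distrC.
Qed.

Lemma complex_cauchy (u : nat -> C) :
  (forall e : R, 0 < e -> exists N, forall m n, (N <= m)%N -> (N <= n)%N ->
     dst (u m) (u n) < e) -> exists l, lims u l.
Proof.
move=> h.
have [a ha] : exists l, forall e : R, 0 < e ->
    exists N, forall n, (N <= n)%N -> `|complex.Re (u n) - l| < e.
  apply: real_cauchy => e /h[N hN]; exists N => m n Nm Nn.
  by rewrite -raddfB /=; apply: (le_lt_trans (le_nr_Re _)); exact: hN.
have [b hb] : exists l, forall e : R, 0 < e ->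
    exists N, forall n, (N <= n)%N -> `|complex.Im (u n) - l| < e.
  apply: real_cauchy => e /h[N hN]; exists N => m n Nm Nn.
  by rewrite -raddfB /=; apply: (le_lt_trans (le_nr_Im _)); exact: hN.
exists (a +i* b) => e e0; have e2 : 0 < e / 2 by lra.
have [N hN] := ha _ e2; have [N' hN'] := hb _ e2.
exists (maxn N N') => n; rewrite geq_max => /andP[/hN h1 /hN' h2].
apply: (le_lt_trans (nr_le_ReIm _)); rewrite !raddfB /=; lra.
Qed.

Lemma lims_uniqueC (u : nat -> C) l l' : lims u l -> lims u l' -> l = l'.
Proof.
move=> h h'; apply: dst_eps => e e0.
have e2 : 0 < e / 2 by lra.
have [N hN] := h _ e2; have [N' hN'] := h' _ e2.
have := hN (maxn N N') (leq_maxl _ _); have := hN' (maxn N N') (leq_maxr _ _).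
move=> h1 h2; apply: (le_trans (dst_tri (u (maxn N N')) _ _)).
rewrite (dstC l); lra.
Qed.

Lemma limsD (u v : nat -> C) l l' : lims u l -> lims v l' -> lims (u \+ v) (l + l').
Proof.
move=> h h' e e0; have e2 : 0 < e / 2 by lra.
have [N hN] := h _ e2; have [N' hN'] := h' _ e2.
exists (maxn N N') => n; rewrite geq_max => /andP[/hN h1 /hN' h2].
rewrite /dst opprD addrACA; apply: (le_lt_trans (nrD _ _)).
rewrite /dst in h1 h2; lra.
Qed.

Lemma limsZ (c : C) (u : nat -> C) l : lims u l -> lims (fun n => c * u n) (c * l).
Proof.
move=> h e e0; have c0 : 0 < nr c + 1 by have := nr_ge0 c; lra.
have e1 : 0 < e / (nr c + 1) by rewrite divr_gt0.
have [N hN] := h _ e1; exists N => n /hN.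
rewrite /dst -mulrBr nrM ltr_pdivlMr // => h1.
have := nr_ge0 c; have := nr_ge0 (u n - l); nra.
Qed.

Lemma lims_conj (u : nat -> C) l : lims u l -> lims (fun n => ((u n)^*)%C) ((l^*)%C).
Proof.
move=> h e /h[N hN]; exists N => n /hN.
by rewrite /dst -nr_conj rmorphB.
Qed.

Lemma lims_limn (u : nat -> C) l : lims u l -> limn u = l.
Proof. by move/lims_cvg => h; apply: cvg_lim => //; exact: norm_hausdorff. Qed.

Lemma seriesB (V : zmodType) (u : nat -> V) m n : (n <= m)%N ->
  series u m - series u n = \sum_(n <= k < m) u k.
Proof. by move=> nm; rewrite /series /= (big_cat_nat (leq0n n) nm) /= [X in X - _]addrC addrK. Qed.

Lemma nr_sum_le (t : nat -> C) (b : nat -> R) m n : (forall k, nr (t k) <= b k) ->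
  nr (\sum_(n <= k < m) t k) <= \sum_(n <= k < m) b k.
Proof.
move=> h; elim/big_ind2 : _ => //; first by rewrite nr0.
move=> x a y c xa yc; apply: (le_trans (nrD _ _)); exact: lerD.
Qed.

End ComplexSeries.

Section WeakStar.
Context {R : realType} (H : hilbertType R).
Local Notation C := (R[i] : numFieldType).
Implicit Types (x y : H -> H) (xi eta : nat -> H).

Lemma square_summableP xi : square_summable xi ->
  forall e : R, 0 < e -> exists N, forall m n, (N <= n)%N -> (n <= m)%N ->
    \sum_(n <= k < m) nr (xi k) ^+ 2 < e.
Proof.
move=> /cvg_ex[l /lims_cvg h] e e0; have e2 : 0 < e / 2 by lra.
have [N hN] := h _ e2; exists N => m n Nn nm.
have := hN n Nn; have := hN m (leq_trans Nn nm) => h1 h2.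
have : dst (series (fun n => `|xi n| ^+ 2) m) (series (fun n => `|xi n| ^+ 2) n) < e.
  by apply: (le_lt_trans (dst_tri l _ _)); rewrite (dstC l); lra.
rewrite /dst seriesB // (eq_bigr (fun k => (nr (xi k) ^+ 2)%:C)); last first.
  by move=> k _; rewrite nrE rmorphXn.
rewrite -rmorph_sum /= nr_real ger0_norm //.
by apply: sumr_ge0 => k _; exact: sqr_ge0.
Qed.

Lemma square_summable_bound xi eta (K : R) : 0 <= K ->
  (forall n, nr (eta n) <= K * nr (xi n)) -> square_summable xi -> square_summable eta.
Proof.
move=> K0 h /square_summableP hx.
suff [l hl] : exists l, lims (series (fun n => `|eta n| ^+ 2)) l.
  by apply/cvg_ex; exists l; apply/lims_cvg.
apply: complex_cauchy => e e0.
have k0 : 0 < K ^+ 2 + 1 by have := sqr_ge0 K; lra.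
have e1 : 0 < e / (K ^+ 2 + 1) by rewrite divr_gt0.
have [N hN] := hx _ e1; exists N.
suff le_case m n : (N <= n)%N -> (n <= m)%N ->
    dst (series (fun n => `|eta n| ^+ 2) m) (series (fun n => `|eta n| ^+ 2) n) < e.
  move=> m n Nm Nn; case: (leqP n m) => [|/ltnW] nm; first exact: le_case.
  by rewrite dstC; exact: le_case.
move=> Nn nm; rewrite /dst seriesB //.
apply: (@le_lt_trans _ _ (\sum_(n <= k < m) (K ^+ 2 * nr (xi k) ^+ 2))).
  apply: nr_sum_le => k; rewrite nrE -rmorphXn /= nr_real ger0_norm ?sqr_ge0 //.
  by rewrite -exprMn ler_pXn2r ?nnegrE ?nr_ge0 // mulr_ge0 // nr_ge0.
rewrite -mulr_sumr; have := hN m n Nn nm; rewrite ltr_pdivlMr //.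
have : 0 <= \sum_(n <= k < m) nr (xi k) ^+ 2 by apply: sumr_ge0 => k _; exact: sqr_ge0.
move: (\sum_(_ <= _ < _) _) => s s0; have := sqr_ge0 K; nra.
Qed.

(** [limn] of a divergent series carries no information, so convergence is secured first: by
    Cauchy-Schwarz and ab <= a^2 + b^2 the tails are dominated by those of the two square sums. *)
Lemma weakstar_lims xi eta x : bounded_op x -> square_summable xi -> square_summable eta ->
  lims (series (fun n => inner (x (xi n)) (eta n))) (weakstar_functional xi eta x).
Proof.
move=> /bounded_opP[_ [K K0 bx]] /square_summableP hxi /square_summableP heta.
suff [l hl] : exists l, lims (series (fun n => inner (x (xi n)) (eta n))) l.
  by rewrite /weakstar_functional (lims_limn hl).
apply: complex_cauchy => e e0.
have e1 : 0 < e / 2 / (K + 1) by rewrite divr_gt0 //; lra.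
have [N hN] := hxi _ e1; have [N' hN'] := heta _ e1.
exists (maxn N N').
suff le_case m n : (maxn N N' <= n)%N -> (n <= m)%N ->
    dst (series (fun n => inner (x (xi n)) (eta n)) m) (series (fun n => inner (x (xi n)) (eta n)) n) < e.
  move=> m n Nm Nn; case: (leqP n m) => [|/ltnW] nm; first exact: le_case.
  by rewrite dstC; exact: le_case.
rewrite geq_max => /andP[Nn N'n] nm; rewrite /dst seriesB //.
apply: (@le_lt_trans _ _ (\sum_(n <= k < m) (K * (nr (xi k) ^+ 2 + nr (eta k) ^+ 2)))).
  apply: nr_sum_le => k; apply: (le_trans (cauchy_schwarz _ _)).
  apply: (@le_trans _ _ (K * nr (xi k) * nr (eta k))); first by rewrite ler_wpM2r ?nr_ge0.
  rewrite -mulrA ler_wpM2l //; have := sqr_ge0 (nr (xi k) - nr (eta k)); rewrite sqrrB mulr2n.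
  have := nr_ge0 (xi k); have := nr_ge0 (eta k); nra.
rewrite -mulr_sumr big_split /=; have := hN m n Nn nm; have := hN' m n N'n nm.
rewrite !ltr_pdivlMr; [|lra..].
have : 0 <= \sum_(n <= k < m) nr (xi k) ^+ 2 by apply: sumr_ge0 => k _; exact: sqr_ge0.
have : 0 <= \sum_(n <= k < m) nr (eta k) ^+ 2 by apply: sumr_ge0 => k _; exact: sqr_ge0.
move: (\sum_(_ <= _ < _) _) (\sum_(_ <= _ < _) _) => s s'; nra.
Qed.

Lemma weakstar_eq xi eta xi' eta' x y :
  (forall n, inner (x (xi n)) (eta n) = inner (y (xi' n)) (eta' n)) ->
  weakstar_functional xi eta x = weakstar_functional xi' eta' y.
Proof. by move=> h; rewrite /weakstar_functional; congr (limn (series _)); apply/funext. Qed.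

Lemma weakstar_lin xi eta (c : C) x y : bounded_op x -> bounded_op y ->
  square_summable xi -> square_summable eta ->
  weakstar_functional xi eta (c *: x + y)
  = c * weakstar_functional xi eta x + weakstar_functional xi eta y.
Proof.
move=> bx b_y hxi heta.
have h := limsD (limsZ c (weakstar_lims bx hxi heta)) (weakstar_lims b_y hxi heta).
apply: (lims_uniqueC (weakstar_lims (bounded_op_lin c bx b_y) hxi heta)).
move=> e /h[N hN]; exists N => n /hN; rewrite /series /=.
rewrite mulr_sumr -big_split /=; congr (dst _ _ < _).
by apply: eq_bigr => k _; rewrite !fctE innerD innerZ.
Qed.

Lemma bounded_opB x y : bounded_op x -> bounded_op y -> bounded_op (x - y).
Proof. by move=> bx b_y; have := bounded_op_lin (-1) b_y bx; rewrite scaleN1r addrC. Qed.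

Lemma weakstar_adj xi eta x y : bounded_op x -> adjoint x y ->
  square_summable xi -> square_summable eta ->
  weakstar_functional xi eta y = ((weakstar_functional eta xi x)^*)%C.
Proof.
move=> bx xy hxi heta.
have b_y : bounded_op y by rewrite -(adjE xy bx); case: (adjP bx).
apply: (lims_uniqueC (weakstar_lims b_y hxi heta)) => e.
move=> /(lims_conj (weakstar_lims bx heta hxi))[N hN]; exists N => n /hN.
rewrite /series /= rmorph_sum /=; congr (dst _ _ < _).
by apply: eq_bigr => k _; rewrite (adjoint_sym xy) [RHS]inner_conj.
Qed.

Lemma weakstar_nbhsS x (U V : set (H -> H)) : U `<=` V -> weakstar_nbhs x U -> weakstar_nbhs x V.
Proof.
move=> UV [n [xi [eta [e [e0 hxi heta hU]]]]]; exists n, xi, eta, e; split => // y b_y hy.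
exact/UV/hU.
Qed.

Lemma weakstar_nbhsI x (U V : set (H -> H)) :
  weakstar_nbhs x U -> weakstar_nbhs x V -> weakstar_nbhs x (U `&` V).
Proof.
move=> [n [xi [eta [e [e0 hxi heta hU]]]]] [m [xi' [eta' [e' [e'0 hxi' heta' hV]]]]].
pose cc (a : 'I_n -> nat -> H) (b : 'I_m -> nat -> H) (k : 'I_(n + m)) :=
  match fintype.split k with inl i => a i | inr j => b j end.
exists (n + m)%N, (cc xi xi'), (cc eta eta'), (Num.min e e'); split.
- by rewrite lt_min e0 e'0.
- by move=> k; rewrite /cc; case: (fintype.split k).
- by move=> k; rewrite /cc; case: (fintype.split k).
move=> y b_y hy; split.
  apply: hU => // i; have := hy (lshift m i).
  rewrite /cc (unsplitK (inl i : 'I_n + 'I_m)%type) => /lt_le_trans; apply.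
  by rewrite lecR ge_min lexx.
apply: hV => // j; have := hy (rshift n j).
rewrite /cc (unsplitK (inr j : 'I_n + 'I_m)%type) => /lt_le_trans; apply.
by rewrite lecR ge_min lexx orbT.
Qed.

Lemma weakstar_basic n (xi eta : 'I_n -> nat -> H) (e : R) x : 0 < e ->
  (forall i, square_summable (xi i)) -> (forall i, square_summable (eta i)) ->
  weakstar_nbhs x [set y | bounded_op y /\
    forall i, nr (weakstar_functional (xi i) (eta i) (y - x)) < e].
Proof.
move=> e0 hxi heta; exists n, xi, eta, e; split => // y b_y hy; split => // i.
by have := hy i; rewrite nrE ltcR.
Qed.

Lemma weakstar_nbhsP x (U : set (H -> H)) : weakstar_nbhs x U <->
  exists n (xi eta : 'I_n -> nat -> H) (e : R),
    [/\ 0 < e, forall i, square_summable (xi i), forall i, square_summable (eta i)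
      & [set y | bounded_op y /\
          forall i, nr (weakstar_functional (xi i) (eta i) (y - x)) < e] `<=` U].
Proof.
split=> -[n [xi [eta [e [e0 hxi heta hU]]]]]; last first.
  by apply: weakstar_nbhsS hU _; exact: weakstar_basic.
exists n, xi, eta, e; split => // y [b_y hy]; apply: hU => // i.
by rewrite nrE ltcR.
Qed.

(** Turns a single matrix coefficient into a weak-* functional. *)
Definition point_seq (u : H) : nat -> H := fun n => if n is 0 then u else 0.

Lemma series_point (t : nat -> C) : (forall n, t n.+1 = 0) -> lims (series t) (t 0%N).
Proof.
move=> h e e0; exists 1%N => -[//|n] _; rewrite /series /= big_nat_recl //.
by rewrite big1 ?addr0 ?dstxx.
Qed.

Lemma square_summable_point u : square_summable (point_seq u).
Proof.
apply/cvg_ex; exists (`|u| ^+ 2); apply/lims_cvg.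
by apply: (@series_point (fun n => `|point_seq u n| ^+ 2)) => n; rewrite /= normr0 expr0n.
Qed.

Lemma weakstar_point u v x : bounded_op x ->
  weakstar_functional (point_seq u) (point_seq v) x = inner (x u) v.
Proof.
move=> bx; apply: lims_limn.
by apply: (@series_point (fun n => inner (x (point_seq u n)) (point_seq v n))) => n; rewrite innerR0.
Qed.

Lemma weakstar_nbhs_point x u v (e : R) : 0 < e -> bounded_op x ->
  weakstar_nbhs x [set y | bounded_op y /\ nr (inner (y u) v - inner (x u) v) < e].
Proof.
move=> e0 bx.
have := @weakstar_basic 1 (fun=> point_seq u) (fun=> point_seq v) e x e0
  (fun=> @square_summable_point u) (fun=> @square_summable_point v).
apply: weakstar_nbhsS => y [b_y hy]; split => //.
by have := hy ord0; rewrite weakstar_point ?fctE ?innerB //; exact: bounded_opB.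
Qed.

Definition weakstar_closure (N : set (H -> H)) : set (H -> H) :=
  [set x | bounded_op x /\ forall U, weakstar_nbhs x U -> U `&` N !=set0].

Lemma weakstar_closure_closed N : weakstar_closed (weakstar_closure N).
Proof.
move=> x bx hx; split => // U /weakstar_nbhsP[n [xi [eta [e [e0 hxi heta hU]]]]].
have e2 : 0 < e / 2 by lra.
have [y [[b_y hy] [_ cy]]] := hx _ (weakstar_basic x e2 hxi heta).
have [z [[bz hz] Nz]] := cy _ (weakstar_basic y e2 hxi heta).
exists z; split => //; apply: hU; split => // i.
have -> : z - x = 1 *: (z - y) + (y - x) by rewrite scale1r addrA subrK.
rewrite weakstar_lin //; try exact: bounded_opB.
by apply: (le_lt_trans (nrD _ _)); rewrite mul1r; have := hy i; have := hz i; lra.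
Qed.

Lemma sub_weakstar_closure N : N `<=` @bounded_op R H -> N `<=` weakstar_closure N.
Proof.
move=> Nb x Nx; split; first exact: Nb.
move=> U /weakstar_nbhsP[n [xi [eta [e [e0 hxi heta hU]]]]]; exists x; split => //.
apply: hU; split; first exact: Nb.
move=> i; have -> : x - x = x - x + (x - x) by rewrite subrr addr0.
have bz := bounded_opB (Nb _ Nx) (Nb _ Nx).
rewrite -[X in X + _]scale1r scale1r subrr addr0.
have := weakstar_lin (-1) (bounded_op0 H) (bounded_op0 H) (hxi i) (heta i).
by rewrite scaler0 addr0 mulN1r addNr => ->; rewrite nr0.
Qed.

Lemma square_summable_bounded x xi : bounded_op x -> square_summable xi ->
  square_summable (x \o xi).
Proof.
by move=> /bounded_opP[_ [K K0 bx]]; apply: (square_summable_bound K0) => n; exact: bx.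
Qed.

Lemma weakstar_closure_von_neumann N : N `<=` @bounded_op R H ->
  is_submodule N -> N id -> (forall x y, N x -> N y -> N (x \o y)) ->
  (forall x, N x -> exists2 y, N y & adjoint x y) ->
  is_von_neumann (weakstar_closure N).
Proof.
move=> Nb [N0 ND] N1 NM NS; have Ncl := sub_weakstar_closure Nb.
split; [by move=> x []|split; [split|]| | |exact: weakstar_closure_closed].
- exact: Ncl.
- move=> c x y [bx hx] [b_y hy]; split; first exact: bounded_op_lin.
  move=> U /weakstar_nbhsP[n [xi [eta [e [e0 hxi heta hU]]]]].
  have c0 : 0 < nr c + 1 by have := nr_ge0 c; lra.
  have e1 : 0 < e / 2 / (nr c + 1) by rewrite divr_gt0 //; lra.
  have e2 : 0 < e / 2 by lra.
  have [x' [[bx' hx'] Nx']] := hx _ (weakstar_basic x e1 hxi heta).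
  have [y' [[by' hy'] Ny']] := hy _ (weakstar_basic y e2 hxi heta).
  exists (c *: x' + y'); split; last exact: ND.
  apply: hU; split => [|i]; first exact: bounded_op_lin.
  have -> : c *: x' + y' - (c *: x + y) = c *: (x' - x) + (y' - y).
    by rewrite opprD addrACA scalerBr.
  rewrite weakstar_lin //; try exact: bounded_opB.
  apply: (le_lt_trans (nrD _ _)); rewrite nrM.
  have := hy' i; have := hx' i; rewrite ltr_pdivlMr //.
  have := nr_ge0 c; have := nr_ge0 (weakstar_functional (xi i) (eta i) (x' - x)); nra.
- exact: Ncl.
- move=> x y [bx hx] [b_y hy]; split; first exact: bounded_op_comp.
  move=> U /weakstar_nbhsP[n [xi [eta [e [e0 hxi heta hU]]]]].
  have e2 : 0 < e / 2 by lra.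
  (* Multiplication is only separately weak-* continuous. So [y'] is chosen first, tested against
     [adj x \o eta i], and [x'] afterwards, tested on the vectors [y' \o xi i], which depend on that
     choice. *)
  have [bax xax] := adjP bx.
  have hax i : square_summable (adj x \o eta i) by exact: square_summable_bounded.
  have [y' [[by' hy'] Ny']] := hy _ (weakstar_basic y e2 hxi hax).
  have hyx i : square_summable (y' \o xi i) by exact: square_summable_bounded.
  have [x' [[bx' hx'] Nx']] := hx _ (weakstar_basic x e2 hyx heta).
  exists (x' \o y'); split; last exact: NM.
  apply: hU; split => [|i]; first exact: bounded_op_comp.
  have -> : (x' \o y') - (x \o y) = 1 *: ((x' - x) \o y') + (x \o (y' - y)).
    apply/funext => v; rewrite scale1r; case/bounded_opP: (bx) => lx _.
    change (x' (y' v) - x (y v) = x' (y' v) - x (y' v) + x (y' v - y v)).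
    by rewrite (linB lx) addrA subrK.
  rewrite weakstar_lin //; try (apply: bounded_op_comp => //); try exact: bounded_opB.
  apply: (le_lt_trans (nrD _ _)); rewrite mul1r.
  have -> : weakstar_functional (xi i) (eta i) ((x' - x) \o y')
    = weakstar_functional (y' \o xi i) (eta i) (x' - x) by apply: weakstar_eq.
  have -> : weakstar_functional (xi i) (eta i) (x \o (y' - y))
    = weakstar_functional (xi i) (adj x \o eta i) (y' - y).
    by apply: weakstar_eq => k /=; rewrite xax.
  by have := hy' i; have := hx' i; lra.
(* Taking adjoints swaps the two test sequences. *)
- move=> x [bx hx]; have [bax xax] := adjP bx; exists (adj x) => //; split => //.
  move=> U /weakstar_nbhsP[n [xi [eta [e [e0 hxi heta hU]]]]].
  have [x' [[bx' hx'] Nx']] := hx _ (weakstar_basic x e0 heta hxi).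
  have [y' Ny' xy'] := NS _ Nx'; exists y'; split => //; apply: hU; split => [|i].
    exact: Nb.
  rewrite (weakstar_adj (bounded_opB bx' bx)) ?nr_conj //.
  by move=> u v; rewrite !fctE innerB innerBR xax xy'.
Qed.

End WeakStar.

(** * Extension to the von Neumann algebra *)

Section IsometricExtension.
Context {R : realType} (H : hilbertType R).
Local Notation C := (R[i] : numFieldType).
Variables (T : Type) (p j : T -> H).
Hypothesis pdense : forall v, adherent (range p) v.
Hypothesis jp : forall a b, dst (j a) (j b) = dst (p a) (p b).

Let approx (v : H) (e : R) : 0 < e -> exists a, dst v (p a) < e.
Proof. by move=> e0; have [_ [a _ <-] h] := pdense v e0; exists a. Qed.

(** Only distances enter, because the map to be extended is antilinear. *)
Lemma isometric_extension : exists J : H -> H,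
  (forall u v, dst (J u) (J v) = dst u v) /\ forall a, J (p a) = j a.
Proof.
have half_gt0 n : 0 < (2^-1 : R) ^+ n by rewrite exprn_gt0 // invr_gt0.
(* The image of [v] is pinned down by its distances to all [j a], a description independent of the
   approximating sequence. *)
have : forall v, exists w, forall a, dst w (j a) = dst v (p a).
  move=> v; have /choice[a ha] : forall n, exists a, dst v (p a) < (2^-1 : R) ^+ n.
    by move=> n; exact: approx.
  have [w hw] : exists w, lims (j \o a) w.
    apply: cauchy_lims => e e0; have e2 : 0 < e / 2 by lra.
    have [N hN] := expr_half_lt e2; exists N => m n /hN hm /hN hn.
    rewrite /= jp; apply: (le_lt_trans (dst_tri v _ _)); rewrite (dstC _ v).
    have := ha m; have := ha n; lra.
  exists w => b; apply/eqP; rewrite eq_le; apply/andP; split; apply: le_eps => e e0.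
    have e2 : 0 < e / 2 by lra.
    have [N hN] := expr_half_lt e2; have [N' hN'] := hw _ e2.
    have := hN _ (leq_maxl N N'); have := hN' _ (leq_maxr N N'); have := ha (maxn N N').
    move: (maxn N N') => n h1 h2 h3; rewrite /= in h2.
    have := dst_tri (j (a n)) w (j b); rewrite (dstC w (j (a n))) jp.
    have := dst_tri v (p (a n)) (p b); rewrite (dstC (p (a n)) v); lra.
  have e2 : 0 < e / 2 by lra.
  have [N hN] := expr_half_lt e2; have [N' hN'] := hw _ e2.
  have := hN _ (leq_maxl N N'); have := hN' _ (leq_maxr N N'); have := ha (maxn N N').
  move: (maxn N N') => n h1 h2 h3; rewrite /= in h2.
  have := dst_tri w (j (a n)) (j b); rewrite jp.
  have := dst_tri (p (a n)) v (p b); lra.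
move=> /choice[J hJ]; exists J.
have Jp a : J (p a) = j a.
  by apply: dst_eps => e e0; rewrite hJ dstxx ltW.
split=> // u v; apply/eqP; rewrite eq_le; apply/andP; split; apply: le_eps => e e0.
  have e2 : 0 < e / 2 by lra.
  have [a ha] := approx v e2.
  have := dst_tri (j a) (J u) (J v); rewrite (dstC (j a)) !hJ.
  have := dst_tri v u (p a); lra.
have e2 : 0 < e / 2 by lra.
have [a ha] := approx v e2.
have := dst_tri (J v) (J u) (j a); rewrite !hJ.
have := dst_tri (p a) u v; rewrite (dstC (p a)); lra.
Qed.

End IsometricExtension.

(** * Antiunitary involutions and the induced map on operators *)

Section Conjugation.
Context {R : realType} (H : hilbertType R).
Local Notation C := (R[i] : numFieldType).

(** Antilinearity and preservation of norms are consequences, see [conj_lin] and [conj_nr]. *)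
Definition conjugation (J : H -> H) :=
  (forall u v, inner (J u) (J v) = inner v u) /\ (forall u, J (J u) = u).

Variables (J : H -> H) (hJ : conjugation J).
Let JJ : forall u, J (J u) = u := hJ.2.

Lemma conj_inner u v : inner (J u) v = inner (J v) u.
Proof. by rewrite -{1}(JJ v) hJ.1. Qed.

Lemma conj_lin (c : C) u v : J (c *: u + v) = (c^*)%C *: J u + J v.
Proof.
apply: inner_ext => w; rewrite -(JJ w) !innerDR innerZR conjcK !hJ.1.
by rewrite innerD innerZ.
Qed.

Lemma conj_nr u : nr (J u) = nr u.
Proof.
apply/eqP; rewrite -(@eqrXn2 _ 2) ?nr_ge0 //; apply/eqP/complexI.
by rewrite -!inner_nr hJ.1.
Qed.

(** Adjunction and conjugation by [J] are both antilinear, so the composite is linear; the second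
    keeps the order of products, so the composite reverses it. *)
Definition conj_adj (x : H -> H) : H -> H := J \o adj x \o J.
Local Notation F := conj_adj.

Lemma conj_adj_eq x y : bounded_op x -> adjoint x y -> F x = J \o y \o J.
Proof. by move=> bx xy; rewrite /conj_adj (adjE xy bx). Qed.

Lemma conj_op_bounded x : bounded_op x -> bounded_op (J \o x \o J).
Proof.
move=> /bounded_opP[lx [K K0 bx]]; apply/bounded_opP; split.
  by move=> c u v /=; rewrite conj_lin lx conj_lin conjcK.
by exists K => // v /=; rewrite conj_nr -[nr v]conj_nr.
Qed.

Lemma conj_op_adjoint x y : adjoint x y -> adjoint (J \o x \o J) (J \o y \o J).
Proof. by move=> xy u v /=; rewrite conj_inner -(adjoint_sym xy) -[in RHS](JJ u) hJ.1. Qed.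

Lemma conj_adj_bounded x : bounded_op x -> bounded_op (F x).
Proof. by move=> /adjP[h _]; exact: conj_op_bounded. Qed.

Lemma conj_adj_adjoint x y : bounded_op x -> bounded_op y -> adjoint x y -> adjoint (F x) (F y).
Proof.
move=> bx b_y xy; rewrite (conj_adj_eq bx xy) (conj_adj_eq b_y (adjoint_sym xy)).
exact/conj_op_adjoint/adjoint_sym.
Qed.

Lemma conj_adjK x : bounded_op x -> F (F x) = x.
Proof.
move=> bx; have [ba xa] := adjP bx.
rewrite (conj_adj_eq (conj_adj_bounded bx) (conj_op_adjoint (adjoint_sym xa))).
by apply/funext => v /=; rewrite !JJ.
Qed.

Lemma conj_adj_id : F id = id.
Proof.
rewrite (@conj_adj_eq id id); first by apply/funext => v /=; rewrite JJ.
  exact: bounded_op_id.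
by [].
Qed.

Lemma conj_adj_lin (c : C) x y : bounded_op x -> bounded_op y -> F (c *: x + y) = c *: F x + F y.
Proof.
move=> bx b_y; have [_ xa] := adjP bx; have [_ ya] := adjP b_y.
have h : adjoint (c *: x + y) ((c^*)%C *: adj x + adj y).
  by move=> u v; rewrite !fctE innerD innerZ innerDR innerZR conjcK xa ya.
rewrite (conj_adj_eq (bounded_op_lin c bx b_y) h); apply/funext => v.
by rewrite /= !fctE conj_lin conjcK.
Qed.

Lemma conj_adj_comp x y : bounded_op x -> bounded_op y -> F (x \o y) = F y \o F x.
Proof.
move=> bx b_y; have [_ xa] := adjP bx; have [_ ya] := adjP b_y.
have h : adjoint (x \o y) (adj y \o adj x) by move=> u v /=; rewrite xa ya.
rewrite (conj_adj_eq (bounded_op_comp bx b_y) h); apply/funext => v /=.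
by rewrite /conj_adj /= JJ.
Qed.

Lemma conj_adj_inner x u v : bounded_op x -> inner (F x u) v = inner (x (J v)) (J u).
Proof. by move=> /adjP[_ xa]; rewrite /= conj_inner xa. Qed.

Lemma square_summable_conj xi : square_summable xi -> square_summable (J \o xi).
Proof.
by apply: (@square_summable_bound _ _ _ _ 1) => // n; rewrite /= conj_nr mul1r.
Qed.

Lemma conj_adj_weakstar xi eta x : bounded_op x ->
  weakstar_functional xi eta (F x) = weakstar_functional (J \o eta) (J \o xi) x.
Proof. by move=> bx; apply: weakstar_eq => n; rewrite conj_adj_inner. Qed.

Lemma conj_adj_normal (N : set (H -> H)) : N `<=` @bounded_op R H -> normal_map N F.
Proof.
move=> Nb x Nx U /weakstar_nbhsP[n [xi [eta [e [e0 hxi heta hU]]]]].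
have := weakstar_basic x e0 (fun i => square_summable_conj (heta i))
          (fun i => square_summable_conj (hxi i)).
apply: weakstar_nbhsS => y [b_y hy] Ny; apply: hU; split; first exact: conj_adj_bounded.
move=> i; have bx := Nb _ Nx.
have -> : F y - F x = F (y - x).
  have := conj_adj_lin (-1) bx b_y; rewrite !scaleN1r ![- _ + _]addrC.
  by move=> ->.
by rewrite conj_adj_weakstar //; exact: bounded_opB.
Qed.

Lemma opnorm_ge (x : H -> H) v : bounded_op x -> nr (x v) <= opnorm x * nr v.
Proof.
move=> /bounded_opP[lx [K K0 bx]].
have x0 := lin0 lx; have xZ := linZ lx.
have [v0|v0] := eqVneq (nr v) 0; first by rewrite (nr_eq0 v0) x0 nr0 mulr0.
have {}v0 : 0 < nr v by rewrite lt_def v0 nr_ge0.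
rewrite -ler_pdivrMr //.
have -> : nr (x v) / nr v = nr (x ((nr v)^-1%:C *: v)).
  by rewrite xZ nrZ nr_real ger0_norm ?invr_ge0 ?nr_ge0 // mulrC.
apply: ub_le_sup.
  exists K => _ [u /= hu <-]; apply: (le_trans (bx u)).
  by rewrite nrE (lecR _ 1) in hu; rewrite ler_piMr.
exists ((nr v)^-1%:C *: v) => //=; rewrite nrE (lecR _ 1) nrZ nr_real.
by rewrite ger0_norm ?invr_ge0 ?nr_ge0 // mulVf // gt_eqF.
Qed.

Lemma opnorm_le (x : H -> H) (K : R) : 0 <= K -> (forall v, nr (x v) <= K * nr v) -> opnorm x <= K.
Proof.
move=> K0 bx; apply: ge_sup; first by exists (nr (x 0)), 0 => //=; rewrite normr0.
by move=> _ [u /= hu <-]; apply: (le_trans (bx u)); rewrite nrE (lecR _ 1) in hu; rewrite ler_piMr.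
Qed.

Lemma opnorm_ge0 (x : H -> H) : bounded_op x -> 0 <= opnorm x.
Proof.
move=> bx; have x00 : nr (x 0) = 0.
  have /bounded_opP[_ [K _ /(_ 0)]] := bx; rewrite nr0 mulr0 => h.
  by apply/eqP; rewrite eq_le h nr_ge0.
have /bounded_opP[_ [K K0 bK]] := bx.
rewrite -x00; apply: ub_le_sup; last by exists 0 => //=; rewrite normr0.
exists K => _ [u /= hu <-]; apply: (le_trans (bK u)).
by rewrite nrE (lecR _ 1) in hu; rewrite ler_piMr.
Qed.

Lemma conj_adj_opnorm x : bounded_op x -> opnorm (F x) <= opnorm x.
Proof.
move=> bx; have [ba xa] := adjP bx; apply: opnorm_le; first exact: opnorm_ge0.
move=> v; rewrite /= conj_nr -[nr v]conj_nr; move: (J v) => {}v.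
have [y0|y0] := eqVneq (nr (adj x v)) 0.
  by rewrite y0 mulr_ge0 ?nr_ge0 //; exact: opnorm_ge0.
have {}y0 : 0 < nr (adj x v) by rewrite lt_def y0 nr_ge0.
rewrite -(ler_pM2r y0) -expr2.
have -> : nr (adj x v) ^+ 2 = complex.Re (inner (adj x v) (adj x v)) by rewrite inner_nr.
rewrite -xa; apply: (le_trans (Re_le_CS _ _)).
by rewrite mulrAC ler_wpM2r ?nr_ge0 //; exact: opnorm_ge.
Qed.

End Conjugation.

(** * Weak-* density of the represented algebra in M *)

Section Representation.
Context {R : realType} (A : cstarAlgType R) (H : hilbertType R) (rep : A -> H -> H).
Hypothesis hrep : is_rep rep.
Local Notation C := (R[i] : numFieldType).

Let rep_bounded a : bounded_op (rep a). Proof. by case: hrep. Qed.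
Let rep_lin (c : C) a b v : rep (c *: a + b) v = c *: rep a v + rep b v.
Proof. by case: hrep => _ l _ _ _; rewrite l. Qed.
Let rep_one v : rep aone v = v. Proof. by case: hrep => _ _ -> _ _. Qed.
Let repM a b v : rep (a ** b) v = rep a (rep b v).
Proof. by case: hrep => _ _ _ -> _. Qed.
Let rep_adj a : adjoint (rep a) (rep (star a)). Proof. by case: hrep. Qed.

Let rep_linear v : linear (rep^~ v). Proof. by move=> c a b; exact: rep_lin. Qed.

Lemma rep0 v : rep 0 v = 0.
Proof. exact: lin0 (rep_linear v). Qed.

Lemma repZ (c : C) a v : rep (c *: a) v = c *: rep a v.
Proof. exact: linZ (rep_linear v) c a. Qed.

Lemma repB a b v : rep (a - b) v = rep a v - rep b v.
Proof. exact: linB (rep_linear v) a b. Qed.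

(* If [1 - y* y = w^2] with [w] self-adjoint then [|y v|^2 + |w v|^2 = |v|^2]. *)
Lemma rep_nr_le a v : nr (rep a v) <= 2 * nr a * nr v.
Proof.
have [t [y [t0 ta ny aE]]] := normalize a.
have nyv : nr (rep y v) <= nr v.
  have s1 : star (star y ** y) = star y ** y by rewrite starM starK.
  have n1 : nr (star y ** y) <= 2^-1.
    by rewrite nr_cstar; have := nr_ge0 y => h; nra.
  have [w [sw ww _]] := sqrt_one_sub s1 n1.
  have e : nr (rep y v) ^+ 2 + nr (rep w v) ^+ 2 = nr v ^+ 2.
    apply: complexI; rewrite rmorphD /= -!inner_nr !rep_adj -!repM sw ww -innerDR.
    by rewrite repB rep_one addrC subrK.
  rewrite -(@ler_pXn2r _ 2) ?nnegrE ?nr_ge0 // -e lerDl sqr_ge0 //.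
rewrite {1}aE repZ nrZ nr_real ger0_norm //.
by apply: ler_pM => //; exact: nr_ge0.
Qed.

Lemma range_rep_bounded : range rep `<=` @bounded_op R H.
Proof. by move=> _ [a _ <-]. Qed.

Local Notation M := (von_neumann_gen (range rep)).

Lemma rep_in_gen a : M (rep a).
Proof. by apply: gen_sub; exists a. Qed.

(** The closure on the right is itself a von Neumann algebra containing [range rep], so minimality
    of [M] applies. *)
Lemma gen_weakstar_closure : M `<=` weakstar_closure (range rep).
Proof.
have [_ lrep r1 rM radj] := hrep.
apply: gen_min; last exact: sub_weakstar_closure range_rep_bounded.
apply: weakstar_closure_von_neumann; first exact: range_rep_bounded.
- split; first by exists 0 => //; apply/funext => v; rewrite rep0.
  by move=> c _ _ [a _ <-] [b _ <-]; exists (c *: a + b); last exact: lrep.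
- by exists aone; last exact: r1.
- by move=> _ _ [a _ <-] [b _ <-]; exists (a ** b); last exact: rM.
- by move=> _ [a _ <-]; exists (rep (star a)); [exists (star a)|exact: rep_adj].
Qed.

Lemma gen_bounded : M `<=` @bounded_op R H.
Proof. by move=> x /gen_weakstar_closure[]. Qed.

Lemma gen_von_neumann : is_von_neumann M.
Proof. exact: von_neumann_genP range_rep_bounded. Qed.

Lemma gen_approx x U : M x -> weakstar_nbhs x U -> exists2 a, U (rep a) & M (rep a).
Proof.
move=> /gen_weakstar_closure[_ hx] /hx[y [Uy [a _ ay]]].
by exists a; [rewrite ay|exact: rep_in_gen].
Qed.

(** A single [a] can be chosen so that [F (rep a)] is close to [F x] and [G (rep a)] to [G x] in a
    given matrix coefficient; matrix coefficients separate operators. *)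
Lemma normal_maps_agree (F G : (H -> H) -> (H -> H)) :
  (forall x, M x -> M (F x)) -> (forall x, M x -> M (G x)) ->
  normal_map M F -> normal_map M G -> (forall a, F (rep a) = G (rep a)) ->
  forall x, M x -> F x = G x.
Proof.
move=> MF MG nF nG FG x Mx; apply/funext => u; apply: inner_ext => v.
rewrite inner_conj [RHS]inner_conj; congr ((_^*)%C); apply: dst_eps => e e0.
have e2 : 0 < e / 2 by lra.
have bF := gen_bounded (MF _ Mx); have bG := gen_bounded (MG _ Mx).
have h1 := nF x Mx _ (weakstar_nbhs_point u v e2 bF).
have h2 := nG x Mx _ (weakstar_nbhs_point u v e2 bG).
have [a [k1 k2] Ma] := gen_approx Mx (weakstar_nbhsI h1 h2).
have [_ l1] := k1 Ma; have [_ l2] := k2 Ma; rewrite /= FG in l1.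
apply: (le_trans (dst_tri (inner (G (rep a) u) v) _ _)); rewrite dstC.
by rewrite /dst; lra.
Qed.

Lemma normal_functionals_agree (f g : (H -> H) -> R[i]) :
  normal_functional M f -> normal_functional M g -> (forall a, f (rep a) = g (rep a)) ->
  forall x, M x -> f x = g x.
Proof.
move=> nf ng fg x Mx; apply: dst_eps => e e0.
have e2 : 0 < e / 2 by lra.
have bC (c : R[i]) : nbhs c (ball c (e / 2)%:C) by apply: nbhsx_ballx; rewrite ltcR.
have h1 := nf x Mx _ (bC _); have h2 := ng x Mx _ (bC _).
have [a [k1 k2] Ma] := gen_approx Mx (weakstar_nbhsI h1 h2).
have := k1 Ma; have := k2 Ma; rewrite /= !ball_nrE fg => l1 l2.
by apply: (le_trans (dst_tri (g (rep a)) _ _)); rewrite (dstC _ (g x)); lra.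
Qed.

Lemma normal_map_comp (F G : (H -> H) -> (H -> H)) :
  (forall x, M x -> M (F x)) -> normal_map M F -> normal_map M G -> normal_map M (G \o F).
Proof.
move=> MF nF nG x Mx U hU; have h := nF x Mx _ (nG _ (MF _ Mx) _ hU).
by apply: weakstar_nbhsS h => y /= hy My; apply: hy => //; exact: MF.
Qed.

Lemma normal_functional_comp (F : (H -> H) -> (H -> H)) (g : (H -> H) -> R[i]) :
  (forall x, M x -> M (F x)) -> normal_map M F -> normal_functional M g ->
  normal_functional M (g \o F).
Proof.
move=> MF nF ng x Mx U hU; have h := nF x Mx _ (ng _ (MF _ Mx) _ hU).
by apply: weakstar_nbhsS h => y /= hy My; apply: hy => //; exact: MF.
Qed.

Lemma bounded_eq_dense (x y : H -> H) (D : set H) : bounded_op x -> bounded_op y ->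
  (forall v, adherent D v) -> (forall v, D v -> x v = y v) -> x = y.
Proof.
move=> /bounded_opP[lx [K K0 bx]] /bounded_opP[ly [L L0 b_y]] hD xy.
have xB := linB lx; have yB := linB ly.
apply/funext => v; apply: dst_eps => e e0.
have e1 : 0 < e / (K + L + 1) by rewrite divr_gt0 //; lra.
have [p Dp] := hD v _ e1; rewrite ltr_pdivlMr; last lra.
move=> hp; apply: (le_trans (dst_tri (x p) _ _)); rewrite [in X in _ + X]xy //.
have h1 : dst (x v) (x p) <= K * dst v p by rewrite !dstE_hilb -xB.
have h2 : dst (y p) (y v) <= L * dst v p by rewrite dstC !dstE_hilb -yB.
have := dst_ge0 v p; nra.
Qed.

End Representation.

(** * The involution on the GNS space *)

Section GNS.
Context {R : realType} (A : cstarAlgType R) (h : A -> R[i]) (H : hilbertType R).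
Variables (rep : A -> H -> H) (Omega : H).
Hypothesis hgns : is_gns h rep Omega.
Local Notation C := (R[i] : numFieldType).
Local Notation M := (von_neumann_gen (range rep)).

Let hrep : is_rep rep. Proof. by case: hgns. Qed.
Let rep_adj a : adjoint (rep a) (rep (star a)). Proof. by case: hrep. Qed.
Let repM a b v : rep (a ** b) v = rep a (rep b v).
Proof. by case: hrep => _ _ _ -> _. Qed.
Let rep_bounded a : bounded_op (rep a). Proof. by case: hrep. Qed.

Lemma gns_adherent v : adherent (range (rep^~ Omega)) v.
Proof.
move=> e e0; have [_ dns _] := hgns.
have bv : nbhs v (ball v (e%:C : C)) by apply: nbhsx_ballx; rewrite ltcR.
have [|w [/interior_subset hw [a _ aw]]] := dns (interior (ball v (e%:C : C))) _ (open_interior _).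
  by exists v.
by exists w; [exists a|rewrite -ball_nrE].
Qed.

Lemma gns_inner a b : inner (rep a Omega) (rep b Omega) = h (star b ** a).
Proof.
have [_ _ hh] := hgns.
by rewrite -hh repM; rewrite (adjoint_sym (rep_adj b)).
Qed.

(** Boundedness of [h] comes from its form as the vector functional of [Omega] and the bound on
    [rep]; it lets invariance pass from polynomials to [A]. *)
Lemma gns_nr_le a : nr (h a) <= 2 * nr a * nr Omega * nr Omega.
Proof.
have [_ _ <-] := hgns; apply: (le_trans (cauchy_schwarz _ _)).
by rewrite ler_wpM2r ?nr_ge0 // rep_nr_le.
Qed.

Variable f : A -> A.
Hypotheses (lf : linear f)
  (fM : forall x y, f (x ** y) = f y ** f x) (fS : forall x, f (star x) = star (f x))
  (fK : forall x, f (f x) = x) (hf : forall x, h (f x) = h x).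

(** On the dense vectors, antimultiplicativity and invariance give <j a, j b> = h (star a ** b) = <p
    b, p a>; the reversal of arguments is antiunitarity. *)
Lemma gns_conjugation : exists J : H -> H,
  conjugation J /\ forall a, J (rep a Omega) = rep (f (star a)) Omega.
Proof.
pose p a := rep a Omega; pose j a := rep (f (star a)) Omega.
have jin a b : inner (j a) (j b) = inner (p b) (p a).
  by rewrite !gns_inner -fS -fM starK hf.
have jp a b : dst (j a) (j b) = dst (p a) (p b).
  have jB : j a - j b = j (a - b) by rewrite /j starB (linB lf) repB.
  have pB : p a - p b = p (a - b) by rewrite /p repB.
  rewrite !dstE_hilb jB pB; apply/eqP; rewrite -(@eqrXn2 _ 2) ?nr_ge0 //.
  by apply/eqP/complexI; rewrite -!inner_nr jin.
have [J [Jd Jp]] := isometric_extension gns_adherent jp.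
have J0 : J 0 = 0.
  have := Jp 0; rewrite /j star0 (lin0 lf) !rep0 //.
have Jn u : nr (J u) = nr u by rewrite -!dstx0 -{1}J0 Jd.
exists J; split; last by move=> a; rewrite Jp.
split; last first.
  move=> u; apply: dst_eps => e e0; have e2 : 0 < e / 2 by lra.
  have [_ [a _ <-] ha] := gns_adherent u e2.
  have JJa : J (J (rep a Omega)) = rep a Omega by rewrite Jp Jp /j -fS starK fK.
  apply: (le_trans (dst_tri (J (J (rep a Omega))) _ _)); rewrite !Jd JJa (dstC _ u); lra.
have inner_dst (u u' v v' : H) : nr (inner u v - inner u' v') <= nr u * dst v v' + dst u u' * nr v'.
  have -> : inner u v - inner u' v' = inner u (v - v') + inner (u - u') v'.
    by rewrite innerBR innerB addrA subrK.
  by apply: (le_trans (nrD _ _)); apply: lerD; exact: cauchy_schwarz.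
move=> u v; apply: dst_eps => e e0.
(* The four error terms add up to at most [2 * d * (nr u + nr v + d)], which is below [d * k] as
   [d <= 1]. *)
pose k := 2 * (nr u + nr v + 1).
have k0 : 0 < k by rewrite mulr_gt0 //; have := nr_ge0 u; have := nr_ge0 v; lra.
pose d := Num.min 1 (e / k).
have d0 : 0 < d by rewrite lt_min ltr01 divr_gt0.
have d1 : d <= 1 by rewrite ge_min lexx.
have dk : d * k <= e by rewrite -ler_pdivlMr // ge_min lexx orbT.
have [_ [a _ <-] ha] := gns_adherent u d0; have [_ [b _ <-] hb] := gns_adherent v d0.
have E : inner (J (rep a Omega)) (J (rep b Omega)) = inner (rep b Omega) (rep a Omega).
  by rewrite !Jp jin.
apply: (le_trans (dst_tri (inner (rep b Omega) (rep a Omega)) _ _)).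
rewrite -{1}E (dstC (inner (rep b Omega) _)).
have i1 := inner_dst (J u) (J (rep a Omega)) (J v) (J (rep b Omega)).
have i2 := inner_dst v (rep b Omega) u (rep a Omega).
rewrite !Jd !Jn in i1.
apply: (le_trans (lerD i1 i2)).
have na : nr (rep a Omega) <= nr u + d.
  by have := dst_tri u (rep a Omega) 0; rewrite !dstx0 (dstC _ u); lra.
have nb : nr (rep b Omega) <= nr v + d.
  by have := dst_tri v (rep b Omega) 0; rewrite !dstx0 (dstC _ v); lra.
have h1 : nr u * dst v (rep b Omega) <= nr u * d by apply: ler_wpM2l; [exact: nr_ge0|exact: ltW].
have h2 : nr v * dst u (rep a Omega) <= nr v * d by apply: ler_wpM2l; [exact: nr_ge0|exact: ltW].
have h3 : dst u (rep a Omega) * nr (rep b Omega) <= d * (nr v + d).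
  by apply: ler_pM; rewrite ?dst_ge0 ?nr_ge0 // ltW.
have h4 : dst v (rep b Omega) * nr (rep a Omega) <= d * (nr u + d).
  by apply: ler_pM; rewrite ?dst_ge0 ?nr_ge0 // ltW.
apply: le_trans dk; rewrite /k; clear -h1 h2 h3 h4 d0 d1.
have : d * d <= d * 1 by apply: ler_wpM2l => //; exact: ltW.
lra.
Qed.

Variables (J : H -> H) (hJ : conjugation J).
Hypothesis hJf : forall a, J (rep a Omega) = rep (f (star a)) Omega.

(** Both operators are bounded, so vectors [rep b Omega] suffice; there
    [f (star (star a ** f (star b)))] reduces to [f a ** b]. *)
Lemma conj_adj_rep a : conj_adj J (rep a) = rep (f a).
Proof.
rewrite (conj_adj_eq J (rep_bounded a) (rep_adj a)).
apply: (bounded_eq_dense _ (rep_bounded (f a)) gns_adherent).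
  exact: conj_op_bounded.
move=> _ [b _ <-] /=; rewrite hJf -repM hJf -repM.
by rewrite starM starK fM -fS starK fK.
Qed.

Lemma conj_adj_gen x : M x -> M (conj_adj J x).
Proof.
have Mb := @gen_bounded _ _ _ _ hrep.
have [_ [[M0 MD] M1] MM MS Mcl] := gen_von_neumann hrep.
(* By minimality of [M] it suffices that [N] is a von Neumann algebra. Normality of the map is
   relative to [M], which is why [M x] is kept in [N]: approximants from [N] can then be used in the
   closedness clause. *)
pose N := [set x | M x /\ M (conj_adj J x)].
suff MN : M `<=` N by move=> /MN[].
have cn := conj_adj_normal hJ Mb.
apply: gen_min; last first.
  by move=> _ [a _ <-]; split; rewrite ?conj_adj_rep; exact: rep_in_gen.
split.
- by move=> y [/Mb].
- split; last by split => //; rewrite conj_adj_id.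
  split.
    split => //; have := conj_adj_lin hJ 1 (bounded_op0 H) (bounded_op0 H).
    rewrite !scale1r addr0 => /eqP; rewrite -subr_eq subrr eq_sym => /eqP ->.
    exact: M0.
  move=> c y z [My My'] [Mz Mz']; split; first exact: MD.
  by rewrite (conj_adj_lin hJ); [exact: MD|exact: Mb..].
- move=> y z [My My'] [Mz Mz']; split; first exact: MM.
  by rewrite (conj_adj_comp hJ); [exact: MM|exact: Mb..].
- move=> y [My My']; have [z Mz yz] := MS _ My; exists z => //; split => //.
  have [w Mw yw] := MS _ My'; have h' := conj_adj_adjoint hJ (Mb _ My) (Mb _ Mz) yz.
  by rewrite (adjoint_unique h' yw).
- move=> y b_y hy.
  have My : M y by apply: Mcl => // U /hy[z [Uz [Mz _]]]; exists z.
  split => //; apply: Mcl => [|U hU]; first exact: conj_adj_bounded.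
  by have [z [Uz [Mz Mz']]] := hy _ (cn y My U hU); exists (conj_adj J z); split => //; exact: Uz.
Qed.

End GNS.

Lemma star_hom_pol (R : realType) (A : cstarAlgType R) (alpha gamma : A) (theta : A -> A) :
  star_hom theta -> pol alpha gamma (theta alpha) -> pol alpha gamma (theta gamma) ->
  forall x, pol alpha gamma x -> pol alpha gamma (theta x).
Proof.
move=> [lt t1 tM tS] Pa Pg; have [[P0 PD] P1 PM PS] := @pol_subalgebra R A alpha gamma.
apply: pol_ind => //; split; [split| | |].
- by rewrite /= (lin0 lt).
- by move=> k x y /= hx hy; rewrite lt; exact: PD.
- by rewrite /= t1.
- by move=> x y /= hx hy; rewrite tM; exact: PM.
- by move=> x /= hx; rewrite tS; exact: PS.
Qed.

Theorem theorem3p39 (R : realType) (q : R[i]) (hq0 : 0 < `|q|) (hq1 : `|q| < 1)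
  (* the C*-algebra A, its polynomial *-subalgebra and the circle action *)
  (A : cstarAlgType R) (alpha gamma : A) (hA : is_universal_suq2 q alpha gamma)
  (rho : A -> R[i] -> A) (hrho : is_circle_coaction alpha gamma rho)
  (* antipode, scaling group and residual mapping on pol alpha gamma *)
  (SA : A -> A) (hSA : is_antipode q alpha gamma rho SA)
  (tau : R[i] -> A -> A) (htau : is_scaling q alpha gamma rho tau)
  (vartheta : A -> A) (hvartheta : is_residual q alpha gamma rho vartheta)
  (* the bosonization B, its comultiplication and its Haar state *)
  (B : cstarAlgType R) (alphaB gammaB z : B)
  (hB : is_universal_boson q alphaB gammaB z)
  (BB : cstarAlgType R) (i1 i2 : B -> BB) (hBB : is_cstar_tensor i1 i2)
  (Delta : B -> BB)
  (hDelta : is_comultiplication q i1 i2 alphaB gammaB z Delta)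
  (haarB : B -> R[i]) (hhaarB : is_haar_state i1 i2 Delta haarB)
  (kappa : A -> B) (hkappa : star_hom kappa)
  (hkappa_alpha : kappa alpha = alphaB) (hkappa_gamma : kappa gamma = gammaB)
  (* GNS representation of h, the extensions of h and of the circle action *)
  (H : hilbertType R) (rep : A -> H -> H) (Omega : H)
  (hgns : is_gns (haarB \o kappa) rep Omega)
  (hM : (H -> H) -> R[i])
  (hhM : is_normal_extension rep (von_neumann_gen (range rep))
           (haarB \o kappa) hM)
  (rhoM : R[i] -> (H -> H) -> (H -> H))
  (hrhoM : is_action_extension rep (von_neumann_gen (range rep))
             (rho_at rho) rhoM) :
  let P := pol alpha gamma in
  let h := haarB \o kappa in
  let M := von_neumann_gen (range rep) in
  let Rant := SA \o tau ('i%C / 2) \o vartheta in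
  let c := cpow (zeta q) 2^-1 * ((q^*)%C / `|q|) in
  [/\ (forall a, P a -> P (Rant a)),
      [/\ Rant aone = aone,
          linear_on P Rant,
          (forall a, P a -> Rant (star a) = star (Rant a))
        & (forall a b, P a -> P b -> Rant (a ** b) = Rant b ** Rant a)],
      [/\ Rant alpha = star alpha,
          Rant (star alpha) = alpha,
          Rant gamma = - (c *: gamma)
        & Rant (star gamma) = - (c *: star gamma)],
      [/\ set_bij P P Rant,
          (forall a, P a -> Rant (Rant a) = a),
          (forall a, P a -> h (Rant a) = h a)
        & (forall l a, circle l -> P a ->
             Rant (rho_at rho l a) = rho_at rho l (Rant a))]
    & exists RA : A -> A,
      [/\ (forall a, P a -> RA a = Rant a),
          [/\ bounded_map RA,
              linear RA,
              RA aone = aone,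
              (forall a, RA (star a) = star (RA a))
            & (forall a b, RA (a ** b) = RA b ** RA a)],
          [/\ (forall a, RA (RA a) = a),
              (forall a, h (RA a) = h a)
            & (forall l a, circle l ->
                 RA (rho_at rho l a) = rho_at rho l (RA a))]
        & exists RM : (H -> H) -> (H -> H),
          [/\ (forall a, RM (rep a) = rep (RA a)),
              (forall x, M x -> M (RM x)),
              [/\ (exists K : R, forall x, M x -> opnorm (RM x) <= K * opnorm x),
                  normal_map M RM,
                  linear_on M RM
                & RM id = id],
              [/\ adjoint_preserving M RM
                & (forall x y, M x -> M y -> RM (x \o y) = RM y \o RM x)]
            & [/\ (forall x, M x -> RM (RM x) = x),
                  (forall x, M x -> hM (RM x) = hM x)
                & (forall l x, circle l -> M x ->
                     RM (rhoM l x) = rhoM l (RM x))]]]].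
Proof.
move=> P h M Rant c.
have q0 : q != 0 by rewrite -normr_gt0.
have [[P0 PD] P1 PM PS] := @pol_subalgebra R A alpha gamma.
(* The flip multiplies [gamma] by [- c], so [flip_exists] is applied to that constant. *)
have cr : ((- c)^*)%C = - c by rewrite rmorphN /= (antipode_const_real hq0).
have cc : - c * - c = 1 by rewrite mulrNN (antipode_const_sqr hq0).
have [f [lf f1 fM fS [fa fg fK fb]]] := flip_exists q0 hA cr cc.
(* From here on [Rant] is seen only through [f], which has its properties on all of [A]. *)
have RantE a : P a -> Rant a = f a.
  by move=> Pa; rewrite (Rant_flip hq0 hrho hSA htau hvartheta lf f1 fM fS fa fg).
have [_ ra rsa rg rsg] := Rant_gens hq0 hrho hSA htau hvartheta.
have Pf x : P x -> P (f x) by exact: (flip_pol lf f1 fM fS fa fg).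
have [[lhB _ _] _] := hhaarB; have [lk _ _ _] := hkappa.
have lh : scalar h by move=> k x y; rewrite /h /= lk lhB.
have hfP x : P x -> h (f x) = h x.
  apply: (flip_haar_pol q0 hA lf f1 fM fS fK fa cr cc fg lh).
    exact: (haar_right hA hB hBB hDelta hhaarB hkappa hkappa_alpha hkappa_gamma).
  exact: (haar_left hA hB hBB hDelta hhaarB hkappa hkappa_alpha hkappa_gamma).
have hf x : h (f x) = h x.
  have hsub := formB lh.
  have [K K0 hK] : exists2 K : R, 0 <= K & forall u, nr (h u) <= K * nr u.
    exists (2 * nr Omega * nr Omega) => [|u]; first by rewrite !mulr_ge0 // nr_ge0.
    rewrite (_ : _ * nr u = 2 * nr u * nr Omega * nr Omega); first exact: gns_nr_le hgns u.
    by ring.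
  apply: dst_eps => e e0.
  (* The defect is at most [3 * K] times the distance to a polynomial: [2 * K] through [f], and [K]
     through [h] alone. *)
  have e1 : 0 < e / (3 * K + 1) by rewrite divr_gt0 //; lra.
  have [p Pp hp] := pol_dense hA x e1; rewrite ltr_pdivlMr in hp; last lra.
  have k1 : dst (h (f x)) (h p) <= 2 * K * dst x p.
    rewrite -(hfP p Pp) /dst -hsub -(linB lf); apply: (le_trans (hK _)).
    by rewrite (mulrC 2) -[X in _ <= X]mulrA; apply: ler_wpM2l; rewrite ?fb.
  have k2 : dst (h p) (h x) <= K * dst x p.
    by rewrite dstC /dst -hsub; exact: hK.
  apply: (le_trans (dst_tri (h p) _ _)); have := dst_ge0 x p; lra.
have rho_hom l : circle l -> star_hom (rho_at rho l).
  by move=> hl; case: hrho => _ hr _ _; apply: hr; rewrite /circle /= normfV hl invr1.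
have rho_alpha l : circle l -> rho_at rho l alpha = alpha.
  by move=> hl; case: hrho => _ _ hr _; apply: hr; rewrite /circle /= normfV hl invr1.
have rho_gamma l : circle l -> rho_at rho l gamma = l^-1 *: gamma.
  by move=> hl; case: hrho => _ _ _ hr; apply: hr; rewrite /circle /= normfV hl invr1.
(* The circle acts with phase 1 on [alpha] and [l^-1] on [gamma], hence by a torus element that
   conjugation by [f] leaves unchanged. *)
have f_rho l a : circle l -> f (rho_at rho l a) = rho_at rho l (f a).
  move=> hl; apply: (flip_torus hA lf f1 fM fS fK fa cc fg (rho_hom l hl) (rho_hom l hl)
    (mu := 1) (nu := l^-1)); rewrite ?conjc1 ?scale1r; by [exact: rho_alpha|exact: rho_gamma].
have Prho l a : circle l -> P a -> P (rho_at rho l a).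
  move=> hl; apply: star_hom_pol; first exact: rho_hom.
    by rewrite rho_alpha //; exact: pol_alpha.
  rewrite rho_gamma //; have := PD l^-1 _ _ (@pol_gamma R A alpha gamma) P0.
  by rewrite addr0.
split.
- by move=> a Pa; rewrite RantE //; exact: Pf.
- split.
  + by rewrite RantE.
  + by move=> k x y Px Py; rewrite !RantE ?lf //; exact: PD.
  + by move=> a Pa; rewrite !RantE ?fS //; exact: PS.
  + by move=> a b Pa Pb; rewrite !RantE ?fM //; exact: PM.
- by split.
- split.
  + split.
    * by move=> a Pa; rewrite /= RantE //; exact: Pf.
    * move=> a b /set_mem Pa /set_mem Pb; rewrite !RantE // => /(congr1 f).
      by rewrite !fK.
    * by move=> a Pa; exists (f a); [exact: Pf|rewrite RantE ?fK //; exact: Pf].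
  + by move=> a Pa; rewrite RantE ?RantE ?fK //; exact: Pf.
  + by move=> a Pa; rewrite RantE // hf.
  + by move=> l a hl Pa; rewrite !RantE ?f_rho //; exact: Prho.
exists f; split.
- by move=> a Pa; rewrite RantE.
- split => //; exists 2 => x; rewrite !nrE -rmorphM /= lecR; exact: fb.
- by split.
have hrep : is_rep rep by case: hgns.
have [J [hJ hJf]] := gns_conjugation hgns lf fM fS fK hf.
have FE := conj_adj_rep hgns fM fS fK hJ hJf.
have MF := conj_adj_gen hgns fM fS fK hJ hJf.
have Mb := gen_bounded hrep; have nF := conj_adj_normal hJ Mb.
have [_ nh hME] := hhM.
exists (conj_adj J); split => //.
- split => //.
  + by exists 1 => x Mx; rewrite mul1r; apply: conj_adj_opnorm => //; exact: Mb.
  + by move=> k x y Mx My; apply: conj_adj_lin => //; exact: Mb.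
  + exact: conj_adj_id.
- split.
  + by move=> x y Mx My; apply: conj_adj_adjoint => //; exact: Mb.
  + by move=> x y Mx My; apply: conj_adj_comp => //; exact: Mb.
- split.
  + by move=> x Mx; apply: conj_adjK => //; exact: Mb.
  (* Both functionals are normal on [M], and on the image of [A] the claim is the invariance of
     [h]. *)
  + apply: (normal_functionals_agree hrep (f := hM \o conj_adj J) _ nh).
      exact: (normal_functional_comp MF nF nh).
    by move=> a; rewrite /= FE !hME; exact: hf.
  + move=> l x hl Mx.
    have Mrho y : M y -> M (rhoM l y) by move=> My; exact: (action_maps hrhoM).
    have nrho := action_normal hrhoM hl.
    apply: (normal_maps_agree hrep (F := conj_adj J \o rhoM l) (G := rhoM l \o conj_adj J)).
    * by move=> y My; apply: MF; exact: Mrho.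
    * by move=> y My; apply: Mrho; exact: MF.
    * exact: (normal_map_comp Mrho nrho nF).
    * exact: (normal_map_comp MF nF nrho).
    * by move=> a /=; rewrite (action_extends hrhoM) // !FE (action_extends hrhoM) // f_rho.
    * exact: Mx.
Qed.
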